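(* Let $K$ be an algebraically closed field, let $(Q,S)$ be a reduced quiver with potential over $K$, and let $k\in Q_0$ be a vertex such that $Q$ has no 2-cycles at $k$ and no cycle occurring in $S$ begins at $k$. Let $\Lambda=\mathcal{P}(Q,S)$ and $\Lambda'=\mathcal{P}(\mu_k(Q,S))$ be the Jacobian algebras, let $S_k$ and $S'_k$ be the simple modules at $k$ over $\Lambda$ and $\Lambda'$ respectively, and let $$\mu_k^+:\Lambda\text{-mod}/[\operatorname{add} S_k]\longrightarrow \Lambda'\text{-mod}/[\operatorname{add} S'_k],\qquad \mu_k^-:\Lambda'\text{-mod}/[\operatorname{add} S'_k]\longrightarrow \Lambda\text{-mod}/[\operatorname{add} S_k]$$ be the mutation functors defined in the context. Then $\mu_k^-$ is a quasi-inverse of $\mu_k^+$; that is, there are natural isomorphisms of functors $\mu_k^-\mu_k^+\cong \mathrm{id}$ on $\Lambda\text{-mod}/[\operatorname{add} S_k]$ and $\mu_k^+\mu_k^-\cong\mathrm{id}$ on $\Lambda'\text{-mod}/[\operatorname{add} S'_k]$.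
   Context: **Quivers and path algebras.** A quiver $Q=(Q_0,Q_1,t,h)$ has finitely many vertices and arrows; an arrow $a$ goes $a:t(a)\to h(a)$. A path $a_l\cdots a_1$ satisfies $t(a_{i+1})=h(a_i)$ (composition from right to left); it is a cycle if $h(a_l)=t(a_1)$. $R=\prod_{i\in Q_0}K$ is the vertex space, $A$ the arrow space ($R$-bimodule with basis $Q_1$), and $K\langle\langle Q\rangle\rangle=\prod_{l\ge 0}A^{l}$ ($A^l$ the $l$-fold tensor power over $R$) is the complete path algebra, whose elements are possibly infinite linear combinations of paths, with the $\mathfrak M$-adic topology, $\mathfrak M=\prod_{l\ge1}A^l$. Homomorphisms of $R$-algebras between complete path algebras on the same vertex set are $K$-algebra homomorphisms that are the identity on $R$. **Potentials.** A potential is a possibly infinite $K$-linear combination of cycles. Two potentials $S,W$ are cyclically equivalent, $S\sim_{\rm cyc}W$, if $S-W$ lies in the closure of the span of all $a_1a_2\cdots a_n-a_2\cdots a_na_1$ with $a_1\cdots a_n$ a cycle. A quiver with potential (QP) is a pair $(Q,S)$ with $Q$ without loops, $S$ a potential, no two different cycles appearing in $S$ with non-zero coefficient being cyclically equivalent. For an arrow $a$, $\partial_a(a_n\cdots a_1)=\sum_{i}\delta_{a,a_i}\,a_{i-1}\cdots a_1a_n\cdots a_{i+1}$, extended linearly and continuously. $\mathcal J(Q,S)$ is the closure of the two-sided ideal generated by all $\partial_a(S)$, and the Jacobian algebra is $\mathcal P(Q,S)=K\langle\langle Q\rangle\rangle/\mathcal J(Q,S)$. $(Q,S)$ is reduced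 if $S$ has no cycles of length 2, and trivial if the $R$-bimodule generated by the $\partial_a(S)$ ($a\in Q_1$) is $A$. A right-equivalence $(Q,S)\to(Q',S')$ is an $R$-algebra isomorphism $\phi:K\langle\langle Q\rangle\rangle\to K\langle\langle Q'\rangle\rangle$ with $\phi(S)\sim_{\rm cyc}S'$. Splitting theorem (known): for every QP $(P,T)$ there are a trivial QP $(P_{\rm triv},T_{\rm triv})$, a reduced QP $(P_{\rm red},T_{\rm red})$ and a right-equivalence $\phi:K\langle\langle P_{\rm triv}\oplus P_{\rm red}\rangle\rangle\to K\langle\langle P\rangle\rangle$ with $\phi(T_{\rm triv}+T_{\rm red})\sim_{\rm cyc}T$; its restriction $\phi_r$ to $K\langle\langle P_{\rm red}\rangle\rangle$ induces an isomorphism $\mathcal P(P_{\rm red},T_{\rm red})\cong\mathcal P(P,T)$. For a $\mathcal P(P,T)$-module $M$, its reduced part $M_{\rm red}$ is $M$ viewed as a $\mathcal P(P_{\rm red},T_{\rm red})$-module via $\phi_r$. **Modules.** For a Jacobian algebra $\Gamma$, $\Gamma$-mod is the category of finite-dimensional left modules, identified with the (nilpotent) finite-dimensional representations $((M_i)_i,(M_a)_a)$ of the quiver satisfying the relations $\partial_a$ of the potential. $[\operatorname{add}S_k]$ is the ideal of morphisms factoring through finite direct sums of $S_k$; it consists exactly of the morphisms $f$ with $f_i=0$ for all $i\ne k$ (morphisms confined to $k$). **Pre-mutation of QPs, with sign $s\in\{+1,-1\}$.** Let $(P,T)$ be a QP such that $P$ has no 2-cycles at $k$ and no cycle in $T$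 begins at $k$. $\widetilde\mu_k(P)$ is obtained from $P$ by (1) adding, for each pair of arrows $a:j\to k$, $b:k\to i$, an arrow $[ba]:j\to i$; (2) replacing each $a:j\to k$ by $a^*:k\to j$ and each $b:k\to i$ by $b^*:i\to k$. Put $$\widetilde\mu_k^{s}(P,T)=\Big(\widetilde\mu_k(P),\ [T]+s\sum_{h(a)=k=t(b)}[ba]a^*b^*\Big),$$ where $[T]$ is obtained from $T$ by replacing each occurrence of a factor $ba$ with $h(a)=k=t(b)$ by $[ba]$. Define $\mu_k(P,T)$ as the reduced part of $\widetilde\mu_k^{+}(P,T)$. **Pre-mutation of representations.** Let $M$ be a finite-dimensional module over $\mathcal P(P,T)$. Let $a_1,\dots,a_r$ be the distinct arrows with head $k$ and $b_1,\dots,b_t$ the distinct arrows with tail $k$. Put $M_{\rm in}=\bigoplus_pM_{t(a_p)}$, $M_{\rm out}=\bigoplus_qM_{h(b_q)}$, let $\alpha_M=(M_{a_1},\dots,M_{a_r}):M_{\rm in}\to M_k$, $\beta_M=(M_{b_1},\dots,M_{b_t})^{T}:M_k\to M_{\rm out}$, and let $\gamma_M:M_{\rm out}\to M_{\rm in}$ have components $\partial_{b_qa_p}(T):M_{h(b_q)}\to M_{t(a_p)}$, where $\partial_{ba}(c_1\cdots c_n)=\sum_j\delta_{ba,\,c_jc_{j+1}}c_{j+2}\cdots c_nc_1\cdots c_{j-1}$, extended linearly and continuously. One has $\alpha_M\gamma_M=0$ and $\gamma_M\beta_M=0$. Choose for each $M$ a retraction $\rho_M:M_{\rm out}\to\ker\gamma_M$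 of the inclusion and a section $\sigma_M:\ker\alpha_M/\operatorname{im}\gamma_M\to\ker\alpha_M$ of the projection. Then $\overline M=\widetilde\mu_k^{s}(M)$ is the $\mathcal P(\widetilde\mu_k^{s}(P,T))$-module with $\overline M_i=M_i$ for $i\ne k$, $$\overline M_k=\frac{\ker\gamma_M}{\operatorname{im}\beta_M}\oplus\operatorname{im}\gamma_M\oplus\frac{\ker\alpha_M}{\operatorname{im}\gamma_M};$$ arrows of $P$ not incident to $k$ act as on $M$; $[b_qa_p]$ acts as $M_{b_q}M_{a_p}$; and the arrows $b_q^*$ and $a_p^*$ act as the components of $$(b_1^*,\dots,b_t^* )=\begin{pmatrix}-s\,\pi\rho_M\\-s\,\gamma_M\\0\end{pmatrix}:M_{\rm out}\to\overline M_k,\qquad (a_1^*,\dots,a_r^* )^{T}=(0,\iota,\iota\sigma_M):\overline M_k\to M_{\rm in},$$ with $\pi$, $\iota$ the natural projections and inclusions. **Morphisms.** For $f:M\to N$ in $\mathcal P(P,T)$-mod let $f_{\rm in}:M_{\rm in}\to N_{\rm in}$, $f_{\rm out}:M_{\rm out}\to N_{\rm out}$ be the induced maps, $f_{\rm in}$ also denoting the restriction $\ker\alpha_M\to\ker\alpha_N$, and $\overline{f_{\rm out}}:\operatorname{coker}\beta_M\to\operatorname{coker}\beta_N$. Let $\widetilde i_M:\ker\gamma_M/\operatorname{im}\beta_M\to\operatorname{coker}\beta_M$ be the inclusion, $\widetilde\gamma_M:\operatorname{coker}\beta_M\to\operatorname{im}\gamma_M$ the map induced by $\gamma_M$, $\widetilde\rho_M:\operatorname{coker}\beta_M\to\ker\gamma_M/\operatorname{im}\beta_M$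 the map induced by $\rho_M$, $\iota_M:\operatorname{im}\gamma_M\to\ker\alpha_M$ the inclusion, $\pi_M:\ker\alpha_M\to\ker\alpha_M/\operatorname{im}\gamma_M$ the projection, and let $j_M:\operatorname{im}\gamma_M\to\operatorname{coker}\beta_M$ and $\epsilon_M:\ker\alpha_M\to\operatorname{im}\gamma_M$ be the maps determined by $\mathrm{id}=\widetilde i_M\widetilde\rho_M+j_M\widetilde\gamma_M$ and $\mathrm{id}=\iota_M\epsilon_M+\sigma_M\pi_M$. Then $\widetilde\mu_k^{s}(f)_i=f_i$ for $i\neq k$ and $$\widetilde\mu_k^{s}(f)_k=\begin{pmatrix}\widetilde\rho_N\overline{f_{\rm out}}\,\widetilde i_M&\widetilde\rho_N\overline{f_{\rm out}}\,j_M&0\\ \widetilde\gamma_N\overline{f_{\rm out}}\,\widetilde i_M&\epsilon_Nf_{\rm in}\iota_M&\epsilon_Nf_{\rm in}\sigma_M\\0&\pi_Nf_{\rm in}\iota_M&\pi_Nf_{\rm in}\sigma_M\end{pmatrix}:\overline M_k\to\overline N_k .$$ **The functors.** Write $(\widetilde Q,\widetilde S)=\widetilde\mu_k^{+}(Q,S)$, so that $\mu_k(Q,S)=(\widetilde Q_{\rm red},\widetilde S_{\rm red})$, and fix a splitting right-equivalence $\phi$ for $(\widetilde Q,\widetilde S)$; via $\phi_r$, $\Lambda'\cong\mathcal P(\widetilde Q,\widetilde S)$. - $\mu_k^+$ is the functor on the quotient categories induced by $M\mapsto\widetilde\mu_k^{+}(M)_{\rm red}$, $f\mapsto\widetilde\mu_k^{+}(f)$.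 - $\mu_k^-$ is the functor on the quotient categories induced as follows: regard a $\Lambda'$-module $N$ as a $\mathcal P(\widetilde Q,\widetilde S)$-module via the isomorphism $\Lambda'\cong\mathcal P(\widetilde Q,\widetilde S)$, form $\widetilde\mu_k^{-}(N)$ (the case $s=-1$), a module over $\mathcal P(\widetilde\mu_k^{-}(\widetilde Q,\widetilde S))$, and take its reduced part, a $\Lambda$-module, where the reduced part of $\widetilde\mu_k^{-}(\widetilde Q,\widetilde S)$ is identified with $(Q,S)$ through the isomorphism $\mathcal P(Q,S)\to\mathcal P(\widetilde\mu_k^{-}(\widetilde Q,\widetilde S))$ sending each arrow of $Q$ not incident to $k$ to itself and each arrow $a$ with $h(a)=k$ (resp. $b$ with $t(b)=k$) to $a^{**}$ (resp. $b^{**}$). On morphisms it is given by $\widetilde\mu_k^{-}(f)$. *)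

(* Defs.v *)
From HB Require Import structures.
From mathcomp Require Import all_boot all_order all_algebra.
From mathcomp Require Import boolp.

Set Implicit Arguments.
Unset Strict Implicit.
Unset Printing Implicit Defensive.

Import GRing.Theory.
Local Open Scope ring_scope.

Definition dsum (K : fieldType) (I : finType) (U : I -> vectType K) : Type :=
  {dffun forall i, U i}.

Section DirectSum.
Variables (K : fieldType) (I : finType) (U : I -> vectType K).
Local Notation D := (dsum U).
Implicit Types f g : D.

HB.instance Definition _ := Choice.on D.

Definition dsum_mk (u : forall i, U i) : D := finfun u.

Lemma dsum_mkE u i : dsum_mk u i = u i. Proof. exact: ffunE. Qed.

Lemma dsumP f g : (forall i, f i = g i) <-> f = g. Proof. exact: ffunP. Qed.

Definition dsum_zero : D := dsum_mk (fun i => 0).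
Definition dsum_opp f : D := dsum_mk (fun i => - f i).
Definition dsum_add f g : D := dsum_mk (fun i => f i + g i).
Definition dsum_scale (c : K) f : D := dsum_mk (fun i => c *: f i).

Fact dsum_addA : associative dsum_add.
Proof. by move=> f g h; apply/dsumP => i; rewrite !dsum_mkE addrA. Qed.
Fact dsum_addC : commutative dsum_add.
Proof. by move=> f g; apply/dsumP => i; rewrite !dsum_mkE addrC. Qed.
Fact dsum_add0 : left_id dsum_zero dsum_add.
Proof. by move=> f; apply/dsumP => i; rewrite !dsum_mkE add0r. Qed.
Fact dsum_addN : left_inverse dsum_zero dsum_opp dsum_add.
Proof. by move=> f; apply/dsumP => i; rewrite !dsum_mkE addNr. Qed.

HB.instance Definition _ :=
  GRing.isZmodule.Build D dsum_addA dsum_addC dsum_add0 dsum_addN.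

Lemma dsum_addE f g i : (f + g) i = f i + g i. Proof. exact: dsum_mkE. Qed.

Fact dsum_scaleA a b f :
  dsum_scale a (dsum_scale b f) = dsum_scale (a * b) f.
Proof. by apply/dsumP => i; rewrite !dsum_mkE scalerA. Qed.
Fact dsum_scale1 : left_id 1 dsum_scale.
Proof. by move=> f; apply/dsumP => i; rewrite !dsum_mkE scale1r. Qed.
Fact dsum_scaleDr : right_distributive dsum_scale +%R.
Proof.
by move=> c f g; apply/dsumP => i; rewrite !(dsum_mkE, dsum_addE) scalerDr.
Qed.
Fact dsum_scaleDl f : {morph dsum_scale^~ f : a b / a + b}.
Proof.
by move=> a b; apply/dsumP => i; rewrite !(dsum_mkE, dsum_addE) scalerDl.
Qed.

HB.instance Definition _ := GRing.Zmodule_isLmodule.Build K D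
  dsum_scaleA dsum_scale1 dsum_scaleDr dsum_scaleDl.

Lemma dsum_scaleE (c : K) f i : (c *: f) i = c *: f i.
Proof. exact: dsum_mkE. Qed.

Import VectorInternalTheory.

Fact dsum_vect_iso : Vector.axiom #|{: {i : I & 'I_(dim (U i))}}| D.
Proof.
pose to f : 'rV[K]_#|{: {i : I & 'I_(dim (U i))}}| :=
  \row_j v2r (f (tag (enum_val j))) 0 (tagged (enum_val j)).
pose of_ (r : 'rV[K]_#|{: {i : I & 'I_(dim (U i))}}|) : D :=
  dsum_mk (fun i => r2v (\row_l r 0 (enum_rank (Tagged (fun i => 'I_(dim (U i))) l)))).
exists to.
  move=> c f g; apply/rowP => j.
  by rewrite !mxE dsum_addE dsum_scaleE linearP !mxE.
exists of_ => [f|r].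
  apply/dsumP => i; rewrite dsum_mkE -[RHS]v2rK; congr r2v.
  by apply/rowP => l; rewrite !mxE enum_rankK.
apply/rowP => j; rewrite mxE dsum_mkE r2vK mxE; congr (r 0 _).
by apply: enum_val_inj; rewrite enum_rankK; case: (enum_val j).
Qed.

HB.instance Definition _ := Lmodule_hasFinDim.Build K D dsum_vect_iso.

Definition dsum_proj (i : I) : 'Hom(D, U i) := linfun (fun f : D => f i).

Definition dsum_single (i : I) (u : U i) : D :=
  dsum_mk (fun j => if eqVneq i j is EqNotNeq e then ecast j (U j) e u else 0).

Definition dsum_inj (i : I) : 'Hom(U i, D) := linfun (@dsum_single i).

Fact dsum_proj_linear i : linear (fun f : D => f i).
Proof. by move=> c f g; rewrite dsum_addE dsum_scaleE. Qed.

Lemma dsum_projE i f : dsum_proj i f = f i.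
Proof.
pose L := GRing.isLinear.Build K _ _ _ _ (@dsum_proj_linear i).
pose F : {linear D -> U i} := HB.pack (fun f : D => f i) L.
exact: (lfunE F).
Qed.

Fact dsum_single_linear i : linear (@dsum_single i).
Proof.
move=> c u v; apply/dsumP => j; rewrite dsum_addE dsum_scaleE !dsum_mkE.
case: eqVneq => [e|_]; last by rewrite scaler0 addr0.
by case: _ / e.
Qed.

HB.instance Definition _ i :=
  GRing.isLinear.Build K _ _ _ (@dsum_single i) (@dsum_single_linear i).

Lemma dsum_injE i u : dsum_inj i u = dsum_single u.
Proof. exact: lfunE. Qed.

Lemma dsum_single_id i (u : U i) : dsum_single u i = u.
Proof. by rewrite dsum_mkE; case: eqVneq => [e|/eqP //]; rewrite eq_axiomK. Qed.

Lemma dsum_single_neq i j (u : U i) : i != j -> dsum_single u j = 0.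
Proof. by rewrite dsum_mkE; case: eqVneq. Qed.

End DirectSum.

(** The quotient [V / U] is realised on the chosen complement [U^C]; it is used
    through the projection [qpi], which is onto with kernel [U], and the induced
    maps [qlift]. *)
Section Quotient.
Variables (K : fieldType) (V : vectType K).

Definition quot (U : {vspace V}) : vectType K := subvs_of (U^C)%VS.

Variable U : {vspace V}.

Definition qpi : 'Hom(V, quot U) :=
  (linfun (vsproj (U^C)%VS) \o daddv_pi (U^C)%VS U)%VF.

Definition qsec : 'Hom(quot U, V) := linfun (@vsval K V (U^C)%VS).

Lemma qsecK v : qpi (qsec v) = v.
Proof.
rewrite lfunE /= lfunE /= lfunE /= daddv_pi_id ?subvsP ?vsvalK //.
by rewrite capvC capv_compl.
Qed.

Lemma lker_qpi : lker qpi = U.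
Proof.
have cUU : (U^C :&: U = 0)%VS by rewrite capvC capv_compl.
have dUU v : daddv_pi (U^C)%VS U v + daddv_pi U (U^C)%VS v = v.
  by apply: daddv_pi_add; rewrite // addvC addv_complf memvf.
apply/vspaceP => v; rewrite memv_ker lfunE /= lfunE /=; apply/eqP/idP => [|Uv].
  move/(congr1 vsval); rewrite vsprojK ?memv_pi //= => v0.
  by rewrite -[v]dUU v0 add0r memv_pi.
have := dUU v; rewrite (daddv_pi_id _ Uv) ?capv_compl // => /(canRL (addrK _)).
by rewrite subrr => ->; rewrite linear0.
Qed.

(** The map [V / U -> W] induced by [f], for [f] vanishing on [U]. *)
Definition qlift (W : vectType K) (f : 'Hom(V, W)) : 'Hom(quot U, W) :=
  (f \o qsec)%VF.

Lemma qliftE (W : vectType K) (f : 'Hom(V, W)) :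
  (U <= lker f)%VS -> (qlift f \o qpi)%VF = f.
Proof.
move=> /subvP Uf; apply/lfunP => v.
rewrite [LHS]comp_lfunE [LHS]comp_lfunE; apply/eqP; rewrite -subr_eq0 -linearB -memv_ker; apply: Uf.
have : qsec (qpi v) - v \in lker qpi by rewrite memv_ker linearB /= qsecK subrr.
by rewrite lker_qpi.
Qed.

End Quotient.

Record quiver (V : finType) :=
  Quiver { arrow : finType; tl : arrow -> V; hd : arrow -> V }.

Section Paths.
Variables (V : finType) (Q : quiver V).
Implicit Types (i j : V) (w u : seq (arrow Q)).

(** The path [c_1 c_2 ... c_n], composed from right to left, is encoded by its
    head [i] together with [w = [:: c_1; ...; c_n]]; [(i, [::])] is the trivial
    path at [i].  The tail of the path is [wend i w]. *)
Fixpoint walk i w : bool :=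
  if w is c :: u then (hd c == i) && walk (tl c) u else true.

Fixpoint wend i w : V := if w is c :: u then wend (tl c) u else i.

Definition is_cycle i w : bool := [&& w != [::], walk i w & wend i w == i].

Definition qpath : Type := {p : V * seq (arrow Q) | walk p.1 p.2}.

Lemma walk_cat i w u : walk i (w ++ u) = walk i w && walk (wend i w) u.
Proof. by elim: w i => //= c w IH i; rewrite IH andbA. Qed.

Lemma wend_cat i w u : wend i (w ++ u) = wend (wend i w) u.
Proof. by elim: w i => //=. Qed.

End Paths.

Record cpa (K : fieldType) (V : finType) (Q : quiver V) :=
  Series { series : qpath Q -> K }.

Section PathAlgebra.
Variables (K : fieldType) (V : finType) (Q : quiver V).
Local Notation A := (cpa K Q).
Implicit Types (x y z : A) (i j : V) (w u : seq (arrow Q)).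

HB.instance Definition _ := gen_eqMixin A.
HB.instance Definition _ := gen_choiceMixin A.

Definition coef x i w : K := if insub (i, w) is Some p then series x p else 0.

Definition mkser (f : V -> seq (arrow Q) -> K) : A :=
  Series (fun p => f (val p).1 (val p).2).

Lemma coef_mkser f i w : coef (mkser f) i w = if walk i w then f i w else 0.
Proof. by rewrite /coef; case: insubP => [p /= -> ->|/= /negbTE->]. Qed.

Lemma coef_out x i w : ~~ walk i w -> coef x i w = 0.
Proof. by move=> nw; rewrite /coef insubN. Qed.

Lemma cpaP x y : (forall i w, coef x i w = coef y i w) <-> x = y.
Proof.
split=> [exy|-> //]; case: x y exy => [f] [g] exy; congr Series.
apply: funext => -[[i w] pw].
by have := exy i w; rewrite /coef insubT.
Qed.

Definition cpa_zero : A := mkser (fun _ _ => 0).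
Definition cpa_opp x : A := mkser (fun i w => - coef x i w).
Definition cpa_add x y : A := mkser (fun i w => coef x i w + coef y i w).
Definition cpa_scale (c : K) x : A := mkser (fun i w => c * coef x i w).
Definition cpa_one : A := mkser (fun _ w => (nilp w)%:R).

(** The coefficient at a path [p] is the sum over the factorisations
    [p = p' p''] of the coefficient of [x] at [p'] times that of [y] at [p'']. *)
Definition cpa_mul x y : A := mkser (fun i w =>
  \sum_(0 <= j < (size w).+1)
     coef x i (take j w) * coef y (wend i (take j w)) (drop j w)).

Let coef0 i w : coef cpa_zero i w = 0.
Proof. by rewrite coef_mkser if_same. Qed.
Let coefN x i w : coef (cpa_opp x) i w = - coef x i w.
Proof.
by rewrite coef_mkser; case: ifP => // /negbT/coef_out ->; rewrite oppr0.
Qed.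
Let coefD x y i w : coef (cpa_add x y) i w = coef x i w + coef y i w.
Proof.
rewrite coef_mkser; case: ifP => // /negbT nw.
by rewrite !coef_out ?addr0.
Qed.
Let coefZ c x i w : coef (cpa_scale c x) i w = c * coef x i w.
Proof.
by rewrite coef_mkser; case: ifP => // /negbT/coef_out ->; rewrite mulr0.
Qed.
Let coef1 i w : coef cpa_one i w = (nilp w)%:R.
Proof. by rewrite coef_mkser; case: w => //= c w; rewrite if_same. Qed.
Let coefM x y i w : coef (cpa_mul x y) i w = \sum_(0 <= j < (size w).+1)
     coef x i (take j w) * coef y (wend i (take j w)) (drop j w).
Proof.
rewrite coef_mkser; case: ifP => // /negbT nw; rewrite big1 // => j _.
move: nw; rewrite -{1}[w](cat_take_drop j) walk_cat negb_and.
by case/orP => /coef_out ->; rewrite ?mul0r ?mulr0.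
Qed.

Fact cpa_addA : associative cpa_add.
Proof. by move=> x y z; apply/cpaP => i w; rewrite !coefD addrA. Qed.
Fact cpa_addC : commutative cpa_add.
Proof. by move=> x y; apply/cpaP => i w; rewrite !coefD addrC. Qed.
Fact cpa_add0 : left_id cpa_zero cpa_add.
Proof. by move=> x; apply/cpaP => i w; rewrite coefD coef0 add0r. Qed.
Fact cpa_addN : left_inverse cpa_zero cpa_opp cpa_add.
Proof. by move=> x; apply/cpaP => i w; rewrite coefD coefN coef0 addNr. Qed.

HB.instance Definition _ :=
  GRing.isZmodule.Build A cpa_addA cpa_addC cpa_add0 cpa_addN.

Fact cpa_mulA : associative cpa_mul.
Proof.
move=> x y z; apply/cpaP => i w; rewrite !coefM.
pose F (j l : nat) := coef x i (take j w) *
  coef y (wend i (take j w)) (take (l - j) (drop j w)) *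
  coef z (wend i (take l w)) (drop l w).
transitivity (\sum_(0 <= j < (size w).+1)
                \sum_(0 <= l < (size w).+1 | (j <= l)%N) F j l).
  apply: eq_big_nat => j /andP[_ lj]; rewrite coefM big_distrr /=.
  rewrite -(@big_nat_widenl _ _ _ j 0 _ xpredT) //.
  rewrite -[X in \sum_(X <= _ < _) F _ _]add0n big_addn size_drop -subSn //.
  apply: eq_bigr => l _; rewrite /F addnK mulrA -wend_cat drop_drop.
  by rewrite [(l + j)%N]addnC takeD.
rewrite (exchange_big_dep_nat predT) //=; apply: eq_big_nat => l /andP[_ ll].
rewrite coefM size_take_min (minn_idPl _) // big_distrl /=.
rewrite [RHS](big_nat_widen _ _ (size w).+1) //=.
rewrite big_mkcond [RHS]big_mkcond; apply: eq_big_nat => j _ /=.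
rewrite ltnS; case: leqP => // jl; rewrite /F take_takel //.
by rewrite [take (l - j) _]take_drop subnK.
Qed.

Fact cpa_mul1 : left_id cpa_one cpa_mul.
Proof.
move=> x; apply/cpaP => i w; rewrite coefM big_nat_recl //= coef1 take0 drop0.
rewrite mul1r big_nat big1 ?addr0 // => j lj; rewrite coef1.
by case: w lj => //= c w _; rewrite mul0r.
Qed.

Fact cpa_1mul : right_id cpa_one cpa_mul.
Proof.
move=> x; apply/cpaP => i w; rewrite coefM big_nat_recr //= coef1.
rewrite take_size drop_size mulr1 big_nat big1 ?add0r // => j lj; rewrite coef1.
by rewrite /nilp size_drop subn_eq0 leqNgt (andP lj).2 mulr0.
Qed.

Fact cpa_mulDl : left_distributive cpa_mul +%R.
Proof.
move=> x y z; apply/cpaP => i w; rewrite coefD !coefM -big_split.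
by apply: eq_bigr => j _; rewrite coefD mulrDl.
Qed.

Fact cpa_mulDr : right_distributive cpa_mul +%R.
Proof.
move=> x y z; apply/cpaP => i w; rewrite coefD !coefM -big_split.
by apply: eq_bigr => j _; rewrite coefD mulrDr.
Qed.

HB.instance Definition _ := GRing.Zmodule_isPzRing.Build A
  cpa_mulA cpa_mul1 cpa_1mul cpa_mulDl cpa_mulDr.

Fact cpa_scaleA a b x : cpa_scale a (cpa_scale b x) = cpa_scale (a * b) x.
Proof. by apply/cpaP => i w; rewrite !coefZ mulrA. Qed.
Fact cpa_scale1 : left_id 1 cpa_scale.
Proof. by move=> x; apply/cpaP => i w; rewrite coefZ mul1r. Qed.
Fact cpa_scaleDr : right_distributive cpa_scale +%R.
Proof. by move=> c x y; apply/cpaP => i w; rewrite !(coefZ, coefD) mulrDr. Qed.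
Fact cpa_scaleDl x : {morph cpa_scale^~ x : a b / a + b}.
Proof. by move=> a b; apply/cpaP => i w; rewrite !(coefZ, coefD) mulrDl. Qed.

HB.instance Definition _ := GRing.Zmodule_isLmodule.Build K A
  cpa_scaleA cpa_scale1 cpa_scaleDr cpa_scaleDl.

Lemma cpa_coefD x y i w : coef (x + y) i w = coef x i w + coef y i w.
Proof. exact: coefD. Qed.
Lemma cpa_coefN x i w : coef (- x) i w = - coef x i w.
Proof. exact: coefN. Qed.
Lemma cpa_coefZ (c : K) x i w : coef (c *: x) i w = c * coef x i w.
Proof. exact: coefZ. Qed.
Lemma cpa_coefM x y i w : coef (x * y) i w = \sum_(0 <= j < (size w).+1)
     coef x i (take j w) * coef y (wend i (take j w)) (drop j w).
Proof. exact: coefM. Qed.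

End PathAlgebra.

Section Potentials.
Variables (K : fieldType) (V : finType) (Q : quiver V).
Local Notation A := (cpa K Q).
Implicit Types (x y S T W : A) (i j k : V) (w u : seq (arrow Q)).

(** The path [(i, w)] as an element of the path algebra (0 if [w] is not a path
    with head [i]). *)
Definition mono i w : A := mkser (fun j u => ((j, u) == (i, w))%:R).

Definition idem i : A := mono i [::].
Definition arr_el (a : arrow Q) : A := mono (hd a) [:: a].

Definition madic_closure (X : A -> Prop) : A -> Prop := fun x =>
  forall n, exists2 y, X y &
    forall i w, (size w < n)%N -> coef x i w = coef y i w.

Inductive lin_span (G : A -> Prop) : A -> Prop :=
| span_gen x of G x : lin_span G x
| span_zero : lin_span G 0
| span_add x y of lin_span G x & lin_span G y : lin_span G (x + y)
| span_scale (c : K) x of lin_span G x : lin_span G (c *: x).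

Inductive ideal (G : A -> Prop) : A -> Prop :=
| ideal_gen x of G x : ideal G x
| ideal_zero : ideal G 0
| ideal_add x y of ideal G x & ideal G y : ideal G (x + y)
| ideal_mull x y of ideal G y : ideal G (x * y)
| ideal_mulr x y of ideal G x : ideal G (x * y).

Definition is_potential S : Prop :=
  forall i w, coef S i w != 0 -> is_cycle i w.

Inductive rotation : A -> Prop :=
  Rotation a w of is_cycle (hd a) (a :: w) :
    rotation (mono (hd a) (a :: w) - mono (tl a) (rcons w a)).

Definition cyc_equiv S W : Prop := madic_closure (lin_span rotation) (S - W).

Record is_qp S : Prop := IsQP {
  qp_loopfree : forall a : arrow Q, tl a != hd a;
  qp_potential : is_potential S;
  qp_cycles : forall i w j u, coef S i w != 0 -> coef S j u != 0 ->
    cyc_equiv (mono i w) (mono j u) -> (i, w) = (j, u) }.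

(** [d_a (c_1 ... c_n)] is the sum over [c_1 ... c_n = y a x] of [x y]; hence the
    coefficient of [d_a S] at a path [p] is the sum, over the factorisations
    [p = x y], of the coefficient of [S] at [y a x].  In [y a x] the head of the
    cycle is the head of [y], i.e. the tail of [x]. *)
Definition dcyc (a : arrow Q) S : A := mkser (fun i w =>
  \sum_(0 <= j < (size w).+1)
     coef S (wend i (take j w)) (drop j w ++ a :: take j w)).

(** [d_(ba)], likewise. *)
Definition dcyc2 (b a : arrow Q) S : A := mkser (fun i w =>
  \sum_(0 <= j < (size w).+1)
     coef S (wend i (take j w)) (drop j w ++ [:: b, a & take j w])).

Definition jacobian S : A -> Prop :=
  madic_closure (ideal (fun x => exists a, x = dcyc a S)).

Definition reduced S : Prop := forall i w, coef S i w != 0 -> size w != 2.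

Definition arrow_space x : Prop := forall i w, coef x i w != 0 -> size w = 1.

(** The [R]-bimodule generated by [G] is spanned by the [e_i g e_j]. *)
Definition bimodule (G : A -> Prop) : A -> Prop :=
  lin_span (fun x => exists i j g, G g /\ x = idem i * g * idem j).

Definition trivial S : Prop :=
  forall x, bimodule (fun y => exists a, y = dcyc a S) x <-> arrow_space x.

Definition no_2cycle_at k : Prop :=
  forall a b : arrow Q, hd a = k -> tl b = k -> hd b != tl a.

Definition no_cycle_begins S k : Prop := forall i w, coef S i w != 0 -> i != k.

End Potentials.

Arguments idem {K V} Q i.
Arguments arr_el {K V Q} a.

Section Splitting.
Variables (K : fieldType) (V : finType).

Definition qsum (P P' : quiver V) : quiver V :=
  @Quiver V (arrow P + arrow P')%type
    (fun c => match c with inl a => tl a | inr a => tl a end)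
    (fun c => match c with inl a => hd a | inr a => hd a end).

(** The embedding of path algebras given by the inclusion of a subquiver [P] of
    [P'], where [g] is the partial inverse of the inclusion on arrows. *)
Definition extend (P P' : quiver V) (g : arrow P' -> option (arrow P))
    (x : cpa K P) : cpa K P' :=
  mkser (fun i w => let u := pmap g w in
                    if size u == size w then coef x i u else 0).

Definition ext_l (P P' : quiver V) : cpa K P -> cpa K (qsum P P') :=
  @extend P (qsum P P') (fun c => if c is inl a then Some a else None).

Definition ext_r (P P' : quiver V) : cpa K P' -> cpa K (qsum P P') :=
  @extend P' (qsum P P') (fun c => if c is inr a then Some a else None).

Record right_equiv (P P' : quiver V) (S : cpa K P) (S' : cpa K P')
    (phi : {rmorphism cpa K P -> cpa K P'}) : Prop := RightEquiv {
  re_scalable : scalable phi;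
  re_vertices : forall i, phi (idem P i) = idem P' i;
  re_bij : bijective phi;
  re_cyc : cyc_equiv (phi S) S' }.

Record splitting (Pt Pr P : quiver V)
    (Tt : cpa K Pt) (Tr : cpa K Pr) (T : cpa K P)
    (phi : {rmorphism cpa K (qsum Pt Pr) -> cpa K P}) : Prop := Splitting {
  sp_triv_qp : is_qp Tt;
  sp_triv : trivial Tt;
  sp_red_qp : is_qp Tr;
  sp_red : reduced Tr;
  sp_equiv : right_equiv (ext_l Pr Tt + ext_r Pt Tr) T phi }.

End Splitting.

Record rep (K : fieldType) (V : finType) (Q : quiver V) := Rep {
  rsp :> V -> vectType K;
  rmap : forall a : arrow Q, 'Hom(rsp (tl a), rsp (hd a)) }.

Section Representations.
Variables (K : fieldType) (V : finType) (Q : quiver V).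
Implicit Types (M N : rep K Q) (i j k : V) (w : seq (arrow Q)).

Definition id_at M i j : 'Hom(M j, M i) :=
  match @eqP _ j i with
  | ReflectT e => ecast l ('Hom(M j, M l)) e \1%VF
  | _ => 0
  end.

(** The action of [a], as a map [M_j -> M_i] (0 unless [a : j -> i]). *)
Definition act1 M i (a : arrow Q) j : 'Hom(M j, M i) :=
  (id_at M i (hd a) \o (rmap M a \o id_at M (tl a) j))%VF.

Fixpoint act M i w j : 'Hom(M j, M i) :=
  match w with
  | [::] => id_at M i j
  | c :: u => (act1 M i c (tl c) \o act M (tl c) u j)%VF
  end.

Definition nilpotent M : Prop :=
  exists n, forall i w j, (n <= size w)%N -> act M i w j = 0.

Definition total_dim M : nat := (\sum_i \dim {: M i})%N.

(** The component [M_j -> M_i] of the action of a possibly infinite linear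
    combination [x] of paths on a nilpotent [M].  Paths of length at least
    [total_dim M] act by 0, as the images of the powers of the arrow ideal
    decrease strictly until they vanish, so the truncated sum is the full one. *)
Definition eval M (x : cpa K Q) i j : 'Hom(M j, M i) :=
  \sum_(n < (total_dim M).+1) \sum_(w : n.-tuple (arrow Q))
    coef x i w *: act M i w j.

(** Finite-dimensional modules over the Jacobian algebra of [(Q, S)], identified
    with the nilpotent representations satisfying the relations [d_a S = 0]. *)
Definition is_module (S : cpa K Q) M : Prop :=
  nilpotent M /\ forall a i j, eval M (dcyc a S) i j = 0.

Definition maps M N : Type := forall i, 'Hom(M i, N i).

Definition is_hom M N (f : maps M N) : Prop :=
  forall a, (f (hd a) \o rmap M a)%VF = (rmap N a \o f (tl a))%VF.

Definition comp_maps L M N (g : maps M N) (f : maps L M) : maps L N :=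
  fun i => (g i \o f i)%VF.

Definition copies (I : finType) M : rep K Q :=
  @Rep K V Q (fun i => {ffun I -> M i})
    (fun a => linfun (fun x : {ffun I -> M (tl a)} =>
                        [ffun l => rmap M a (x l)] : {ffun I -> M (hd a)})).

Definition simple k : rep K Q :=
  @Rep K V Q (fun i => 'rV[K]_(i == k)) (fun a => 0).

Definition in_add_simple k M N (f : maps M N) : Prop :=
  exists (I : finType) (g : maps M (copies I (simple k)))
         (h : maps (copies I (simple k)) N),
    [/\ is_hom g, is_hom h & forall i, f i = comp_maps h g i].

Definition eq_mod_simple k M N (f g : maps M N) : Prop :=
  in_add_simple k (fun i => f i - g i).

End Representations.

(** [M], a representation of [Q'], viewed as a representation of [Q] through a
    homomorphism of path algebras mapping each arrow [a] to [th a]. *)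
Definition pullback (K : fieldType) (V : finType) (Q Q' : quiver V)
    (th : arrow Q -> cpa K Q') (M : rep K Q') : rep K Q :=
  @Rep K V Q (fun i => M i) (fun a => eval M (th a) (hd a) (tl a)).

(** Morphisms are compared by the equivalence relation [heq]; for a quotient
    category this is congruence modulo the ideal. *)
Record category := Category {
  obj : Type;
  hom : obj -> obj -> Type;
  heq : forall X Y, hom X Y -> hom X Y -> Prop;
  idm : forall X, hom X X;
  cmp : forall X Y Z, hom Y Z -> hom X Y -> hom X Z;
  heq_refl : forall X Y (f : hom X Y), heq f f;
  heq_sym : forall X Y (f g : hom X Y), heq f g -> heq g f;
  heq_trans : forall X Y (f g h : hom X Y), heq f g -> heq g h -> heq f h;
  comp_heq : forall X Y Z (g g' : hom Y Z) (f f' : hom X Y),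
    heq g g' -> heq f f' -> heq (cmp g f) (cmp g' f');
  comp_idl : forall X Y (f : hom X Y), heq (cmp (idm Y) f) f;
  comp_idr : forall X Y (f : hom X Y), heq (cmp f (idm X)) f;
  comp_assoc : forall X Y Z W (h : hom Z W) (g : hom Y Z) (f : hom X Y),
    heq (cmp h (cmp g f)) (cmp (cmp h g) f) }.

Arguments hom {c} X Y.
Arguments heq {c X Y} f g.
Arguments idm {c} X.
Arguments cmp {c X Y Z} g f.

Record functor (C D : category) := Functor {
  fobj :> obj C -> obj D;
  fmap : forall X Y, hom X Y -> hom (fobj X) (fobj Y);
  fmap_heq : forall X Y (f g : hom X Y), heq f g -> heq (fmap f) (fmap g);
  fmap_id : forall X, heq (fmap (idm X)) (idm (fobj X));
  fmap_comp : forall X Y Z (g : hom Y Z) (f : hom X Y),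
    heq (fmap (cmp g f)) (cmp (fmap g) (fmap f)) }.

Arguments fmap {C D} f0 {X Y} f.

Definition id_functor (C : category) : functor C C :=
  @Functor C C id (fun X Y f => f) (fun X Y f g e => e)
    (fun X => heq_refl _) (fun X Y Z g f => heq_refl _).

Definition comp_functor (C D E : category) (G : functor D E) (F : functor C D) :
  functor C E.
Proof.
apply: (@Functor C E (fun X => G (F X)) (fun X Y f => fmap G (fmap F f))).
- by move=> X Y f g /(fmap_heq F)/(fmap_heq G).
- by move=> X; apply: heq_trans (fmap_id G _); apply/fmap_heq/fmap_id.
- by move=> X Y Z g f; apply: heq_trans (fmap_comp G _ _); apply/fmap_heq/fmap_comp.
Defined.

Definition iso (C : category) (X Y : obj C) (f : hom X Y) : Prop :=
  exists2 g : hom Y X, heq (cmp g f) (idm X) & heq (cmp f g) (idm Y).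

Definition nat_iso (C D : category) (F G : functor C D) : Prop :=
  exists2 eta : forall X, hom (F X) (G X), forall X, iso (eta X) &
    forall X Y (f : hom X Y),
      heq (cmp (eta Y) (fmap F f)) (cmp (fmap G f) (eta X)).

Definition quasi_inverse (C D : category) (F : functor C D) (G : functor D C) :
  Prop :=
  nat_iso (comp_functor G F) (id_functor C) /\
  nat_iso (comp_functor F G) (id_functor D).

Section StableCategory.
Variables (K : fieldType) (V : finType) (Q : quiver V) (S : cpa K Q) (k : V).
Implicit Types (L M N : rep K Q).

Lemma is_hom_id M : is_hom (fun i => \1%VF : 'End(M i)).
Proof. by move=> a; rewrite comp_lfun1l comp_lfun1r. Qed.

Lemma is_hom_comp L M N (g : maps M N) (f : maps L M) :
  is_hom g -> is_hom f -> is_hom (comp_maps g f).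
Proof.
move=> hg hf a; rewrite /comp_maps -comp_lfunA hf.
by rewrite comp_lfunA hg comp_lfunA.
Qed.

Lemma is_hom_opp M N (f : maps M N) : is_hom f -> is_hom (fun i => - f i).
Proof. by move=> hf a; rewrite comp_lfunNl comp_lfunNr hf. Qed.

Lemma in_add_simple0 M N : in_add_simple k (fun i => 0 : 'Hom(M i, N i)).
Proof.
exists 'I_0, (fun i => 0), (fun i => 0).
by split=> [a|a|i]; rewrite ?/comp_maps !comp_lfun0l ?comp_lfun0r.
Qed.

Lemma in_add_simpleN M N (f : maps M N) :
  in_add_simple k f -> in_add_simple k (fun i => - f i).
Proof.
case=> I [g] [h] [hg hh e]; exists I, (fun i => - g i), h; split=> //.
  exact: is_hom_opp.
by move=> i; rewrite e /comp_maps comp_lfunNr.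
Qed.

Lemma in_add_simple_comp L M N (g : maps M N) (f : maps L M) :
  is_hom g -> in_add_simple k f -> in_add_simple k (comp_maps g f).
Proof.
move=> hg [I] [u] [v] [hu hv e]; exists I, u, (comp_maps g v); split=> //.
  exact: is_hom_comp.
by move=> i; rewrite /comp_maps e comp_lfunA.
Qed.

Lemma in_add_simple_precomp L M N (g : maps M N) (f : maps L M) :
  is_hom f -> in_add_simple k g -> in_add_simple k (comp_maps g f).
Proof.
move=> hf [I] [u] [v] [hu hv e]; exists I, (comp_maps u f), v; split=> //.
  exact: is_hom_comp.
by move=> i; rewrite /comp_maps e comp_lfunA.
Qed.

Definition reindex_ffun (T : vectType K) (I J : finType) (r : J -> option I)
    (x : {ffun I -> T}) : {ffun J -> T} :=
  [ffun j => if r j is Some i then x i else 0].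

Fact reindex_ffun_linear T I J r : linear (@reindex_ffun T I J r).
Proof.
move=> c x y; apply/ffunP => j; rewrite !ffunE; case: (r j) => [i|].
  by rewrite !ffunE.
by rewrite scaler0 addr0.
Qed.

HB.instance Definition _ T I J r := GRing.isLinear.Build K _ _ _
  (@reindex_ffun T I J r) (@reindex_ffun_linear T I J r).

Definition reindex_copies (I J : finType) (r : J -> option I) M :
    maps (copies I M) (copies J M) :=
  fun i => linfun (@reindex_ffun (M i) I J r).

Fact copies_map_linear (I : finType) (T U : vectType K) (f : 'Hom(T, U)) :
  linear (fun x : {ffun I -> T} => [ffun l => f (x l)] : {ffun I -> U}).
Proof. by move=> c x y; apply/ffunP => l; rewrite !ffunE linearP. Qed.

Lemma copiesE (I : finType) M a (x : {ffun I -> M (tl a)}) :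
  rmap (copies I M) a x = [ffun l => rmap M a (x l)].
Proof.
pose L := GRing.isLinear.Build K _ _ _ _ (@copies_map_linear I _ _ (rmap M a)).
pose F : {linear {ffun I -> M (tl a)} -> {ffun I -> M (hd a)}} := HB.pack
  (fun x : {ffun I -> M (tl a)} => [ffun l => rmap M a (x l)]) L.
exact: (lfunE F).
Qed.

Lemma reindex_copies_hom (I J : finType) (r : J -> option I) M :
  is_hom (reindex_copies r M).
Proof.
move=> a; apply/lfunP => x; rewrite [LHS]comp_lfunE [RHS]comp_lfunE.
rewrite [in RHS]lfunE (copiesE (M := M)) [LHS]lfunE /= (copiesE (M := M)).
by apply/ffunP => j; rewrite !ffunE; case: (r j) => [i|]; rewrite ?ffunE ?linear0.
Qed.

Lemma in_add_simpleD M N (f g : maps M N) :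
  in_add_simple k f -> in_add_simple k g ->
  in_add_simple k (fun i => f i + g i).
Proof.
case=> I [u] [v] [hu hv ef] [J] [u'] [v'] [hu' hv' eg].
pose r1 (l : I + J) := if l is inl i then Some i else None.
pose r2 (l : I + J) := if l is inr j then Some j else None.
pose p1 (i : I) : option (I + J) := Some (inl i).
pose p2 (j : J) : option (I + J) := Some (inr j).
pose S1 := simple K Q k.
pose uu : maps M (copies (I + J)%type S1) := fun i =>
  (reindex_copies r1 S1 i \o u i)%VF +
  (reindex_copies r2 S1 i \o u' i)%VF.
pose vv : maps (copies (I + J)%type S1) N := fun i =>
  (v i \o reindex_copies p1 S1 i)%VF +
  (v' i \o reindex_copies p2 S1 i)%VF.
have homD L1 L2 (a b : maps L1 L2) :
    is_hom a -> is_hom b -> is_hom (fun i => a i + b i).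
  by move=> ha hb c; rewrite comp_lfunDl comp_lfunDr ha hb.
exists (I + J)%type, uu, vv; split.
- by apply: homD; apply: is_hom_comp => //; apply: reindex_copies_hom.
- by apply: homD; apply: is_hom_comp => //; apply: reindex_copies_hom.
move=> i; rewrite ef eg /comp_maps; apply/lfunP => x.
rewrite !(add_lfunE, comp_lfunE) !linearD /=.
have E (A B C : finType) (r : B -> option A) (p : C -> option B) y :
  reindex_copies p S1 i (reindex_copies r S1 i y) =
  reindex_ffun p (reindex_ffun r y) by rewrite 2!lfunE.
rewrite !E.
have -> (y : {ffun I -> S1 i}) : reindex_ffun p1 (reindex_ffun r1 y) = y.
  by apply/ffunP => l; rewrite !ffunE /= ?ffunE.
have -> (y : {ffun J -> S1 i}) : reindex_ffun p1 (reindex_ffun r2 y) = 0.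
  by apply/ffunP => l; rewrite !ffunE /= ?ffunE.
have -> (y : {ffun I -> S1 i}) : reindex_ffun p2 (reindex_ffun r1 y) = 0.
  by apply/ffunP => l; rewrite !ffunE /= ?ffunE.
have -> (y : {ffun J -> S1 i}) : reindex_ffun p2 (reindex_ffun r2 y) = y.
  by apply/ffunP => l; rewrite !ffunE /= ?ffunE.
by rewrite !linear0 addr0 add0r.
Qed.

Record fdmod := FdMod { fd_rep :> rep K Q; fd_ok : is_module S fd_rep }.

Record fdhom (M N : fdmod) :=
  FdHom { fd_maps : maps M N; fd_hom : is_hom fd_maps }.

Definition fdhom_id (M : fdmod) : fdhom M M := FdHom (is_hom_id M).

Definition fdhom_comp (L M N : fdmod) (g : fdhom M N) (f : fdhom L M) :
  fdhom L N := FdHom (is_hom_comp (fd_hom g) (fd_hom f)).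

Definition fdhom_eq (M N : fdmod) (f g : fdhom M N) : Prop :=
  eq_mod_simple k (fd_maps f) (fd_maps g).

Lemma in_add_simple_eq M N (f g : maps M N) :
  (forall i, f i = g i) -> in_add_simple k f -> in_add_simple k g.
Proof.
by move=> e [I] [u] [v] [hu hv ef]; exists I, u, v; split=> // i; rewrite -e.
Qed.

Lemma eq_mod_simple_of_eq M N (f g : maps M N) :
  (forall i, f i = g i) -> eq_mod_simple k f g.
Proof.
by move=> e; apply: in_add_simple_eq (in_add_simple0 M N) => i; rewrite e subrr.
Qed.

Definition stable_cat : category.
Proof.
apply: (@Category fdmod fdhom fdhom_eq fdhom_id fdhom_comp).
- by move=> M N f; apply: eq_mod_simple_of_eq.
- move=> M N f g /in_add_simpleN; apply: in_add_simple_eq => i.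
  by rewrite opprB.
- move=> M N f g h fg gh; apply: in_add_simple_eq (in_add_simpleD fg gh) => i.
  by rewrite addrA subrK.
- move=> L M N g g' f f' gg ff.
  have := in_add_simpleD (in_add_simple_comp (fd_hom g) ff)
                         (in_add_simple_precomp (fd_hom f') gg).
  apply: in_add_simple_eq => i; rewrite /comp_maps /=.
  by rewrite comp_lfunDr comp_lfunDl comp_lfunNr comp_lfunNl addrA subrK.
- by move=> M N f; apply: eq_mod_simple_of_eq => i; apply: comp_lfun1l.
- by move=> M N f; apply: eq_mod_simple_of_eq => i; apply: comp_lfun1r.
- by move=> L M N P h g f; apply: eq_mod_simple_of_eq => i; apply: comp_lfunA.
Defined.

End StableCategory.

(** The assignment [M |-> Fo M], [f |-> Fm f], given on representations, induces
    a functor [mod(Q, S) / [add S_k] -> mod(Q', S') / [add S'_k]]. *)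
Record induces (K : fieldType) (V : finType) (Q Q' : quiver V)
    (S : cpa K Q) (S' : cpa K Q') (k : V) (Fo : rep K Q -> rep K Q')
    (Fm : forall M N : rep K Q, maps M N -> maps (Fo M) (Fo N)) : Prop :=
  Induces {
    ind_obj : forall M, is_module S M -> is_module S' (Fo M);
    ind_hom : forall M N (f : maps M N), is_module S M -> is_module S N ->
      is_hom f -> is_hom (Fm M N f);
    ind_heq : forall M N (f g : maps M N), is_module S M -> is_module S N ->
      is_hom f -> is_hom g ->
      eq_mod_simple k f g -> eq_mod_simple k (Fm M N f) (Fm M N g);
    ind_id : forall M, is_module S M ->
      eq_mod_simple k (Fm M M (fun i => \1%VF)) (fun i => \1%VF);
    ind_comp : forall L M N (g : maps M N) (f : maps L M),
      is_module S L -> is_module S M -> is_module S N -> is_hom g -> is_hom f ->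
      eq_mod_simple k (Fm L N (comp_maps g f))
                      (comp_maps (Fm M N g) (Fm L M f)) }.

Definition induced_functor (K : fieldType) (V : finType) (Q Q' : quiver V)
    (S : cpa K Q) (S' : cpa K Q') (k : V) (Fo : rep K Q -> rep K Q')
    (Fm : forall M N : rep K Q, maps M N -> maps (Fo M) (Fo N))
    (w : induces S S' k Fm) : functor (stable_cat S k) (stable_cat S' k) :=
  @Functor (stable_cat S k) (stable_cat S' k)
    (fun M => FdMod (ind_obj w (fd_ok M)))
    (fun M N f => @FdHom K V Q' S' (FdMod (ind_obj w (fd_ok M)))
       (FdMod (ind_obj w (fd_ok N))) (Fm M N (fd_maps f))
       (ind_hom w (fd_ok M) (fd_ok N) (fd_hom f)))
    (fun M N f g e =>
       ind_heq w (fd_ok M) (fd_ok N) (fd_hom f) (fd_hom g) e)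
    (fun M => ind_id w (fd_ok M))
    (fun L M N g f =>
       ind_comp w (fd_ok L) (fd_ok M) (fd_ok N) (fd_hom g) (fd_hom f)).

Section Premutation.
Variables (V : finType) (Q : quiver V) (k : V).

Definition in_arrow : Type := {a : arrow Q | hd a == k}.
Definition out_arrow : Type := {b : arrow Q | tl b == k}.
Definition off_arrow : Type := {c : arrow Q | (hd c != k) && (tl c != k)}.

HB.instance Definition _ := Finite.on in_arrow.
HB.instance Definition _ := Finite.on out_arrow.
HB.instance Definition _ := Finite.on off_arrow.

(** [Comp b a] is [[ba]]; [StarIn a] is [a^*] and [StarOut b] is [b^*]. *)
Inductive premut_arrow : Type :=
  | Keep of off_arrow
  | Comp of out_arrow & in_arrow
  | StarIn of in_arrow
  | StarOut of out_arrow.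

Definition premut_arrow_enc (x : premut_arrow) :
    off_arrow + out_arrow * in_arrow + in_arrow + out_arrow :=
  match x with
  | Keep c => inl (inl (inl c))
  | Comp b a => inl (inl (inr (b, a)))
  | StarIn a => inl (inr a)
  | StarOut b => inr b
  end.

Definition premut_arrow_dec
    (x : off_arrow + out_arrow * in_arrow + in_arrow + out_arrow) :=
  match x with
  | inl (inl (inl c)) => Keep c
  | inl (inl (inr (b, a))) => Comp b a
  | inl (inr a) => StarIn a
  | inr b => StarOut b
  end.

Lemma premut_arrow_encK : cancel premut_arrow_enc premut_arrow_dec.
Proof. by case. Qed.

HB.instance Definition _ := Equality.copy premut_arrow (can_type premut_arrow_encK).
HB.instance Definition _ := Choice.copy premut_arrow (can_type premut_arrow_encK).
HB.instance Definition _ := Countable.copy premut_arrow (can_type premut_arrow_encK).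
HB.instance Definition _ : isFinite premut_arrow := CanIsFinite premut_arrow_encK.

Definition premut_tl (x : premut_arrow) : V :=
  match x with
  | Keep c => tl (val c)
  | Comp b a => tl (val a)
  | StarIn a => k
  | StarOut b => hd (val b)
  end.

Definition premut_hd (x : premut_arrow) : V :=
  match x with
  | Keep c => hd (val c)
  | Comp b a => hd (val b)
  | StarIn a => tl (val a)
  | StarOut b => k
  end.

Definition premut : quiver V := @Quiver V premut_arrow premut_tl premut_hd.

Variable K : fieldType.

Definition unbracket1 (x : arrow premut) : option (seq (arrow Q)) :=
  match x with
  | Keep c => Some [:: val c]
  | Comp b a => Some [:: val b; val a]
  | _ => None
  end.

Definition unbracket (w : seq (arrow premut)) : option (seq (arrow Q)) :=
  foldr (fun x r => if (unbracket1 x, r) is (Some u, Some v) then Some (u ++ v)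
                    else None) (Some [::]) w.

(** [[T]]: every cycle of [premut] without starred arrows is [[c]] for exactly one
    cycle [c] of [Q] that does not begin at [k], obtained by expanding each
    [[ba]] to [ba]. *)
Definition bracket (T : cpa K Q) : cpa K premut :=
  mkser (fun i w => if unbracket w is Some u then coef T i u else 0).

Definition premut_pot (s : K) (T : cpa K Q) : cpa K premut :=
  bracket T + s *: \sum_(b : out_arrow) \sum_(a : in_arrow)
    (arr_el (Comp b a : arrow premut) * arr_el (StarIn a : arrow premut)
     * arr_el (StarOut b : arrow premut)).

End Premutation.

Section PremutRep.
Variables (K : fieldType) (V : finType) (Q : quiver V) (k : V).
Local Notation in_arrow := (in_arrow Q k).
Local Notation out_arrow := (out_arrow Q k).

Definition vincl (T : vectType K) (U : {vspace T}) : 'Hom(subvs_of U, T) :=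
  linfun vsval.

(** On [U] this is the identity; it serves to corestrict maps to [U]. *)
Definition vcores (T : vectType K) (U : {vspace T}) : 'Hom(T, subvs_of U) :=
  linfun (vsproj U).

Section Objects.
Variables (T : cpa K Q) (M : rep K Q).

Definition Min : vectType K := dsum (fun a : in_arrow => M (tl (val a))).
Definition Mout : vectType K := dsum (fun b : out_arrow => M (hd (val b))).

Definition alpha : 'Hom(Min, M k) :=
  \sum_(a : in_arrow) (act1 M k (val a) (tl (val a)) \o dsum_proj _ a)%VF.

Definition beta : 'Hom(M k, Mout) :=
  \sum_(b : out_arrow) (dsum_inj _ b \o act1 M (hd (val b)) (val b) k)%VF.

Definition gamma : 'Hom(Mout, Min) :=
  \sum_(a : in_arrow) \sum_(b : out_arrow)
    (dsum_inj _ a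
     \o (eval M (dcyc2 (val b) (val a) T) (tl (val a)) (hd (val b))
         \o dsum_proj _ b))%VF.

Definition ker_gamma : vectType K := subvs_of (lker gamma).
Definition im_gamma : vectType K := subvs_of (limg gamma).
Definition ker_alpha : vectType K := subvs_of (lker alpha).
Definition coker_beta : vectType K := quot (limg beta).

Definition im_beta_in_ker : {vspace ker_gamma} :=
  (vincl (lker gamma) @^-1: limg beta)%VS.
Definition im_gamma_in_ker : {vspace ker_alpha} :=
  (vincl (lker alpha) @^-1: limg gamma)%VS.

Definition ker_gamma_mod : vectType K := quot im_beta_in_ker.
Definition ker_alpha_mod : vectType K := quot im_gamma_in_ker.

Definition Mbar : vectType K := (ker_gamma_mod * im_gamma * ker_alpha_mod)%type.

Definition Mbar1 : 'Hom(Mbar, ker_gamma_mod) := linfun (fun y : Mbar => y.1.1).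
Definition Mbar2 : 'Hom(Mbar, im_gamma) := linfun (fun y : Mbar => y.1.2).
Definition Mbar3 : 'Hom(Mbar, ker_alpha_mod) := linfun (fun y : Mbar => y.2).

Definition Mbar_in1 : 'Hom(ker_gamma_mod, Mbar) := linfun (fun u => (u, 0, 0)).
Definition Mbar_in2 : 'Hom(im_gamma, Mbar) := linfun (fun u => (0, u, 0)).
Definition Mbar_in3 : 'Hom(ker_alpha_mod, Mbar) := linfun (fun u => (0, 0, u)).

Variables (s : K) (rho : 'Hom(Mout, ker_gamma))
  (sigma : 'Hom(ker_alpha_mod, ker_alpha)).

Definition star_out : 'Hom(Mout, Mbar) :=
  (Mbar_in1 \o (- s *: (qpi im_beta_in_ker \o rho)))%VF
  + (Mbar_in2 \o (- s *: (vcores (limg gamma) \o gamma)))%VF.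

Definition star_in : 'Hom(Mbar, Min) :=
  (vincl (limg gamma) \o Mbar2)%VF
  + (vincl (lker alpha) \o (sigma \o Mbar3))%VF.

(** The spaces of the pre-mutation: [Mbar] at [k], and [M i] at [i <> k]. *)
Definition mut_space (A : vectType K) (i : V) : vectType K :=
  if i == k then A else M i.

Definition to_off (A : vectType K) i : 'Hom(M i, mut_space A i) :=
  match i == k as b return 'Hom(M i, if b then A else M i) with
  | true => 0
  | false => \1%VF
  end.

Definition from_off (A : vectType K) i : 'Hom(mut_space A i, M i) :=
  match i == k as b return 'Hom(if b then A else M i, M i) with
  | true => 0
  | false => \1%VF
  end.

Definition to_k (A : vectType K) i : 'Hom(A, mut_space A i) :=
  match i == k as b return 'Hom(A, if b then A else M i) with
  | true => \1%VF
  | false => 0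
  end.

Definition from_k (A : vectType K) i : 'Hom(mut_space A i, A) :=
  match i == k as b return 'Hom(if b then A else M i, A) with
  | true => \1%VF
  | false => 0
  end.

Definition premut_rmap (x : premut_arrow Q k) :
    'Hom(mut_space Mbar (premut_tl x), mut_space Mbar (premut_hd x)) :=
  match x with
  | Keep c =>
      (to_off Mbar (hd (val c)) \o (rmap M (val c) \o from_off Mbar (tl (val c))))%VF
  | Comp b a =>
      (to_off Mbar (hd (val b))
       \o (act1 M (hd (val b)) (val b) k \o act1 M k (val a) (tl (val a)))
       \o from_off Mbar (tl (val a)))%VF
  | StarIn a =>
      (to_off Mbar (tl (val a)) \o (dsum_proj _ a \o star_in) \o from_k Mbar k)%VF
  | StarOut b =>
      (to_k Mbar k \o (star_out \o dsum_inj _ b) \o from_off Mbar (hd (val b)))%VF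
  end.

Definition premut_rep : rep K (premut Q k) :=
  @Rep K V (premut Q k) (mut_space Mbar) premut_rmap.

Definition i_tilde : 'Hom(ker_gamma_mod, coker_beta) :=
  qlift im_beta_in_ker (qpi (limg beta) \o vincl (lker gamma))%VF.

Definition gamma_tilde : 'Hom(coker_beta, im_gamma) :=
  qlift (limg beta) (vcores (limg gamma) \o gamma)%VF.

Definition rho_tilde : 'Hom(coker_beta, ker_gamma_mod) :=
  qlift (limg beta) (qpi im_beta_in_ker \o rho)%VF.

(** As [gamma_tilde] is onto, this is the only solution of
    [id = i_tilde rho_tilde + j gamma_tilde]. *)
Definition j_map : 'Hom(im_gamma, coker_beta) :=
  ((\1 - (i_tilde \o rho_tilde)) \o gamma_tilde^-1)%VF.

Definition pi_map : 'Hom(ker_alpha, ker_alpha_mod) := qpi im_gamma_in_ker.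

Definition iota_map : 'Hom(im_gamma, ker_alpha) :=
  (vcores (lker alpha) \o vincl (limg gamma))%VF.

(** As [iota_map] is the inclusion, this is the only solution of
    [id = iota epsilon + sigma pi]. *)
Definition epsilon_map : 'Hom(ker_alpha, im_gamma) :=
  (vcores (limg gamma) \o (vincl (lker alpha) \o (\1 - (sigma \o pi_map))))%VF.

End Objects.

(** Only the choices at modules over the Jacobian algebra of [(Q, T)] are
    relevant; the maps exist, and may be chosen arbitrarily, at all others. *)
Record premut_choice (T : cpa K Q) := PremutChoice {
  ch_rho : forall M : rep K Q, 'Hom(Mout M, ker_gamma T M);
  ch_sigma : forall M : rep K Q, 'Hom(ker_alpha_mod T M, ker_alpha M);
  ch_rhoK : forall M, (ch_rho M \o vincl (lker (gamma T M)))%VF = \1%VF;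
  ch_sigmaK : forall M, (pi_map T M \o ch_sigma M)%VF = \1%VF }.

Lemma Mbar_components (T : cpa K Q) (M : rep K Q) u v w (y : Mbar T M) :
  [/\ Mbar1 T M y = y.1.1, Mbar2 T M y = y.1.2 & Mbar3 T M y = y.2] /\
  [/\ Mbar_in1 T M u = (u, 0, 0), Mbar_in2 T M v = (0, v, 0)
    & Mbar_in3 T M w = (0, 0, w)].
Proof.
have E (A B : vectType K) (f : A -> B) : linear f -> linfun f =1 f.
  move=> fL; pose L := GRing.isLinear.Build K _ _ _ f fL.
  by pose F : {linear A -> B} := HB.pack f L; exact: (lfunE F).
have Z (A : vectType K) (c : K) : 0 = c *: 0 + 0 :> A by rewrite scaler0 addr0.
by split; split; rewrite E // => c a b /=; do 2?[congr pair]; apply: Z.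
Qed.

Section Morphisms.
Variables (T : cpa K Q) (ch : premut_choice T) (M N : rep K Q) (f : maps M N).

Definition f_in : 'Hom(Min M, Min N) :=
  \sum_(a : in_arrow) (dsum_inj _ a \o (f (tl (val a)) \o dsum_proj _ a))%VF.

Definition f_out : 'Hom(Mout M, Mout N) :=
  \sum_(b : out_arrow) (dsum_inj _ b \o (f (hd (val b)) \o dsum_proj _ b))%VF.

Definition f_in_ker : 'Hom(ker_alpha M, ker_alpha N) :=
  (vcores (lker (alpha N)) \o (f_in \o vincl (lker (alpha M))))%VF.

Definition f_out_coker : 'Hom(coker_beta M, coker_beta N) :=
  qlift (limg (beta M)) (qpi (limg (beta N)) \o f_out)%VF.

Definition premut_hom_k : 'Hom(Mbar T M, Mbar T N) :=
  let rN := rho_tilde (ch_rho ch N) in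
  let gN := gamma_tilde T N in
  let eN := epsilon_map (ch_sigma ch N) in
  let pN := pi_map T N in
  let iM := i_tilde T M in
  let jM := j_map (ch_rho ch M) in
  let incM := iota_map T M in
  let sM := ch_sigma ch M in
  let E (A B : vectType K) (u : 'Hom(B, Mbar T N)) (g : 'Hom(A, B))
        (v : 'Hom(Mbar T M, A)) := (u \o (g \o v))%VF in
    E _ _ (Mbar_in1 T N) (rN \o f_out_coker \o iM)%VF (Mbar1 T M)
  + E _ _ (Mbar_in1 T N) (rN \o f_out_coker \o jM)%VF (Mbar2 T M)
  + E _ _ (Mbar_in2 T N) (gN \o f_out_coker \o iM)%VF (Mbar1 T M)
  + E _ _ (Mbar_in2 T N) (eN \o f_in_ker \o incM)%VF (Mbar2 T M)
  + E _ _ (Mbar_in2 T N) (eN \o f_in_ker \o sM)%VF (Mbar3 T M)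
  + E _ _ (Mbar_in3 T N) (pN \o f_in_ker \o incM)%VF (Mbar2 T M)
  + E _ _ (Mbar_in3 T N) (pN \o f_in_ker \o sM)%VF (Mbar3 T M).

Definition premut_maps (s : K) :
    maps (premut_rep s (ch_rho ch M) (ch_sigma ch M))
         (premut_rep s (ch_rho ch N) (ch_sigma ch N)) :=
  fun i => match i == k as b
    return 'Hom(if b then Mbar T M else M i, if b then Mbar T N else N i) with
  | true => premut_hom_k
  | false => f i
  end.

End Morphisms.

End PremutRep.

Section MutationFunctors.
Variables (K : fieldType) (V : finType) (Q : quiver V) (S : cpa K Q) (k : V).
Local Notation Qm := (premut Q k).
Local Notation Sm := (premut_pot k 1 S).
Local Notation Qmm := (premut Qm k).
Local Notation Smm := (premut_pot k (-1) Sm).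

Variables (Qt Qr : quiver V).
Variable phi : {rmorphism cpa K (qsum Qt Qr) -> cpa K Qm}.

Definition phi_r (x : cpa K Qr) : cpa K Qm := phi (ext_r Qt x).

Definition mu_plus_obj (ch : premut_choice k S) (M : rep K Q) : rep K Qr :=
  pullback (fun c => phi_r (arr_el c))
           (premut_rep 1 (ch_rho ch M) (ch_sigma ch M)).

Definition mu_plus_maps (ch : premut_choice k S) (M N : rep K Q)
    (f : maps M N) : maps (mu_plus_obj ch M) (mu_plus_obj ch N) :=
  premut_maps ch f 1.

(** A representative of the preimage of the class of the arrow [c] under the
    isomorphism of Jacobian algebras induced by [phi_r]. *)
Definition phi_r_inv (c : arrow Qm) : cpa K Qr :=
  if pselect (exists y, jacobian Sm (phi_r y - arr_el c)) is left e
  then projT1 (cid e) else 0.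

Definition star_in_arrow (a : in_arrow Q k) : out_arrow Qm k :=
  exist _ (StarIn a : arrow Qm) (eqxx k).
Definition star_out_arrow (b : out_arrow Q k) : in_arrow Qm k :=
  exist _ (StarOut b : arrow Qm) (eqxx k).
Definition keep_arrow (c : off_arrow Q k) : off_arrow Qm k :=
  exist _ (Keep c : arrow Qm) (valP c).

(** [a |-> a^**], [b |-> b^**] and [c |-> c] for [c] not incident to [k]. *)
Definition double_star (a : arrow Q) : cpa K Qmm :=
  if insub a is Some a' then arr_el (StarOut (star_in_arrow a') : arrow Qmm)
  else if insub a is Some b' then arr_el (StarIn (star_out_arrow b') : arrow Qmm)
  else if insub a is Some c' then arr_el (Keep (keep_arrow c') : arrow Qmm)
  else 0.

Definition mu_minus_obj (ch : premut_choice k Sm) (N : rep K Qr) : rep K Q :=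
  let N' := pullback phi_r_inv N in
  pullback double_star (premut_rep (-1) (ch_rho ch N') (ch_sigma ch N')).

Definition mu_minus_maps (ch : premut_choice k Sm) (M N : rep K Qr)
    (f : maps M N) : maps (mu_minus_obj ch M) (mu_minus_obj ch N) :=
  @premut_maps K V Qm k Sm ch (pullback phi_r_inv M) (pullback phi_r_inv N) f (-1).

End MutationFunctors.

(* Main.v *)
Require Import Defs.
From HB Require Import structures.
From mathcomp Require Import all_boot all_order all_algebra.
From mathcomp Require Import boolp zify.

(** Two morphisms of modules agreeing at all vertices other than [k] are equal
    modulo [add S_k], and at [k] a module matters only through the kernel of
    [alpha], the image of [beta] and the composite [beta alpha]: any family of maps
    off [k] compatible with these data extends to a morphism.  For the
    pre-mutation, a family in [M_out] is killed by the [b^*] iff it lies in the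
    image of [beta], a family in [M_in] is of the form [a^* y] iff it is killed by
    [alpha], and [a^* b^*] acts as [-s d_(ba) T].  Applying this twice, with
    opposite signs, the double mutation has the same data as the original module,
    as the derivative of the mutated potential along [a^* b^*] is [[ba]].  The
    identity maps off [k] thus extend to mutually inverse isomorphisms modulo
    [add S_k], for both composites, and these are natural since they are so off
    [k].  The passage to reduced parts is harmless: by the chain rule for cyclic
    derivatives, the splitting right-equivalence identifies the Jacobian algebras. *)

Set Implicit Arguments.
Unset Strict Implicit.
Unset Printing Implicit Defensive.

Import GRing.Theory.
Local Open Scope ring_scope.

(** * Complete path algebras *)

(** Two obstacles shape the argument. Series are infinite sums. Each is, however, a finite
    expression in its constant terms and its left quotients [lres], so an identity between actions
    on a nilpotent representation can be proved by coinduction ([nilp_coind]): if every defect is a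
    sum of arrows applied to defects of the same kind, it factors through paths of any length and
    vanishes. For cyclic derivatives, congruences modulo powers of the arrow ideal play this role.
    The second obstacle is the vertex [k], where the double mutation and the original module have
    unrelated spaces. No two matrices at [k] are ever multiplied: an extension at [k] is chosen by
    linear algebra, it need be neither canonical nor invertible, and functor laws and naturality are
    tested off [k], where the comparison maps are identities up to a case distinction. The sign is
    fixed by [a^* b^*] acting as [- s] times the derivative along [ba]: since [s * s = 1] this
    matches the relation of [[ba]], and [s = -1] in the second mutation turns the derivative [[ba]]
    into the product [ba] with sign plus. *)

Section Series.
Variables (K : fieldType) (V : finType) (Q : quiver V).
Local Notation A := (cpa K Q).
Implicit Types (x y z : A) (i j : V) (w u v : seq (arrow Q)) (a b c : arrow Q).

Lemma cpa_coef0 i w : coef (0 : A) i w = 0.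
Proof. by rewrite /GRing.zero /= coef_mkser if_same. Qed.

Lemma cpa_coef1 i w : coef (1 : A) i w = (nilp w)%:R.
Proof. by rewrite /GRing.one /= coef_mkser; case: w => //= c w; rewrite if_same. Qed.

Lemma cpa_coefB x y i w : coef (x - y) i w = coef x i w - coef y i w.
Proof. by rewrite cpa_coefD cpa_coefN. Qed.

Lemma cpa_coef_sum (I : Type) (r : seq I) (P : pred I) (F : I -> A) i w :
  coef (\sum_(l <- r | P l) F l) i w = \sum_(l <- r | P l) coef (F l) i w.
Proof.
elim/big_rec2: _ => [|l y x _ <-]; first exact: cpa_coef0.
by rewrite cpa_coefD.
Qed.

Lemma coef_mono i w j u :
  coef (mono K i w) j u = (walk i w && ((j, u) == (i, w)))%:R.
Proof.
rewrite coef_mkser; have [[-> ->]|] := eqVneq (j, u) (i, w).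
  by rewrite andbT; case: ifP.
by rewrite andbF if_same.
Qed.

Lemma mono_out i w : ~~ walk i w -> mono K i w = 0.
Proof. by move=> /negbTE nw; apply/cpaP => j u; rewrite coef_mono nw cpa_coef0. Qed.

Lemma coef_idem i j u : coef (idem Q i : A) j u = ((j == i) && nilp u)%:R.
Proof. by rewrite coef_mono /= xpair_eqE; case: u. Qed.

Lemma coef_arr c j u : coef (arr_el c : A) j u = ((j == hd c) && (u == [:: c]))%:R.
Proof. by rewrite coef_mono /= eqxx. Qed.

Lemma coef_idem_mul l x i w : coef (idem Q l * x) i w = (i == l)%:R * coef x i w.
Proof.
rewrite cpa_coefM big_nat_recl //= take0 drop0 coef_idem andbT big_nat big1 ?addr0 //.
move=> j /andP[_ jw]; rewrite coef_idem; case: w jw => //= c w _.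
by rewrite andbF mul0r.
Qed.

Lemma coef_mul_idem l x i w : coef (x * idem Q l) i w = coef x i w * (wend i w == l)%:R.
Proof.
rewrite cpa_coefM big_nat_recr //= take_size drop_size coef_idem andbT.
rewrite big_nat big1 ?add0r // => j /andP[_ jw]; rewrite coef_idem.
by rewrite /nilp size_drop subn_eq0 leqNgt jw andbF mulr0.
Qed.

Lemma coef_arr_mul c x i w :
  coef (arr_el c * x) i w =
  if w is d :: v then ((d == c) && (i == hd c))%:R * coef x (tl c) v else 0.
Proof.
rewrite cpa_coefM; case: w => [|d v].
  by rewrite big_nat1 coef_arr andbF mul0r.
rewrite big_nat_recl // take0 coef_arr andbF mul0r add0r.
rewrite /= big_nat_recl // take0 drop0 coef_arr eqseq_cons /= andbT.
rewrite big_nat big1 ?addr0.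
  by rewrite andbC; case: (d =P c) => [->|_] //=; rewrite !mul0r.
move=> j /andP[_ jv]; rewrite coef_arr eqseq_cons.
by case: v jv => //= e v _; rewrite !andbF mul0r.
Qed.

Lemma monoM i u j v :
  mono K i u * mono K j v = (wend i u == j)%:R *: mono K i (u ++ v).
Proof.
apply/cpaP => l w; rewrite cpa_coefM cpa_coefZ.
have E p : coef (mono K i u) l (take p w) * coef (mono K j v) (wend l (take p w)) (drop p w)
   = if (p == size u :> nat) && (p <= size w)%N then (wend i u == j)%:R * coef (mono K i (u ++ v)) l w
     else coef (mono K i u) l (take p w) * coef (mono K j v) (wend l (take p w)) (drop p w).
  case: ifP => // /andP[/eqP -> le]; rewrite !coef_mono walk_cat !xpair_eqE.
  have [->|_] := eqVneq l i; last by rewrite !andbF mul0r mulr0.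
  rewrite -{4}[w](cat_take_drop (size u)) eqseq_cat ?size_takel //.
  have [->|_] := eqVneq (take (size u) w) u; last by rewrite !andbF mul0r mulr0.
  have [->|_] := eqVneq (wend i u) j; last by rewrite !andbF mulr0 mul0r.
  by rewrite /= mul1r !andbT -natrM mulnb andbA.
have [le|gt] := leqP (size u) (size w).
  rewrite (bigD1_seq (size u)) ?mem_index_iota ?iota_uniq //= E eqxx le /=.
  rewrite big1_seq ?addr0 // => p; rewrite mem_index_iota => /andP[/negP pu /andP[_ pw]].
  rewrite coef_mono xpair_eqE; case: (_ =P u) => [eu|_]; last by rewrite !andbF mul0r.
  by case: pu; rewrite -eu size_takel.
rewrite big1_seq.
  rewrite coef_mono xpair_eqE; case: (w =P _) => [ew|_]; last by rewrite !andbF mulr0.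
  by move: gt; rewrite ew size_cat ltnNge leq_addr.
move=> p /andP[_ _]; rewrite coef_mono xpair_eqE; case: (take p w =P u) => [eu|_].
  by move: gt; rewrite -eu size_take_min ltnNge geq_minr.
by rewrite !andbF mul0r.
Qed.

Lemma mono_cons c i w : i = hd c -> mono K i (c :: w) = arr_el c * mono K (tl c) w.
Proof. by move->; rewrite monoM /= eqxx scale1r. Qed.

Lemma sum_idem : \sum_i idem Q i = 1 :> A.
Proof.
apply/cpaP => j w; rewrite cpa_coef_sum cpa_coef1 (bigD1 j) //= coef_idem eqxx.
rewrite big1 ?addr0 // => l lj; by rewrite coef_idem eq_sym (negbTE lj).
Qed.

Lemma cpa_scalerAl (k : K) x y : k *: (x * y) = (k *: x) * y.
Proof.
apply/cpaP => i w; rewrite cpa_coefZ !cpa_coefM mulr_sumr.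
by apply: eq_bigr => j _; rewrite cpa_coefZ mulrA.
Qed.

Lemma cpa_scalerAr (k : K) x y : k *: (x * y) = x * (k *: y).
Proof.
apply/cpaP => i w; rewrite cpa_coefZ !cpa_coefM mulr_sumr.
by apply: eq_bigr => j _; rewrite cpa_coefZ mulrCA.
Qed.

Lemma idem_arr c i : idem Q i * arr_el c = (hd c == i)%:R *: (arr_el c : A).
Proof.
apply/cpaP => l w; rewrite coef_idem_mul cpa_coefZ coef_arr.
by case: (l =P hd c) => [->|_]; rewrite // !mulr0.
Qed.

Lemma arr_idem c i : arr_el c * idem Q i = (tl c == i)%:R *: (arr_el c : A).
Proof.
apply/cpaP => l w; rewrite coef_mul_idem cpa_coefZ coef_arr mulrC.
by case: (w =P [:: c]) => [->|_] //=; rewrite andbF !mulr0.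
Qed.

Lemma idemM i j : idem Q i * idem Q j = (i == j)%:R *: (idem Q i : A).
Proof. by rewrite monoM. Qed.

(** Left division by the arrow [c]. *)
Definition lres c x : A :=
  mkser (fun i w => if i == tl c then coef x (hd c) (c :: w) else 0).

Lemma coef_lres c x i w :
  coef (lres c x) i w = if i == tl c then coef x (hd c) (c :: w) else 0.
Proof.
rewrite coef_mkser; case: (i =P tl c) => [->|_]; last by rewrite if_same.
case: ifP => // /negbT nw; rewrite coef_out //=; by rewrite negb_and nw orbT.
Qed.

(** The sum is finite, as there are finitely many arrows. It peels off the outermost arrow, which is
    the first letter of the word; inductions over series start from here. *)
Lemma lres_eq x : x = \sum_i coef x i [::] *: idem Q i + \sum_c arr_el c * lres c x.
Proof.
apply/cpaP => i w; rewrite cpa_coefD !cpa_coef_sum; case: w => [|d v].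
  rewrite [X in _ + X]big1 ?addr0; last by move=> c _; rewrite coef_arr_mul.
  rewrite (bigD1 i) //= cpa_coefZ coef_idem eqxx mulr1 big1 ?addr0 // => j ji.
  by rewrite cpa_coefZ coef_idem eq_sym (negbTE ji) mulr0.
rewrite big1 ?add0r; last by move=> j _; rewrite cpa_coefZ coef_idem andbF mulr0.
rewrite (bigD1 d) //= coef_arr_mul eqxx /= big1 ?addr0.
  rewrite coef_lres eqxx; case: eqP => [->|/eqP ne]; first by rewrite mul1r.
  by rewrite mul0r coef_out //= eq_sym (negbTE ne).
by move=> c cd; rewrite coef_arr_mul eq_sym (negbTE cd) mul0r.
Qed.

Lemma coefM_nil x y i : coef (x * y) i [::] = coef x i [::] * coef y i [::].
Proof. by rewrite cpa_coefM big_nat1. Qed.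

(** In a product the first letter belongs to the left factor, unless that factor contributes its
    constant term at the head of [c]. *)
Lemma lresM c x y : lres c (x * y) = coef x (hd c) [::] *: lres c y + lres c x * y.
Proof.
apply/cpaP => i w; rewrite cpa_coefD cpa_coefZ !coef_lres.
have [->|ne] := eqVneq i (tl c).
  rewrite [LHS]cpa_coefM big_nat_recl // take0 drop0 cpa_coefM; congr (_ + _).
  by apply: eq_bigr => j _; rewrite coef_lres eqxx.
rewrite mulr0 add0r cpa_coefM big1 // => j _.
by rewrite coef_lres (negbTE ne) mul0r.
Qed.

(** [depth n x] says that [x] lies in the [n]-th power of the arrow ideal. *)
Definition depth n x := forall i w, (size w < n)%N -> coef x i w = 0.

Lemma depth0 n : depth n 0. Proof. by move=> i w _; rewrite cpa_coef0. Qed.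

Lemma depthD n x y : depth n x -> depth n y -> depth n (x + y).
Proof. by move=> dx dy i w ltw; rewrite cpa_coefD dx ?dy ?addr0. Qed.

Lemma depthN n x : depth n x -> depth n (- x).
Proof. by move=> dx i w ltw; rewrite cpa_coefN dx ?oppr0. Qed.

Lemma depthB n x y : depth n x -> depth n y -> depth n (x - y).
Proof. by move=> dx dy; apply: depthD => //; apply: depthN. Qed.

Lemma depthZ n k x : depth n x -> depth n (k *: x).
Proof. by move=> dx i w ltw; rewrite cpa_coefZ dx ?mulr0. Qed.

Lemma depth_sum n (I : Type) (r : seq I) (P : pred I) (F : I -> A) :
  (forall l, P l -> depth n (F l)) -> depth n (\sum_(l <- r | P l) F l).
Proof.
by move=> dF; elim/big_rec: _ => [|l x /dF]; [exact: depth0 | exact: depthD].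
Qed.

Lemma depthM m n x y : depth m x -> depth n y -> depth (m + n) (x * y).
Proof.
move=> dx dy i w ltw; rewrite cpa_coefM big_nat big1 // => j /andP[_ jw].
have [jm|mj] := ltnP j m; first by rewrite dx ?mul0r // size_take_min (leq_ltn_trans (geq_minl _ _)).
rewrite dy ?mulr0 // size_drop ltn_subLR // (leq_trans ltw) // leq_add2r; exact: mj.
Qed.

Lemma depthW m n x : (m <= n)%N -> depth n x -> depth m x.
Proof. by move=> mn dx i w ltw; apply: dx; apply: leq_trans mn. Qed.

Lemma depthMl n x y : depth n y -> depth n (x * y).
Proof. by move=> dy; rewrite -[n]add0n; apply: depthM. Qed.

Lemma depthMr n x y : depth n x -> depth n (x * y).
Proof. by move=> dx; rewrite -[n]addn0; apply: depthM. Qed.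

Lemma depth_mono n i w : (n <= size w)%N -> depth n (mono K i w).
Proof.
move=> nw j u ltu; rewrite coef_mono xpair_eqE; case: (u =P w) => [eu|_].
  by move: ltu; rewrite eu ltnNge nw.
by rewrite !andbF.
Qed.

Lemma depth_lres n x c : depth n.+1 x -> depth n (lres c x).
Proof. by move=> dx i w ltw; rewrite coef_lres dx ?if_same. Qed.

Lemma madic_closureP (X : A -> Prop) x :
  madic_closure X x <-> forall n, exists2 y, X y & depth n (x - y).
Proof.
split=> cX n; have [y Xy e] := cX n; exists y => // i w ltw.
  by rewrite cpa_coefB e ?subrr.
by apply/eqP; rewrite -subr_eq0 -cpa_coefB e.
Qed.

Lemma depth_eq0 x : (forall n, depth n x) -> x = 0.
Proof. by move=> dx; apply/cpaP => i w; rewrite cpa_coef0; apply: (dx (size w).+1). Qed.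

(** Modulo depth [n] a series is a finite combination of paths. The induction on [n] replaces [P] by
    its composite with left multiplication by an arrow, which lowers the required depth by one. *)
Lemma cpa_ind n (P : A -> Prop) :
    (forall x y, P x -> P y -> P (x + y)) -> (forall k x, P x -> P (k *: x)) ->
    (forall i w, walk i w -> P (mono K i w)) -> (forall x, depth n x -> P x) ->
  forall x, P x.
Proof.
elim: n P => [|n IHn] P PD PZ Pm Pd x; first exact: Pd.
have P0 : P 0 by apply/Pd/depth0.
rewrite [x]lres_eq; apply: (PD).
  by elim/big_rec: _ => // i y _; apply: (PD); apply/PZ/Pm.
elim/big_rec: _ => // c y _; apply: (PD).
move: (lres c x); apply: IHn.
- by move=> y1 y2 P1 P2; rewrite mulrDr; apply: (PD).
- by move=> k y1 P1; rewrite -cpa_scalerAr; apply: (PZ).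
- move=> i w wk; rewrite monoM; apply: PZ => /=.
  have [?|?] := boolP (walk (hd c) (c :: w)); first exact: Pm.
  by rewrite mono_out.
- by move=> y1 d1; apply: Pd; apply: (@depthM 1) => //; apply: depth_mono.
Qed.

End Series.

(** * Evaluation of series on nilpotent representations *)

Lemma big_tuple_cons (R : nmodType) (T : finType) n (F : seq T -> R) :
  \sum_(w : n.+1.-tuple T) F w = \sum_c \sum_(w : n.-tuple T) F (c :: w).
Proof.
rewrite pair_bigA /= (reindex (fun p : T * n.-tuple T => [tuple of p.1 :: p.2])) //=.
exists (fun w => (thead w, [tuple of behead w])) => [[c w] _|w _].
  by congr pair; apply/val_inj.
by rewrite [w in RHS]tuple_eta; apply/val_inj.
Qed.

Lemma comp_lfun_sumr (K : fieldType) (U W T : vectType K) (I : Type) (r : seq I)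
    (P : pred I) (f : 'Hom(W, T)) (g : I -> 'Hom(U, W)) :
  (f \o \sum_(l <- r | P l) g l)%VF = \sum_(l <- r | P l) (f \o g l)%VF.
Proof.
elim/big_rec2: _ => [|l y x _ <-]; first exact: comp_lfun0r.
by rewrite comp_lfunDr.
Qed.

Section Rep.
Variables (K : fieldType) (V : finType) (Q : quiver V).
Local Notation A := (cpa K Q).
Implicit Types (M N : rep K Q) (x y : A) (i j l : V) (w u : seq (arrow Q)) (c : arrow Q).

Lemma id_atxx M i : id_at M i i = \1%VF.
Proof. by rewrite /id_at; case: eqP => // e; rewrite eq_axiomK. Qed.

Lemma id_at_neq M i j : j != i -> id_at M i j = 0.
Proof. by rewrite /id_at; case: eqP => // ->; rewrite eqxx. Qed.

Lemma act1E M c : act1 M (hd c) c (tl c) = rmap M c.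
Proof. by rewrite /act1 !id_atxx comp_lfun1l comp_lfun1r. Qed.

Lemma act1_hd M i c j : hd c != i -> act1 M i c j = 0.
Proof. by move=> ne; rewrite /act1 id_at_neq // comp_lfun0l. Qed.

Lemma act1_tl M i c j : tl c != j -> act1 M i c j = 0.
Proof. by move=> ne; rewrite /act1 (@id_at_neq _ (tl c)) 1?eq_sym // !comp_lfun0r. Qed.

Lemma act1_id M i c j : (act1 M i c (tl c) \o id_at M (tl c) j)%VF = act1 M i c j.
Proof. by rewrite /act1 id_atxx comp_lfun1r !comp_lfunA. Qed.

Lemma id_act1 M i c j : (id_at M i (hd c) \o act1 M (hd c) c j)%VF = act1 M i c j.
Proof. by rewrite /act1 id_atxx comp_lfun1l. Qed.

Lemma act1_cast M i c j : tl c = j ->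
  (act1 M i c j \o id_at M j (tl c))%VF = act1 M i c (tl c).
Proof. by move <-; rewrite id_atxx comp_lfun1r. Qed.

Lemma cast_act1 M i c j : hd c = i ->
  (id_at M (hd c) i \o act1 M i c j)%VF = act1 M (hd c) c j.
Proof. by move <-; rewrite id_atxx comp_lfun1l. Qed.

Lemma act_rcons M i w c j :
  act M i (rcons w c) j = (act M i w (hd c) \o act1 M (hd c) c j)%VF.
Proof.
elim: w i => [|d w IHw] i /=; first by rewrite act1_id id_act1.
by rewrite IHw comp_lfunA.
Qed.

Lemma act_act1 M l w i c j (v : M j) : act M l w i (act1 M i c j v) =
  if hd c == i then act M l (rcons w c) j v else 0.
Proof.
case: (hd c =P i) => [<-|/eqP ne]; first by rewrite act_rcons comp_lfunE.
by rewrite act1_hd // zero_lfunE linear0.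
Qed.

(** Iterating the hypothesis turns [v] into a sum of long paths applied to vectors, and long paths
    act by 0. *)
Lemma nilp_coind M (P : forall i, M i -> Prop) : nilpotent M ->
    (forall i v, P i v -> exists2 F : forall c, M (tl c),
       v = \sum_c act1 M i c (tl c) (F c) & forall c, hd c = i -> P (tl c) (F c)) ->
  forall i v, P i v -> v = 0.
Proof.
case=> n nilM PF i v Pv.
(* [w] is the path already extracted, and [m] bounds the number of letters still missing to reach
   the nilpotency bound [n]. *)
suff H m w l : (n - m <= size w)%N -> forall i v, P i v -> act M l w i v = 0.
  by rewrite -[v]id_lfunE -(id_atxx M); apply: (H n [::] i _ i v Pv); rewrite subnn.
elim: m w l => [|m IHm] w l le {Pv} {i v} i v.
  by rewrite subn0 in le; rewrite nilM // zero_lfunE.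
case/PF => F -> PFc; rewrite linear_sum /= big1 // => c _; rewrite act_act1.
case: eqP => // e; apply: IHm; last exact: PFc.
by rewrite size_rcons; move: le; rewrite !leq_subLR addSnnS.
Qed.

(** The component at [i] of the [n]-th power of the arrow ideal applied to [M]. *)
Fixpoint pow M n i : {vspace M i} :=
  if n is m.+1 then (\sum_(c | hd c == i) (act1 M i c (tl c) @: pow M m (tl c)))%VS
  else fullv.

Lemma act_pow M i w j v : act M i w j v \in pow M (size w) i.
Proof.
elim: w i => [|c w IHw] i /=; first exact: memvf.
rewrite comp_lfunE; have [e|ne] := eqVneq (hd c) i.
  apply: subvP (memv_img _ (IHw _)) .
  by apply: (sumv_sup c); [apply/eqP | apply: subvv].
by rewrite act1_hd // zero_lfunE mem0v.
Qed.

Lemma pow_sub M n i : (pow M n.+1 i <= pow M n i)%VS.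
Proof.
elim: n i => [|n IHn] i; first exact: subvf.
apply/subv_sumP => c hc; apply: subv_trans (limgS _ (IHn _)) _.
by apply: (sumv_sup c) (subvv _).
Qed.

Lemma pow_le M m n i : (m <= n)%N -> (pow M n i <= pow M m i)%VS.
Proof.
by move/subnK <-; elim: (n - m)%N => // p; apply: subv_trans (pow_sub M _ i).
Qed.

(** The total dimension drops until two consecutive terms agree at every vertex. From then on each
    vector is a sum of arrow images of vectors of the same family, hence 0 by [nilp_coind]. *)
Lemma pow_total_dim M i : nilpotent M -> pow M (total_dim M) i = 0%VS.
Proof.
move=> nilM; pose D n := (\sum_i \dim (pow M n i))%N.
suff H n : (forall i, pow M n i = 0%VS) \/ (D n + n <= total_dim M)%N.
  case: (H (total_dim M)) => [-> //|]; rewrite -[X in (_ <= X)%N]add0n leq_add2r leqn0.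
  by rewrite sum_nat_eq0 => /forallP /(_ i) /=; rewrite dimv_eq0 => /eqP.
elim: n => [|n [IHn|IHn]]; first by right; rewrite addn0.
  by left=> l; apply/eqP; rewrite -subv0 -(IHn l) pow_sub.
have [le|gt] := leqP (D n) (D n.+1); last by right; rewrite (leq_trans _ IHn) // -addSnnS leq_add2r.
left=> l; have E j : pow M n.+1 j = pow M n j.
  apply/eqP; rewrite eqEdim pow_sub /=; move: le; rewrite /D.
  rewrite (bigD1 j) //= [X in (_ <= X)%N](bigD1 j) //= => le.
  rewrite -(leq_add2r (\sum_(l < #|V| | true) 0 + \sum_(i | i != j) \dim (pow M n i))%N).
  rewrite big1 // !add0n (leq_trans le) // leq_add2l leq_sum // => p _.
  by rewrite dimvS // pow_sub.
rewrite E; apply/vspaceP => v; rewrite memv0; apply/idP/eqP => [|->]; last exact: mem0v.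
move: l v; apply: (@nilp_coind M (fun l v => v \in pow M n l)) => // l v.
rewrite -E => /memv_sumP[F Fm ->].
have /fin_all_exists [G GP] c : exists u : M (tl c),
    hd c == l -> u \in pow M n (tl c) /\ F c = act1 M l c (tl c) u.
  case: (boolP (hd c == l)) => [e|_]; last by exists 0.
  by have /memv_imgP[u um ->] := Fm _ e; exists u.
exists G; last by move=> c /eqP /GP [].
rewrite big_mkcond; apply: eq_bigr => c _; case: ifP => [/GP[_ //]|/negbT ne].
by rewrite act1_hd // zero_lfunE.
Qed.

Lemma act_long M i w j : nilpotent M -> (total_dim M <= size w)%N -> act M i w j = 0.
Proof.
move=> nilM le; apply/lfunP => v; rewrite zero_lfunE; apply/eqP.
by rewrite -memv0 -(pow_total_dim i nilM) (subvP (pow_le M i le)) // act_pow.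
Qed.

Definition evaln M n x i j : 'Hom(M j, M i) :=
  \sum_(m < n) \sum_(w : m.-tuple (arrow Q)) coef x i w *: act M i w j.

Lemma evalnS M n x i j : evaln M n.+1 x i j =
  coef x i [::] *: id_at M i j
  + \sum_c (act1 M i c (tl c) \o evaln M n (lres c x) (tl c) j)%VF.
Proof.
rewrite /evaln big_ord_recl /= (big_pred1 [tuple]) /=; last by move=> w; apply/esym/eqP; exact: tuple0.
congr (_ + _); under [RHS]eq_bigr => c _ do rewrite comp_lfun_sumr.
rewrite exchange_big; apply: eq_bigr => m _ /=.
rewrite (big_tuple_cons _ (fun w => coef x i w *: act M i w j)); apply: eq_bigr => c _.
rewrite comp_lfun_sumr; apply: eq_bigr => w _ /=.
rewrite -comp_lfunZr coef_lres eqxx; have [->//|ne] := eqVneq (hd c) i.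
by rewrite act1_hd // comp_lfun0l !scaler0.
Qed.

(** Paths of length [total_dim M] already act by 0, so [eval] sums one length more than necessary.
    This slack lets [eval_unroll] have the same truncation on both sides. *)
Lemma evaln_last M x i j : nilpotent M ->
  evaln M (total_dim M).+1 x i j = evaln M (total_dim M) x i j.
Proof.
move=> nilM; rewrite /evaln big_ord_recr /= [X in _ + X]big1 ?addr0 // => w _.
by rewrite act_long ?scaler0 // size_tuple.
Qed.

Lemma eval_unroll M x i j : nilpotent M -> eval M x i j =
  coef x i [::] *: id_at M i j
  + \sum_c (act1 M i c (tl c) \o eval M (lres c x) (tl c) j)%VF.
Proof.
move=> nilM; rewrite [LHS]evalnS; congr (_ + _).
by apply: eq_bigr => c _; rewrite -evaln_last.
Qed.

Lemma eval_depth M x i j : nilpotent M -> depth (total_dim M) x -> eval M x i j = 0.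
Proof.
move=> nilM dx; rewrite /eval big1 // => n _; rewrite big1 // => w _.
have [lt|ge] := ltnP (size w) (total_dim M); first by rewrite dx ?scale0r.
by rewrite act_long ?scaler0.
Qed.

Lemma evalD M x y i j : eval M (x + y) i j = eval M x i j + eval M y i j.
Proof.
rewrite /eval -big_split; apply: eq_bigr => n _ /=; rewrite -big_split.
by apply: eq_bigr => w _; rewrite cpa_coefD scalerDl.
Qed.

Lemma evalZ M k x i j : eval M (k *: x) i j = k *: eval M x i j.
Proof.
rewrite /eval scaler_sumr; apply: eq_bigr => n _ /=; rewrite scaler_sumr.
by apply: eq_bigr => w _; rewrite cpa_coefZ scalerA.
Qed.

Lemma eval0 M i j : eval M 0 i j = 0.
Proof. by rewrite -(scale0r 0) evalZ scale0r. Qed.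

Lemma evalN M x i j : eval M (- x) i j = - eval M x i j.
Proof. by rewrite -scaleN1r evalZ scaleN1r. Qed.

Lemma evalB M x y i j : eval M (x - y) i j = eval M x i j - eval M y i j.
Proof. by rewrite evalD evalN. Qed.

Lemma eval_sum M (I : Type) (r : seq I) (P : pred I) (F : I -> A) i j :
  eval M (\sum_(l <- r | P l) F l) i j = \sum_(l <- r | P l) eval M (F l) i j.
Proof.
elim/big_rec2: _ => [|l y x _ <-]; first exact: eval0.
by rewrite evalD.
Qed.

(** [P] collects the defects of multiplicativity. On unrolling, the constant terms cancel and the
    defect of [x] becomes the sum of arrows applied to the defects of its left quotients. The same
    scheme proves [hom_eval], [eval_pullback] and [bracket_eval]. *)
Lemma eval_mul M x y i j (v : M j) : nilpotent M ->
  eval M (x * y) i j v = \sum_l eval M x i l (eval M y l j v).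
Proof.
move=> nilM; apply/eqP; rewrite -subr_eq0; apply/eqP; move: i x y j v.
pose P i (d : M i) := exists x y j v,
  d = eval M (x * y) i j v - \sum_l eval M x i l (eval M y l j v).
suff H i d : P i d -> d = 0 by move=> i x y j v; apply: (H i); exists x, y, j, v.
move: i d; apply: nilp_coind => // i _ [x [y [j [v ->]]]].
exists (fun c => eval M (lres c x * y) (tl c) j v
   - \sum_l eval M (lres c x) (tl c) l (eval M y l j v)); last first.
  by move=> c _; exists (lres c x), y, j, v.
have -> : \sum_l eval M x i l (eval M y l j v) = coef x i [::] *: eval M y i j v
    + \sum_l \sum_c act1 M i c (tl c) (eval M (lres c x) (tl c) l (eval M y l j v)).
  have -> : eval M y i j v = \sum_l id_at M i l (eval M y l j v).
    rewrite (bigD1 i) //= id_atxx id_lfunE big1 ?addr0 // => l li.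
    by rewrite id_at_neq // zero_lfunE.
  rewrite scaler_sumr -big_split; apply: eq_bigr => l _ /=.
  rewrite eval_unroll // add_lfunE scale_lfunE sum_lfunE; congr (_ + _).
  by apply: eq_bigr => c _; rewrite comp_lfunE.
rewrite exchange_big /= (eval_unroll (x * y)) // coefM_nil.
rewrite [eval M y i j in X in _ - X]eval_unroll //.
rewrite !(add_lfunE, scale_lfunE, sum_lfunE) scalerDr scalerA -[X in _ - X]addrA opprD addrACA subrr add0r.
rewrite scaler_sumr -big_split -sumrB; apply: eq_bigr => c _ /=.
rewrite !(comp_lfunE (act1 M i c (tl c))) linearB linear_sum /= opprD addrA; congr (_ - _).
rewrite lresM evalD add_lfunE linearD evalZ scale_lfunE linearZ /= addrC.
(* The coefficient coming from [lresM] sits at [hd c], the other one at [i]; if these differ, [act1]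
   is 0. *)
have [<-|ne] := eqVneq (hd c) i; first by rewrite addrA addNr add0r.
by rewrite act1_hd // !zero_lfunE !scaler0 oppr0 !add0r.
Qed.

Lemma eval_idem M l i j : nilpotent M ->
  eval M (idem Q l) i j = (i == l)%:R *: id_at M i j.
Proof.
move=> nilM; rewrite eval_unroll // coef_idem andbT big1 ?addr0 // => c _.
have -> : lres c (idem Q l : A) = 0.
  by apply/cpaP => k w; rewrite coef_lres coef_idem cpa_coef0 andbF if_same.
by rewrite eval0 comp_lfun0r.
Qed.

Lemma eval_idxx M i : nilpotent M -> eval M (idem Q i) i i = \1%VF.
Proof. by move=> nilM; rewrite eval_idem // eqxx scale1r id_atxx. Qed.

Lemma eval_arr M c i j : nilpotent M -> eval M (arr_el c) i j = act1 M i c j.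
Proof.
move=> nilM; rewrite eval_unroll // coef_arr andbF scale0r add0r.
rewrite (bigD1 c) //= big1 ?addr0 => [|d dc].
  have -> : lres c (arr_el c : A) = idem Q (tl c).
    apply/cpaP => l w; rewrite coef_lres coef_arr coef_idem eqxx /=.
    by case: eqP => //; case: w => [|d w]; rewrite eqseq_cons eqxx.
  by rewrite eval_idem // eqxx scale1r act1_id.
have -> : lres d (arr_el c : A) = 0.
  apply/cpaP => l w; rewrite coef_lres coef_arr cpa_coef0 eqseq_cons (negbTE dc).
  by rewrite andbF if_same.
by rewrite eval0 comp_lfun0r.
Qed.

Lemma act_wend M i w j : wend i w != j -> act M i w j = 0.
Proof.
elim: w i => [|c w IHw] i /=; first by move=> ne; rewrite id_at_neq // eq_sym.
by move=> /IHw ->; rewrite comp_lfun0r.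
Qed.

(** [x] is a combination of paths from [t] to [h]. *)
Definition corner h t x := x = idem Q h * x * idem Q t.

Lemma coef_corner h t x i w : corner h t x ->
  coef x i w = (i == h)%:R * coef x i w * (wend i w == t)%:R.
Proof. by move=> e; rewrite {1}e coef_mul_idem coef_idem_mul. Qed.

Lemma corner_eval_hd M h t x i j : corner h t x -> i != h -> eval M x i j = 0.
Proof.
move=> cx ne; rewrite /eval big1 // => n _; rewrite big1 // => w _.
by rewrite (coef_corner _ _ cx) (negbTE ne) !mul0r scale0r.
Qed.

Lemma corner_eval_tl M h t x i j : corner h t x -> j != t -> eval M x i j = 0.
Proof.
move=> cx ne; rewrite /eval big1 // => n _; rewrite big1 // => w _.
rewrite (coef_corner _ _ cx); have [ew|ne'] := eqVneq (wend i w) t.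
  by rewrite act_wend ?scaler0 // ew eq_sym.
by rewrite mulr0 scale0r.
Qed.

Lemma corner_arr c : corner (hd c) (tl c) (arr_el c).
Proof. by rewrite /corner idem_arr eqxx scale1r arr_idem eqxx scale1r. Qed.

(** To be read with [P m] as the [m]-th layer of a filtration in which every arrow moves one layer
    down and which vanishes from [n] on. The clause on 0 covers letters that do not compose, where
    [act] is 0. *)
Lemma nilpotentP M (P : nat -> forall i, M i -> Prop) n :
    (forall i v, P 0%N i v) -> (forall m i, P m i 0) ->
    (forall m c v, P m (tl c) v -> P m.+1 (hd c) (rmap M c v)) ->
    (forall m i v, (n <= m)%N -> P m i v -> v = 0) -> nilpotent M.
Proof.
move=> P0 Pz PS Pn; exists n => i w j le; apply/lfunP => v; rewrite zero_lfunE.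
apply: (Pn (size w)) => // {le}; elim: w i => [|c w IHw] i //=.
rewrite comp_lfunE; have [<-|ne] := eqVneq (hd c) i.
  by rewrite act1E; apply/PS/IHw.
by rewrite act1_hd // zero_lfunE.
Qed.

Lemma hom_act1 M N (f : maps M N) i c j v : is_hom f ->
  f i (act1 M i c j v) = act1 N i c j (f j v).
Proof.
move=> hf; have [<-|ne] := eqVneq (hd c) i; last by rewrite !act1_hd // !zero_lfunE linear0.
case: (tl c =P j) v => [<-|/eqP ne] v; last by rewrite !act1_tl // !zero_lfunE linear0.
by rewrite !act1E -!comp_lfunE hf.
Qed.

Lemma hom_eval M N (f : maps M N) x i j v : nilpotent M -> nilpotent N -> is_hom f ->
  f i (eval M x i j v) = eval N x i j (f j v).
Proof.
move=> nilM nilN hf; apply/eqP; rewrite -subr_eq0; apply/eqP; move: i x j v.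
pose P i (d : N i) := exists x j v, d = f i (eval M x i j v) - eval N x i j (f j v).
suff H i d : P i d -> d = 0 by move=> i x j v; apply: (H i); exists x, j, v.
move: i d; apply: nilp_coind => // i _ [x [j [v ->]]].
exists (fun c => f (tl c) (eval M (lres c x) (tl c) j v) - eval N (lres c x) (tl c) j (f j v));
  last by move=> c _; exists (lres c x), j, v.
rewrite !eval_unroll // !(add_lfunE, scale_lfunE, sum_lfunE) linearD linearZ linear_sum /=.
have -> : f i (id_at M i j v) = id_at N i j (f j v).
  case: (j =P i) v => [->|/eqP ne] v; first by rewrite !id_atxx !id_lfunE.
  by rewrite !id_at_neq // !zero_lfunE linear0.
rewrite opprD addrACA subrr add0r -sumrB; apply: eq_bigr => c _.
by rewrite linearB /= -hom_act1 // (comp_lfunE (act1 M _ _ _)) (comp_lfunE (act1 N _ _ _)).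
Qed.

(** Deep series act by 0, so an element of the closure acts like an element of the ideal that
    approximates it to depth [total_dim M]. *)
Lemma is_module_jacobian (S : A) M x i j : is_module S M -> jacobian S x -> eval M x i j = 0.
Proof.
case=> nilM relM /madic_closureP /(_ (total_dim M))[y Jy dy].
have -> : eval M x i j = eval M y i j.
  by apply/eqP; rewrite -subr_eq0 -evalB eval_depth.
move: i j; elim: Jy => {x y dy}.
- by move=> x [a ->].
- by move=> i j; rewrite eval0.
- by move=> x y _ IHx _ IHy i j; rewrite evalD IHx IHy addr0.
- move=> x y _ IHy i j; apply/lfunP => v; rewrite eval_mul // zero_lfunE big1 // => l _.
  by rewrite IHy zero_lfunE linear0.
move=> x y _ IHy i j; apply/lfunP => v; rewrite eval_mul // zero_lfunE big1 // => l _.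
by rewrite IHy zero_lfunE.
Qed.

End Rep.

Section EvalArrow.
Variables (K : fieldType) (V : finType) (Q : quiver V) (M : rep K Q).
Hypothesis nilM : nilpotent M.
Implicit Types (c : arrow Q) (x : cpa K Q).

Lemma eval_arr_mul c x i j v :
  eval M (arr_el c * x) i j v = act1 M i c (tl c) (eval M x (tl c) j v).
Proof.
rewrite eval_mul // (bigD1 (tl c)) //= big1 ?addr0 ?eval_arr // => l lc.
by rewrite eval_arr // act1_tl ?zero_lfunE // eq_sym.
Qed.

Lemma eval_mul_arr c x i j v :
  eval M (x * arr_el c) i j v = eval M x i (hd c) (act1 M (hd c) c j v).
Proof.
rewrite eval_mul // (bigD1 (hd c)) //= big1 ?addr0 ?eval_arr // => l lc.
by rewrite eval_arr // act1_hd ?zero_lfunE ?linear0 // eq_sym.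
Qed.

End EvalArrow.

(** * Homomorphisms of path algebras and pullback of representations *)

Record cpa_morph (K : fieldType) (V : finType) (Q Q' : quiver V)
    (f : cpa K Q -> cpa K Q') : Prop := CpaMorph {
  cmD : forall x y, f (x + y) = f x + f y;
  cmZ : forall k x, f (k *: x) = k *: f x;
  cmM : forall x y, f (x * y) = f x * f y;
  cm_idem : forall i, f (idem Q i) = idem Q' i }.

Section Morph.
Variables (K : fieldType) (V : finType) (Q Q' : quiver V) (f : cpa K Q -> cpa K Q').
Hypothesis mf : cpa_morph f.

Lemma cm0 : f 0 = 0.
Proof. by rewrite -(scale0r 0) (cmZ mf) scale0r. Qed.

Lemma cmN x : f (- x) = - f x.
Proof. by rewrite -scaleN1r (cmZ mf) scaleN1r. Qed.

Lemma cmB x y : f (x - y) = f x - f y.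
Proof. by rewrite (cmD mf) cmN. Qed.

Lemma cm_sum (I : Type) (r : seq I) (P : pred I) (F : I -> cpa K Q) :
  f (\sum_(l <- r | P l) F l) = \sum_(l <- r | P l) f (F l).
Proof.
by elim/big_rec2: _ => [|l y x _ <-]; [exact: cm0 | rewrite (cmD mf)].
Qed.

Lemma cm_corner h t x : corner h t x -> corner h t (f x).
Proof. by rewrite /corner => {1}->; rewrite !(cmM mf) !(cm_idem mf). Qed.

(** Continuity, which is not a field of [cpa_morph], follows by peeling off one arrow at a time. *)
Lemma cm_depth : (forall c, depth 1 (f (arr_el c))) -> forall n x, depth n x -> depth n (f x).
Proof.
move=> d1; elim=> // n IHn x dx; rewrite [x]lres_eq (cmD mf) !cm_sum.
apply: depthD; apply: depth_sum => l _; first by rewrite dx // scale0r cm0; apply: depth0.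
by rewrite (cmM mf); apply: (@depthM _ _ _ 1) => //; apply/IHn/depth_lres.
Qed.

End Morph.

Lemma cpa_morph_comp (K : fieldType) (V : finType) (Q Q' Q'' : quiver V)
    (g : cpa K Q' -> cpa K Q'') (f : cpa K Q -> cpa K Q') :
  cpa_morph g -> cpa_morph f -> cpa_morph (g \o f).
Proof.
case=> gD gZ gM gi [fD fZ fM fi].
by split=> *; rewrite /= ?fD ?fZ ?fM ?fi ?gD ?gZ ?gM ?gi.
Qed.

Section Pullback.
Variables (K : fieldType) (V : finType) (Q Q' : quiver V).
Implicit Types (M N : rep K Q') (th : arrow Q -> cpa K Q').

Lemma pullback_act1 th N i c j : corner (hd c) (tl c) (th c) ->
  act1 (pullback th N) i c j = eval N (th c) i j.
Proof.
move=> cc; have [<-|ne] := eqVneq (hd c) i; last first.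
  by rewrite act1_hd // (corner_eval_hd _ _ cc) // eq_sym.
have [<-|ne] := eqVneq (tl c) j; first by rewrite act1E.
by rewrite act1_tl // (corner_eval_tl _ _ cc) // eq_sym.
Qed.

Lemma nilpotent_pullback th N : nilpotent N ->
    (forall c, corner (hd c) (tl c) (th c)) -> (forall c, depth 1 (th c)) ->
  nilpotent (pullback th N).
Proof.
(* Layer [m] consists of the vectors killed by all series of depth [total_dim N - m]. Since [th c]
   has no constant term, it gains one layer; in layer [total_dim N] even the idempotent kills
   [v]. *)
move=> nilN cth dth; pose P m i (v : N i) :=
  forall l x, depth (total_dim N - m) x -> eval N x l i v = 0.
apply: (@nilpotentP _ _ _ (pullback th N) P (total_dim N)).
- by move=> i v l x; rewrite subn0 => dx; rewrite eval_depth // zero_lfunE.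
- by move=> m i l x _; rewrite linear0.
- move=> m c v Pv l x dx; have := Pv l (x * th c).
  rewrite eval_mul // (bigD1 (hd c)) //= big1 ?addr0 => [|p pc]; last first.
    by rewrite (corner_eval_hd _ _ (cth c) pc) zero_lfunE linear0.
  apply; apply: depthW (depthM dx (dth c)); rewrite subnS.
  by case: (_ - _)%N => // p; rewrite addn1.
move=> m i v; rewrite -subn_eq0 => /eqP e /(_ i (idem Q' i)); rewrite e eval_idxx // id_lfunE.
by apply.
Qed.

Lemma eval_pullback th N (f : cpa K Q -> cpa K Q') x i j :
    nilpotent N -> nilpotent (pullback th N) -> cpa_morph f ->
    (forall c, f (arr_el c) = th c) ->
  eval (pullback th N) x i j = eval N (f x) i j.
Proof.
move=> nilN nilP mf fth; apply/lfunP => v; apply/eqP; rewrite -subr_eq0; apply/eqP; move: i x j v.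
pose P i (d : pullback th N i) := exists x j v,
  d = eval (pullback th N) x i j v - eval N (f x) i j v.
suff H i d : P i d -> d = 0 by move=> i x j v; apply: (H i); exists x, j, v.
move: i d; apply: nilp_coind => // i _ [x [j [v ->]]].
exists (fun c => eval (pullback th N) (lres c x) (tl c) j v - eval N (f (lres c x)) (tl c) j v);
  last by move=> c _; exists (lres c x), j, v.
rewrite eval_unroll // [in f x](lres_eq x) (cmD mf) !(cm_sum mf) evalD !eval_sum.
rewrite !(add_lfunE, scale_lfunE, sum_lfunE).
have -> : \sum_l eval N (f (coef x l [::] *: idem Q l)) i j v
    = coef x i [::] *: id_at (pullback th N) i j v.
  rewrite (bigD1 i) //= big1 ?addr0 => [|l li].
    by rewrite (cmZ mf) (cm_idem mf) evalZ eval_idem // eqxx scale1r scale_lfunE.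
  by rewrite (cmZ mf) (cm_idem mf) evalZ eval_idem // eq_sym (negbTE li) scale0r scaler0 zero_lfunE.
rewrite opprD addrACA subrr add0r -sumrB; apply: eq_bigr => c _.
have cth : corner (hd c) (tl c) (th c) by rewrite -fth; apply/(cm_corner mf)/corner_arr.
rewrite linearB /=; congr (_ - _); first exact: comp_lfunE.
rewrite (cmM mf) eval_mul // (bigD1 (tl c)) //=.
rewrite [X in (_ + X)]big1 ?addr0 => [|l lc]; last first.
  by rewrite fth (corner_eval_tl _ _ cth lc) zero_lfunE.
by rewrite fth -pullback_act1.
Qed.

Lemma hom_pullback th M N (f : maps M N) : nilpotent M -> nilpotent N -> is_hom f ->
  @is_hom _ _ _ (pullback th M) (pullback th N) f.
Proof.
move=> nilM nilN hf a; apply/lfunP => v /=.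
by rewrite [LHS]comp_lfunE [RHS]comp_lfunE; apply: hom_eval.
Qed.

End Pullback.

(** * Cyclic derivatives and Jacobian ideals *)

Section CyclicDerivatives.
Variables (K : fieldType) (V : finType) (Q : quiver V).
Local Notation A := (cpa K Q).
Implicit Types (x y z S T : A) (i j l : V) (u v w s : seq (arrow Q)) (a b c : arrow Q).

(** The derivative with respect to a subword [s]: [dcyc a] is the case
    [s = [:: a]] and [dcyc2 b a] the case [s = [:: b; a]]. *)
Definition dcycs s T : A := mkser (fun i w =>
  \sum_(0 <= j < (size w).+1)
     coef T (wend i (take j w)) (drop j w ++ s ++ take j w)).

Lemma dcycE a T : dcyc a T = dcycs [:: a] T.
Proof. by []. Qed.

Lemma dcyc2E b a T : dcyc2 b a T = dcycs [:: b; a] T.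
Proof. by []. Qed.

Lemma coef_dcycs s T i w : walk i w -> coef (dcycs s T) i w =
  \sum_(0 <= j < (size w).+1) coef T (wend i (take j w)) (drop j w ++ s ++ take j w).
Proof. by rewrite coef_mkser => ->. Qed.

Lemma dcycsD s S T : dcycs s (S + T) = dcycs s S + dcycs s T.
Proof.
apply/cpaP => i w; rewrite cpa_coefD; have [wk|nw] := boolP (walk i w).
  by rewrite !coef_dcycs // -big_split; apply: eq_bigr => j _; rewrite cpa_coefD.
by rewrite !coef_out ?addr0.
Qed.

Lemma dcycsZ s k T : dcycs s (k *: T) = k *: dcycs s T.
Proof.
apply/cpaP => i w; rewrite cpa_coefZ; have [wk|nw] := boolP (walk i w).
  by rewrite !coef_dcycs // big_distrr; apply: eq_bigr => j _; rewrite cpa_coefZ.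
by rewrite !coef_out ?mulr0.
Qed.

Lemma dcycs0 s : dcycs s 0 = 0.
Proof. by have := dcycsZ s 0 0; rewrite !scale0r. Qed.

Lemma dcycsB s S T : dcycs s (S - T) = dcycs s S - dcycs s T.
Proof. by rewrite -scaleN1r dcycsD dcycsZ scaleN1r. Qed.

Lemma dcycs_sum s (I : Type) (r : seq I) (P : pred I) (F : I -> A) :
  dcycs s (\sum_(l <- r | P l) F l) = \sum_(l <- r | P l) dcycs s (F l).
Proof.
by elim/big_rec2: _ => [|l y x _ <-]; [exact: dcycs0 | rewrite dcycsD].
Qed.

Lemma depth_dcyc a n T : depth n.+1 T -> depth n (dcyc a T).
Proof.
move=> dT i w lt; have [wk|nw] := boolP (walk i w); last by rewrite coef_out.
rewrite (@coef_dcycs [:: a]) // big1 // => j _; apply: dT.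
by rewrite !size_cat /= addnS addnC -size_cat cat_take_drop ltnS.
Qed.

(** Coefficients are compared at a path [u]. An occurrence of [s] at position [m] of [w] corresponds
    to the cut of [u] at [size u - m], whence the reversal of the summation index. *)
Lemma dcycs_mono s i w : walk i w -> wend i w = i ->
  dcycs s (mono K i w) = \sum_(0 <= m < (size w).+1 | take (size s) (drop m w) == s)
    mono K (wend i (take (m + size s) w)) (drop (m + size s) w) * mono K i (take m w).
Proof.
move=> wk ew.
have wks p : walk (wend i (take p w)) (drop p w) by move: wk; rewrite -{1}[w](cat_take_drop p) walk_cat => /andP[].
have wkt p : walk i (take p w) by move: wk; rewrite -{1}[w](cat_take_drop p) walk_cat => /andP[].
have ends p : wend (wend i (take p w)) (drop p w) = i by rewrite -wend_cat cat_take_drop.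
under eq_bigr => m _ do rewrite monoM ends eqxx scale1r.
apply/cpaP => l u; rewrite cpa_coef_sum.
(* Every nonzero term on either side forces this length. *)
have [esz|nsz] := eqVneq (size w) (size u + size s)%N; last first.
  rewrite big1_seq => [|m /andP[/eqP es]]; last first.
    rewrite mem_index_iota => /andP[_ lt]; rewrite coef_mono; case: eqP => [[_ eu]|_]; last by rewrite andbF.
    case/eqP: nsz; rewrite eu size_cat size_drop size_takel // addnAC.
    have : (m + size s <= size w)%N.
      rewrite -{1}es size_take_min size_drop -leq_subRL; last by rewrite -ltnS.
      exact: geq_minr.
    by move=> le; rewrite -addnA [(size s + m)%N]addnC subnK.
  rewrite coef_mkser; case: ifP => // _; rewrite big1 // => j _.
  rewrite coef_mono; case: eqP => [[_ eu]|_]; last by rewrite andbF.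
  by case/eqP: nsz; rewrite -eu !size_cat addnA addnAC [(size (drop j u) + _)%N]addnC -size_cat cat_take_drop.
(* Positions beyond [size u] leave no room for [s] in [w]. *)
rewrite esz -addSn big_mkcond (@big_cat_nat _ _ _ (size u).+1) ?leq_addr //= [X in _ + X]big1_seq ?addr0; last first.
  move=> m; rewrite mem_index_iota => /andP[_ /andP[lt lt']]; case: eqP => // es.
  suff : (size s < size s)%N by rewrite ltnn.
  rewrite -{1}es size_take_min (leq_ltn_trans (geq_minr _ _)) // size_drop esz.
  by lia.
rewrite big_nat_rev /= add0n coef_mkser; case: ifP => wu; last first.
  rewrite big1_seq // => m; rewrite mem_index_iota => /andP[_ /andP[_ lt]].
  case: ifP => // _; rewrite coef_mono; case: eqP => [[el eu]|_]; last by rewrite andbF.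
  by move: wu; rewrite el [X in walk _ X]eu walk_cat wks ends wkt.
rewrite !big_nat; apply: eq_bigr => j /andP[_ lt]; rewrite ltnS in lt; rewrite subSS.
rewrite !coef_mono wk /= !xpair_eqE.
have szd : size (drop j u) = (size u - j)%N by rewrite size_drop.
have -> : (drop j u ++ s ++ take j u == w) =
    [&& drop j u == take (size u - j) w, s == take (size s) (drop (size u - j) w) &
       take j u == drop (size u - j + size s) w].
  rewrite -{1}[w](cat_take_drop (size u - j)) eqseq_cat; last first.
    by rewrite szd size_takel // esz (leq_trans (leq_subr _ _)) // leq_addr.
  congr andb; rewrite -{1}[drop _ w](cat_take_drop (size s)) eqseq_cat ?drop_drop 1?addnC //.
  by rewrite size_takel // size_drop esz -addnBAC ?leq_subr // leq_addl.
rewrite [s == _]eq_sym; have [es|_] := eqVneq (take (size s) _) s; last by rewrite !andbF.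
rewrite -[X in X == _ ++ _](cat_take_drop j) eqseq_cat; last first.
  by rewrite size_drop size_takel // esz subnDr subKn.
set p := (size u - j + size s)%N.
have [e1|_] := eqVneq (take j u) (drop p w); last by rewrite /= !andbF.
have [e2|_] := eqVneq (drop j u) (take _ w); last by rewrite /= !andbF.
rewrite /= !andbT walk_cat wks ends wkt /= e1; congr ((_ : bool)%:R).
(* Base vertices remain to be matched: a nonempty suffix determines its head, and for an empty one
   both conditions read [l = i]. *)
move: (ends p) (wks p); have : walk l (drop p w).
  by move: wu; rewrite -{1}[u](cat_take_drop j) walk_cat e1 => /andP[].
case: (drop p w) => [_ /= -> _|d q /= /andP[/eqP <- _] -> /andP[/eqP -> _]]; last by rewrite !eqxx.
by [].
Qed.

(** [dword a i w y] is the sum of the [q y p] over the factorisations [w = p a q]. *)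
Fixpoint dword a i w y : A :=
  if w is c :: u then
    (c == a)%:R *: (mono K (tl c) u * y * idem Q i) + dword a (tl c) u (y * arr_el c)
  else 0.

Lemma dwordD a i w y z : dword a i w (y + z) = dword a i w y + dword a i w z.
Proof.
elim: w i y z => [|c w IHw] i y z /=; first by rewrite addr0.
by rewrite mulrDr !mulrDl IHw scalerDr addrACA.
Qed.

Lemma dwordZ a i w k y : dword a i w (k *: y) = k *: dword a i w y.
Proof.
elim: w i y => [|c w IHw] i y /=; first by rewrite scaler0.
by rewrite -cpa_scalerAr -!cpa_scalerAl IHw scalerDr !scalerA mulrC.
Qed.

Lemma depth_dword a i w y n : depth n y -> depth n (dword a i w y).
Proof.
elim: w i y => [|c w IHw] i y dy /=; first exact: depth0.
by apply: depthD; [apply/depthZ/depthMr/depthMl | apply/IHw/depthMr].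
Qed.

Lemma depth_dword_size a i w y n : depth n y -> depth ((size w).-1 + n) (dword a i w y).
Proof.
elim: w i y n => [|c w IHw] i y n dy /=; first exact: depth0.
apply: depthD; first by apply/depthZ/depthMr/depthM => //; apply: depth_mono.
case: w IHw => [|d w] IHw /=; first exact: depth0.
rewrite addSnnS; apply: (IHw _ _ n.+1); rewrite -addn1; apply: depthM => //.
exact: depth_mono.
Qed.

Lemma dword_corner a i w y : walk i w ->
  dword a i w y = dword a i w (idem Q (wend i w) * y * idem Q i).
Proof.
elim: w i y => [|c w IHw] i y //= /andP[/eqP hc wk].
rewrite IHw // [in RHS]IHw //; congr (_ *: _ + dword _ _ _ _).
  by rewrite !mulrA monoM eqxx scale1r cats0 -(mulrA (_ * y)) idemM eqxx scale1r.
by rewrite -hc -(mulrA (_ * y)) idem_arr eqxx scale1r !mulrA idemM eqxx scale1r.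
Qed.

Lemma dword_open a i w y : walk i w -> idem Q (wend i w) * y * idem Q i = 0 ->
  dword a i w y = 0.
Proof.
move=> wk y0; rewrite dword_corner // y0.
by have := dwordZ a i w 0 0; rewrite !scale0r.
Qed.

(** Leibniz rule in cyclic order: the factor that is not differentiated is absorbed into [y], [v] on
    the left and [u] on the right. *)
Lemma dword_cat a i u v y : walk i (u ++ v) -> dword a i (u ++ v) y =
  dword a i u (mono K (wend i u) v * y) + dword a (wend i u) v (y * mono K i u).
Proof.
elim: u i y => [|c u IHu] i y /=.
  move=> wk; rewrite add0r dword_corner // [in RHS]dword_corner //.
  by rewrite -!mulrA idemM eqxx scale1r.
move=> /andP[/eqP hc wk]; rewrite IHu // addrA; congr (_ + _).
  by rewrite !mulrA monoM eqxx scale1r.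
by rewrite mono_cons // mulrA.
Qed.

Lemma dwordE a i w y : walk i w -> dword a i w y =
  \sum_(0 <= m < (size w).+1 | take 1 (drop m w) == [:: a])
    mono K (wend i (take (m + 1) w)) (drop (m + 1) w) * y * mono K i (take m w).
Proof.
elim: w i y => [|c w IHw] i y; first by rewrite /= big_mkcond big_nat1.
move=> /= /andP[/eqP hc wk]; rewrite IHw // big_mkcond [RHS]big_mkcond.
rewrite [RHS]big_nat_recl //= !take0 drop0 eqseq_cons andbT; congr (_ + _).
  by case: eqP => _; rewrite ?scale1r ?scale0r.
apply: eq_bigr => m _; rewrite addn1; case: ifP => // _.
by rewrite mono_cons // !mulrA.
Qed.

Lemma dcyc_mono a i w : walk i w -> wend i w = i -> dcyc a (mono K i w) = dword a i w 1.
Proof.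
move=> wk ew; rewrite dwordE // -[LHS]/(dcycs [:: a] _) dcycs_mono //.
by apply: eq_bigr => m _; rewrite mulr1.
Qed.

Section Truncation.
Variable N : nat.

(** Modulo the [N]-th power of the arrow ideal, the sum of the [x_(paq) (q y p)]
    over all paths [p a q]. *)
Definition ddel a x y : A :=
  \sum_(m < N.+1) \sum_(w : m.-tuple (arrow Q)) \sum_i coef x i w *: dword a i w y.

Lemma ddelDl a x1 x2 y : ddel a (x1 + x2) y = ddel a x1 y + ddel a x2 y.
Proof.
rewrite /ddel -big_split; apply: eq_bigr => m _ /=; rewrite -big_split.
apply: eq_bigr => w _ /=; rewrite -big_split; apply: eq_bigr => i _ /=.
by rewrite cpa_coefD scalerDl.
Qed.

Lemma ddelZl a k x y : ddel a (k *: x) y = k *: ddel a x y.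
Proof.
rewrite /ddel scaler_sumr; apply: eq_bigr => m _ /=; rewrite scaler_sumr.
apply: eq_bigr => w _ /=; rewrite scaler_sumr; apply: eq_bigr => i _ /=.
by rewrite cpa_coefZ scalerA.
Qed.

Lemma ddelDr a x y1 y2 : ddel a x (y1 + y2) = ddel a x y1 + ddel a x y2.
Proof.
rewrite /ddel -big_split; apply: eq_bigr => m _ /=; rewrite -big_split.
apply: eq_bigr => w _ /=; rewrite -big_split; apply: eq_bigr => i _ /=.
by rewrite dwordD scalerDr.
Qed.

Lemma ddelZr a k x y : ddel a x (k *: y) = k *: ddel a x y.
Proof.
rewrite /ddel scaler_sumr; apply: eq_bigr => m _ /=; rewrite scaler_sumr.
apply: eq_bigr => w _ /=; rewrite scaler_sumr; apply: eq_bigr => i _ /=.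
by rewrite dwordZ scalerA mulrC -scalerA.
Qed.

Lemma ddel0 a x : ddel a x 0 = 0.
Proof. by have := ddelZr a 0 x 0; rewrite !scale0r. Qed.

Lemma ddelBr a x y1 y2 : ddel a x (y1 - y2) = ddel a x y1 - ddel a x y2.
Proof. by rewrite -scaleN1r ddelDr ddelZr scaleN1r. Qed.

Lemma depth_ddel a x y n : depth n y -> depth n (ddel a x y).
Proof.
move=> dy; do 3!(apply: depth_sum => ? _); exact/depthZ/depth_dword.
Qed.

Lemma ddel_depth a x y : depth N.+1 x -> ddel a x y = 0.
Proof.
move=> dx; rewrite /ddel big1 // => m _; rewrite big1 // => w _; rewrite big1 // => i _.
by rewrite dx ?scale0r // size_tuple.
Qed.

Definition eqmod x y := depth N (x - y).

Lemma eqmod_refl x : eqmod x x.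
Proof. by rewrite /eqmod subrr; apply: depth0. Qed.

Lemma eqmod_sym x y : eqmod x y -> eqmod y x.
Proof. by rewrite /eqmod -[y - x]opprB => /depthN. Qed.

Lemma eqmod_trans y x z : eqmod x y -> eqmod y z -> eqmod x z.
Proof. by move=> xy yz; rewrite /eqmod -(subrK y x) -addrA; apply: depthD. Qed.

Lemma eqmodD x1 x2 y1 y2 : eqmod x1 y1 -> eqmod x2 y2 -> eqmod (x1 + x2) (y1 + y2).
Proof. by move=> e1 e2; rewrite /eqmod opprD addrACA; apply: depthD. Qed.

Lemma eqmodZ k x y : eqmod x y -> eqmod (k *: x) (k *: y).
Proof. by move=> e; rewrite /eqmod -scalerBr; apply: depthZ. Qed.

Lemma eqmod_sum (I : Type) (r : seq I) (P : pred I) (F G : I -> A) :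
  (forall t, P t -> eqmod (F t) (G t)) -> eqmod (\sum_(t <- r | P t) F t) (\sum_(t <- r | P t) G t).
Proof. by move=> FG; rewrite /eqmod -sumrB; apply: depth_sum. Qed.

Lemma depth_eqmod n x : (N <= n)%N -> depth n x -> eqmod x 0.
Proof. by move=> Nn dx; rewrite /eqmod subr0; apply: depthW dx. Qed.

(** Differentiation removes one letter, so a path longer than [N] contributes in depth at least [N]
    only; hence the cut of [ddel] at words of length [N]. *)
Lemma ddel_mono a i w y : walk i w -> eqmod (ddel a (mono K i w) y) (dword a i w y).
Proof.
move=> wk; have [lt|gt] := leqP (size w) N; last first.
  rewrite ddel_depth; last exact: depth_mono.
  apply/eqmod_sym/(@depth_eqmod ((size w).-1 + 0)); last by apply: depth_dword_size => ? ?.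
  by rewrite addn0; case: (size w) gt.
rewrite /ddel (bigD1 (inord (size w))) //= [X in _ + X]big1 ?addr0; last first.
  move=> m mw; rewrite big1 // => u _; rewrite big1 // => j _; rewrite coef_mono xpair_eqE.
  case: (_ =P w) => [ew|_]; last by rewrite !andbF scale0r.
  case/eqP: mw; apply/val_inj; by rewrite /= inordK // -ew size_tuple.
have sz : size w == (inord (size w) : 'I_N.+1) :> nat by rewrite inordK.
rewrite (bigD1 (Tuple sz)) //= [X in _ + X]big1 ?addr0; last first.
  move=> u uw; rewrite big1 // => j _; rewrite coef_mono xpair_eqE.
  case: (_ =P w) => [ew|_]; last by rewrite !andbF scale0r.
  by case/eqP: uw; apply/val_inj.
rewrite (bigD1 i) //= big1 ?addr0 => [|j ji]; last first.
  by rewrite coef_mono xpair_eqE (negbTE ji) andbF scale0r.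
by rewrite coef_mono wk eqxx scale1r; apply: eqmod_refl.
Qed.

(** By bilinearity this reduces to [dword_cat] for paths; if two paths do not compose, all three
    terms vanish modulo depth [N]. *)
Lemma ddel_mul a x z y : eqmod (ddel a (x * z) y) (ddel a x (z * y) + ddel a z (y * x)).
Proof.
move: x; apply: (@cpa_ind _ _ _ N.+1).
- move=> x1 x2 e1 e2; rewrite mulrDl !ddelDl mulrDr ddelDr addrACA; exact: eqmodD.
- by move=> k x e; rewrite -cpa_scalerAl -cpa_scalerAr !ddelZl ddelZr -scalerDr; apply: eqmodZ.
- move=> i u wu; move: z; apply: (@cpa_ind _ _ _ N.+1).
  + move=> z1 z2 e1 e2; rewrite mulrDr !ddelDl mulrDl ddelDr addrACA; exact: eqmodD.
  + by move=> k z e; rewrite -cpa_scalerAr -cpa_scalerAl !ddelZl ddelZr -scalerDr; apply: eqmodZ.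
  + move=> j v wv; apply: eqmod_trans (eqmod_sym (eqmodD (ddel_mono _ _ wu) (ddel_mono _ _ wv))).
    rewrite monoM; have [e|ne] := eqVneq (wend i u) j.
      have wuv : walk i (u ++ v) by rewrite walk_cat wu e.
      by rewrite scale1r; apply: eqmod_trans (ddel_mono _ _ wuv) _; rewrite dword_cat // e; apply: eqmod_refl.
    rewrite scale0r ddel_depth; last exact: depth0.
    rewrite !dword_open ?addr0 //; first exact: eqmod_refl.
      by rewrite -!mulrA monoM (negbTE ne) scale0r !mulr0.
    by rewrite !mulrA monoM /= (negbTE ne) scale0r !mul0r.
  move=> z dz; rewrite !(ddel_depth _ _ dz) addr0 ddel_depth; last exact: depthMl.
  by apply/eqmod_sym/(@depth_eqmod N.+1) => //; apply/depth_ddel/depthMr.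
move=> x dx; rewrite !(ddel_depth _ _ dx) add0r ddel_depth; last exact: depthMr.
by apply/eqmod_sym/(@depth_eqmod N.+1) => //; apply/depth_ddel/depthMl.
Qed.

Lemma ddel_idem a i y : ddel a (idem Q i) y = 0.
Proof.
rewrite /ddel big1 // => m _; rewrite big1 // => w _; rewrite big1 // => j _.
by rewrite coef_idem; case: w => -[|c w] /= _; rewrite ?andbF ?scale0r ?scaler0.
Qed.

Lemma dcyc_ddel a S : is_potential S -> eqmod (dcyc a S) (ddel a S 1).
Proof.
(* The induction passes through paths that are not cycles, on which [ddel] with [y = 1] vanishes but
   [dcyc] may not. The projection [cl] onto closed paths is linear, fixes [S], and makes the claim
   true for them as well. *)
move=> potS; pose cl x : A := mkser (fun i w => if wend i w == i then coef x i w else 0).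
have coef_cl x i w : coef (cl x) i w = if wend i w == i then coef x i w else 0.
  by rewrite coef_mkser; case: ifP => // /negbT nw; rewrite coef_out ?if_same.
have <- : cl S = S.
  apply/cpaP => i w; rewrite coef_cl; case: ifP => // /negbT ne.
  by apply/eqP; rewrite eq_sym; apply: contraNT ne => /potS /and3P[].
have -> : ddel a (cl S) 1 = ddel a S 1.
  congr ddel; apply/cpaP => i w; rewrite coef_cl; case: ifP => // /negbT ne.
  by apply/eqP; rewrite eq_sym; apply: contraNT ne => /potS /and3P[].
move: S {potS}; apply: (@cpa_ind _ _ _ N.+1).
- move=> x y ex ey; have -> : cl (x + y) = cl x + cl y.
    apply/cpaP => i w; rewrite cpa_coefD !coef_cl cpa_coefD.
    by case: ifP => // _; rewrite addr0.
  by rewrite !dcycE dcycsD ddelDl; apply: eqmodD.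
- move=> k x ex; have -> : cl (k *: x) = k *: cl x.
    by apply/cpaP => i w; rewrite cpa_coefZ !coef_cl cpa_coefZ; case: ifP => // _; rewrite mulr0.
  by rewrite !dcycE dcycsZ ddelZl; apply: eqmodZ.
- move=> i w wk; apply: eqmod_trans (eqmod_sym (ddel_mono _ _ wk)).
  have [e|ne] := eqVneq (wend i w) i.
    have -> : cl (mono K i w) = mono K i w.
      apply/cpaP => j u; rewrite coef_cl coef_mono xpair_eqE.
      case: (j =P i) => [->|_]; last by rewrite andbF if_same.
      by case: (u =P w) => [->|_]; rewrite ?e ?eqxx ?andbF ?if_same.
    by rewrite dcyc_mono //; apply: eqmod_refl.
  have -> : cl (mono K i w) = 0.
    apply/cpaP => j u; rewrite coef_cl coef_mono xpair_eqE cpa_coef0.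
    case: (j =P i) => [->|_]; last by rewrite andbF if_same.
    by case: (u =P w) => [->|_]; rewrite ?(negbTE ne) ?andbF ?if_same.
  rewrite dword_open //; last by rewrite mulr1 idemM (negbTE ne) scale0r.
  by rewrite dcycE dcycs0; apply: eqmod_refl.
move=> x dx; rewrite ddel_depth //; apply: (@depth_eqmod N) => //; apply: depth_dcyc.
by move=> i w lt; rewrite coef_cl dx // if_same.
Qed.

End Truncation.

(** For [y = 1] a rotation swaps the two summands of [dword_cat]. *)
Lemma rotation_dcyc a x : rotation x -> dcyc a x = 0.
Proof.
case=> c w /and3P[_ wk /eqP ew]; move: (wk) (ew) => /= /andP[_ wk'] ew'.
have wkr : walk (tl c) (rcons w c) by rewrite -cats1 walk_cat wk' /= ew' eqxx.
rewrite dcycE dcycsB -!dcycE dcyc_mono // dcyc_mono //; last by rewrite -cats1 wend_cat.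
rewrite -cat1s in wk *; rewrite -cats1 in wkr *.
rewrite dword_cat // dword_cat //.
rewrite [wend _ [:: c]]/= ew' !mulr1 !mul1r; apply/eqP.
by rewrite subr_eq0 addrC eqxx.
Qed.

Lemma cyc_equiv_dcyc a S T : cyc_equiv S T -> dcyc a S = dcyc a T.
Proof.
move=> /madic_closureP cST; apply/eqP; rewrite -subr_eq0 !dcycE -dcycsB; apply/eqP.
apply: depth_eq0 => n; have [y sy dy] := cST n.+1.
rewrite -(subrK y (S - T)) dcycsD; apply: depthD; first exact: depth_dcyc.
suff -> : dcycs [:: a] y = 0 by apply: depth0.
elim: sy => {y dy} [y ry||x y _ ex _ ey|k x _ ex].
- exact: rotation_dcyc.
- exact: dcycs0.
- by rewrite dcycsD ex ey addr0.
- by rewrite dcycsZ ex scaler0.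
Qed.

End CyclicDerivatives.

(** * Closed ideals *)

Record cideal (K : fieldType) (V : finType) (Q : quiver V) (I : cpa K Q -> Prop) : Prop :=
  CIdeal {
    ci0 : I 0;
    ciD : forall x y, I x -> I y -> I (x + y);
    ciMl : forall x y, I y -> I (x * y);
    ciMr : forall x y, I x -> I (x * y);
    ci_closed : forall x, madic_closure I x -> I x }.

Section ClosedIdeals.
Variables (K : fieldType) (V : finType) (Q : quiver V).
Local Notation A := (cpa K Q).
Implicit Types (I : A -> Prop) (x y S : A).

Lemma ciZ I k x : cideal I -> I x -> I (k *: x).
Proof. by move=> cI Ix; rewrite -[x]mul1r cpa_scalerAl; apply: ciMl. Qed.

Lemma ciN I x : cideal I -> I x -> I (- x).
Proof. by move=> cI Ix; rewrite -scaleN1r; apply: ciZ. Qed.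

Lemma ci_sum I (T : Type) (r : seq T) (P : pred T) (F : T -> A) : cideal I ->
  (forall t, P t -> I (F t)) -> I (\sum_(t <- r | P t) F t).
Proof.
by move=> cI IF; elim/big_rec: _ => [|t x /IF It Ix]; [exact: ci0 | exact: ciD].
Qed.

Lemma ci_dword I a i w y : cideal I -> I y -> I (dword a i w y).
Proof.
move=> cI; elim: w i y => [|c w IHw] i y Iy /=; first exact: ci0.
apply: ciD => //; last by apply: IHw; apply: ciMr.
by apply: ciZ => //; apply: ciMr => //; apply: ciMl.
Qed.

Lemma ci_ddel I N a x y : cideal I -> I y -> I (ddel N a x y).
Proof. by move=> cI Iy; do 3!(apply: ci_sum => // ? _); apply: ciZ => //; apply: ci_dword. Qed.

Lemma ideal_sub I (G : A -> Prop) x : cideal I -> (forall y, G y -> I y) -> ideal G x -> I x.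
Proof.
move=> cI GI; elim=> {x} [x /GI //||x y _ Ix _ Iy|x y _ Iy|x y _ Ix].
- exact: ci0.
- exact: ciD.
- exact: ciMl.
- exact: ciMr.
Qed.

(** Inclusions of Jacobian ideals are obtained by testing generators against a closed ideal,
    typically the preimage of another Jacobian ideal. *)
Lemma jacobian_sub I S x : cideal I -> (forall a, I (dcyc a S)) -> jacobian S x -> I x.
Proof.
move=> cI dI Jx; apply: ci_closed => // n; have [y Jy e] := Jx n.
by exists y => //; apply: ideal_sub Jy => // z [a ->].
Qed.

Lemma jacobian_cideal S : cideal (jacobian S).
Proof.
split.
- by apply/madic_closureP => n; exists 0; [apply: ideal_zero | rewrite subrr; apply: depth0].
- move=> x y /madic_closureP Jx /madic_closureP Jy; apply/madic_closureP => n.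
  have [[x' Ix dx] [y' Iy dy]] := (Jx n, Jy n).
  by exists (x' + y'); [apply: ideal_add | rewrite opprD addrACA; apply: depthD].
- move=> x y /madic_closureP Jy; apply/madic_closureP => n; have [y' Iy dy] := Jy n.
  by exists (x * y'); [apply: ideal_mull | rewrite -mulrBr; apply: depthMl].
- move=> x y /madic_closureP Jx; apply/madic_closureP => n; have [x' Ix dx] := Jx n.
  by exists (x' * y); [apply: ideal_mulr | rewrite -mulrBl; apply: depthMr].
move=> x /madic_closureP Jx; apply/madic_closureP => n.
have [y /madic_closureP/(_ n)[z Iz dz] dy] := Jx n.
by exists z => //; rewrite -(subrK y x) -addrA; apply: depthD.
Qed.

Lemma dcyc_jacobian S a : jacobian S (dcyc a S).
Proof.
apply/madic_closureP => n; exists (dcyc a S); last by rewrite subrr; apply: depth0.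
by apply: ideal_gen; exists a.
Qed.

End ClosedIdeals.

(** * Chain rule for cyclic derivatives *)

Section ChainRule.
Variables (K : fieldType) (V : finType) (Q Q' : quiver V) (f : cpa K Q -> cpa K Q').
Hypotheses (mf : cpa_morph f) (f1 : forall c, depth 1 (f (arr_el c))).

Lemma preim_cideal (I : cpa K Q' -> Prop) : cideal I -> cideal (fun x => I (f x)).
Proof.
move=> cI; split.
- by rewrite (cm0 mf); apply: ci0.
- by move=> x y Ix Iy; rewrite (cmD mf); apply: ciD.
- by move=> x y Iy; rewrite (cmM mf); apply: ciMl.
- by move=> x y Ix; rewrite (cmM mf); apply: ciMr.
move=> x /madic_closureP Ix; apply: ci_closed => //; apply/madic_closureP => n.
have [y Iy dy] := Ix n; exists (f y) => //.
by rewrite -(cmB mf); apply: cm_depth.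
Qed.

(** A potential is the sum of its diagonal corners, which [f] respects, and it has no constant term,
    which continuity preserves. *)
Lemma morph_potential (S : cpa K Q) : is_potential S -> is_potential (f S).
Proof.
move=> potS i w; have dS : depth 1 S.
  move=> j u; rewrite ltnS leqn0 size_eq0 => /eqP ->.
  by apply/eqP; apply: contraT => /potS.
have eS : f S = \sum_j idem Q' j * f S * idem Q' j.
  have {1}-> : S = \sum_j idem Q j * S * idem Q j.
    apply/cpaP => j u; rewrite cpa_coef_sum (bigD1 j) //= big1 ?addr0 => [|l lj].
      rewrite coef_mul_idem coef_idem_mul eqxx mul1r; case: eqP => [_|/eqP ne]; first by rewrite mulr1.
      by rewrite mulr0; apply/eqP; apply: contraNT ne => /potS /and3P[].
    by rewrite coef_mul_idem coef_idem_mul eq_sym (negbTE lj) !mul0r.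
  rewrite (cm_sum mf); apply: eq_bigr => j _; by rewrite !(cmM mf) !(cm_idem mf).
move=> ne; apply/and3P; split.
- apply: contraNN ne => /eqP ->; by rewrite (cm_depth mf f1 dS).
- by apply: contraNT ne => nw; rewrite coef_out.
apply: contraNT ne => ne; rewrite eS cpa_coef_sum big1 // => j _.
rewrite coef_mul_idem coef_idem_mul; case: (i =P j) => [<-|_]; last by rewrite !mul0r.
by rewrite (negbTE ne) mulr0.
Qed.

(** Linearity reduces to paths, where the Leibniz rule splits off one arrow at a time. The argument
    [y] serves the induction: the arrow split off moves into it. *)
Lemma chain_rule N a (S y : cpa K Q) :
  eqmod N (ddel N a (f S) (f y)) (\sum_b ddel N a (f (arr_el b)) (f (ddel N b S y))).
Proof.
move: S y; apply: (@cpa_ind _ _ _ N.+1).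
- move=> x1 x2 e1 e2 y; rewrite (cmD mf) ddelDl.
  under eq_bigr => b _ do rewrite ddelDl (cmD mf) ddelDr.
  by rewrite big_split; apply: eqmodD.
- move=> k x e y; rewrite (cmZ mf) ddelZl.
  under eq_bigr => b _ do rewrite ddelZl (cmZ mf) ddelZr.
  by rewrite -scaler_sumr; apply: eqmodZ.
- move=> i w wk y.
  apply: (@eqmod_trans _ _ _ _ (\sum_b ddel N a (f (arr_el b)) (f (dword b i w y)))); last first.
    apply: eqmod_sum => b _; rewrite /eqmod -ddelBr -(cmB mf).
    by apply/depth_ddel/(cm_depth mf) => //; apply/eqmod_sym/ddel_mono.
  elim: w i y wk => [|c w IHw] i y /=.
    move=> _; rewrite (cm_idem mf) ddel_idem big1; first exact: eqmod_refl.
    by move=> b _; rewrite (cm0 mf) ddel0.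
  move=> /andP[/eqP hc wk]; rewrite mono_cons // (cmM mf).
  apply: eqmod_trans (ddel_mul _ _ _ _) _.
  under eq_bigr => b _ do rewrite (cmD mf) ddelDr.
  rewrite big_split /=; apply: eqmodD; last by rewrite -(cmM mf); apply: IHw.
  rewrite (bigD1 c) //= eqxx scale1r big1 ?addr0 => [|b bc]; last first.
    by rewrite eq_sym (negbTE bc) scale0r (cm0 mf) ddel0.
  rewrite -(cmM mf) [f (_ * idem _ _)](cmM mf) (cm_idem mf) -hc.
  have {1}<- : idem Q' (hd c) * f (arr_el c) = f (arr_el c).
    by rewrite -(cm_idem mf) -(cmM mf) idem_arr eqxx scale1r.
  apply: eqmod_trans (ddel_mul _ _ _ _) _; rewrite ddel_idem add0r; exact: eqmod_refl.
move=> x dx y; rewrite ddel_depth; last exact: cm_depth.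
rewrite big1; first exact: eqmod_refl.
by move=> b _; rewrite (ddel_depth _ _ dx) (cm0 mf) ddel0.
Qed.

(** Each term of the chain rule has [f (dcyc b S)] as inner factor and so lies in [I]; congruences
    modulo all depths suffice because [I] is closed. *)
Lemma dcyc_morph (I : cpa K Q' -> Prop) (S : cpa K Q) a : cideal I -> is_potential S ->
  (forall b, I (f (dcyc b S))) -> I (dcyc a (f S)).
Proof.
move=> cI potS IS; apply: ci_closed => //; apply/madic_closureP => N.
exists (\sum_b ddel N a (f (arr_el b)) (f (dcyc b S))).
  by apply: ci_sum => // b _; apply: ci_ddel.
have potf := morph_potential potS.
apply: (eqmod_trans (dcyc_ddel a potf)).
have f1E : f 1 = 1.
  by rewrite -sum_idem (cm_sum mf) -sum_idem; apply: eq_bigr => i _; rewrite (cm_idem mf).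
rewrite -f1E; apply: eqmod_trans (chain_rule _ _ _) _.
apply: eqmod_sum => b _; rewrite /eqmod -ddelBr -(cmB mf).
by apply/depth_ddel/(cm_depth mf) => //; apply/eqmod_sym/dcyc_ddel.
Qed.

End ChainRule.

(** * Splitting *)

Section Subquiver.
Variables (K : fieldType) (V : finType) (P P' : quiver V).
Variables (g : arrow P' -> option (arrow P)) (h : arrow P -> arrow P').
Hypotheses (gh : forall c d, g c = Some d <-> c = h d).
Hypotheses (hdh : forall d, hd (h d) = hd d) (tlh : forall d, tl (h d) = tl d).
Implicit Types (S : cpa K P) (i : V).

Lemma walk_map i (u : seq (arrow P)) : walk i (map h u) = walk i u.
Proof. by elim: u i => //= d u IHu i; rewrite hdh tlh IHu. Qed.

Lemma wend_map i (u : seq (arrow P)) : wend i (map h u) = wend i u.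
Proof. by elim: u i => //= d u IHu i; rewrite tlh IHu. Qed.

Lemma gK d : g (h d) = Some d.
Proof. exact/gh. Qed.

Lemma h_inj : injective h.
Proof. by move=> d e E; apply/Some_inj; rewrite -!gK E. Qed.

Lemma pmap_mapK (u : seq (arrow P)) : pmap g (map h u) = u.
Proof. by elim: u => //= d u IHu; rewrite gK /= IHu. Qed.

Lemma coef_extend (x : cpa K P) i u : coef (extend g x) i (map h u) = coef x i u.
Proof.
rewrite coef_mkser walk_map /= pmap_mapK size_map eqxx; case: ifP => // /negbT nw.
by rewrite coef_out.
Qed.

Lemma mapP' (w : seq (arrow P')) : (exists u, w = map h u) \/ (exists2 c, c \in w & g c = None).
Proof.
elim: w => [|c w [[u ->]|[d dw gd]]]; first by left; exists [::].
  case E: (g c) => [d|]; last by right; exists c; rewrite ?mem_head.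
  by left; exists (d :: u); rewrite /= -(iffLR (gh _ _) E).
by right; exists d; rewrite // inE dw orbT.
Qed.

Lemma coef_extend0 (x : cpa K P) i w c : c \in w -> g c = None -> coef (extend g x) i w = 0.
Proof.
move=> cw gc; rewrite coef_mkser; case: ifP => // _ /=; case: eqP => // e; exfalso.
elim: w cw e => //= d w IHw; rewrite inE => /orP[/eqP <-|cw].
  rewrite gc /= => e; have := size_pmap g w.
  by have := count_size g w; lia.
have := size_pmap g w; have := count_size g w.
by case: (g d) => [e|] /= ? ? E; [case: E => /(IHw cw) | lia].
Qed.

Lemma extend_morph : cpa_morph (extend g : cpa K P -> cpa K P').
Proof.
have E (x : cpa K P') (y : cpa K P') :
    (forall i u, coef x i (map h u) = coef y i (map h u)) ->
    (forall i w c, c \in w -> g c = None -> coef x i w = coef y i w) -> x = y.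
  by move=> E1 E2; apply/cpaP => i w; have [[u ->]|[c cw gc]] := mapP' w; [|apply: E2 gc].
split=> [x y|k x|x y|i]; apply: E.
- by move=> i u; rewrite cpa_coefD !coef_extend cpa_coefD.
- by move=> i w c cw gc; rewrite cpa_coefD !(coef_extend0 _ _ cw gc) addr0.
- by move=> i u; rewrite cpa_coefZ !coef_extend cpa_coefZ.
- by move=> i w c cw gc; rewrite cpa_coefZ !(coef_extend0 _ _ cw gc) mulr0.
- move=> i u; rewrite coef_extend !cpa_coefM size_map; apply: eq_bigr => j _.
  by rewrite -map_take -map_drop wend_map !coef_extend.
- move=> i w c cw gc; rewrite (coef_extend0 _ _ cw gc) cpa_coefM big1 // => j _.
  move: cw; rewrite -{1}[w](cat_take_drop j) mem_cat => /orP[] cw.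
    by rewrite (coef_extend0 _ _ cw gc) mul0r.
  by rewrite (coef_extend0 _ _ cw gc) mulr0.
- by move=> j u; rewrite coef_extend !coef_idem; case: u.
- by move=> j w c cw gc; rewrite (coef_extend0 _ _ cw gc) coef_idem; case: w cw => // ? ? _; rewrite andbF.
Qed.

Lemma extend_arr d : extend g (arr_el d : cpa K P) = arr_el (h d).
Proof.
apply/cpaP => i w; have [[u ->]|[c cw gc]] := mapP' w.
  by rewrite coef_extend !coef_arr hdh -(inj_eq (inj_map h_inj)).
rewrite (coef_extend0 _ _ cw gc) coef_arr; case: (w =P [:: h d]) => [e|_]; last by rewrite andbF.
by move: cw gc; rewrite e inE => /eqP ->; rewrite gK.
Qed.

Lemma dcyc_extend d S : dcyc (h d) (extend g S) = extend g (dcyc d S).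
Proof.
apply/cpaP => i w; have [[u ->]|[c cw gc]] := mapP' w.
  rewrite coef_extend; have [wu|nw] := boolP (walk i u); last by rewrite !coef_out // walk_map.
  rewrite !dcycE !coef_dcycs ?walk_map // size_map; apply: eq_bigr => j _.
  by rewrite -map_take -map_drop -[[:: h d]]/(map h [:: d]) -!map_cat wend_map coef_extend.
rewrite (coef_extend0 _ _ cw gc) coef_mkser; case: ifP => // _; rewrite big1 // => j _.
apply: (coef_extend0 _ _ _ gc); move: cw.
by rewrite -{1}[w](cat_take_drop j) mem_cat mem_cat inE => /orP[] ->; rewrite ?orbT.
Qed.

Lemma dcyc_extend0 c S : g c = None -> dcyc c (extend g S) = 0.
Proof.
move=> gc; apply/cpaP => i w; rewrite cpa_coef0 coef_mkser; case: ifP => // _.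
rewrite big1 // => j _; apply: (coef_extend0 _ _ _ gc).
by rewrite mem_cat inE eqxx orbT.
Qed.

Lemma extend_potential S : is_potential S -> is_potential (extend g S).
Proof.
move=> potS i w; have [[u ->]|[c cw gc]] := mapP' w.
  by rewrite coef_extend /is_cycle walk_map wend_map => /potS /and3P[nu -> ->]; case: u nu.
by rewrite (coef_extend0 _ _ cw gc) eqxx.
Qed.

(** The projection that sends the arrows outside the subquiver to 0. *)
Definition restr (x : cpa K P') : cpa K P := mkser (fun i u => coef x i (map h u)).

Lemma coef_restr (x : cpa K P') i u : coef (restr x) i u = coef x i (map h u).
Proof.
rewrite coef_mkser; case: ifP => // /negbT nw; by rewrite coef_out ?walk_map.
Qed.

Lemma restr_morph : cpa_morph restr.
Proof.
split=> [x y|k x|x y|i]; apply/cpaP => j u.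
- by rewrite cpa_coefD !coef_restr cpa_coefD.
- by rewrite cpa_coefZ !coef_restr cpa_coefZ.
- rewrite coef_restr !cpa_coefM size_map; apply: eq_bigr => l _.
  by rewrite -map_take -map_drop wend_map !coef_restr.
by rewrite coef_restr !coef_idem; case: u.
Qed.

Lemma extendK : cancel (extend g : cpa K P -> cpa K P') restr.
Proof. by move=> x; apply/cpaP => i u; rewrite coef_restr coef_extend. Qed.

Lemma restr_arr0 c : g c = None -> restr (arr_el c) = 0.
Proof.
move=> gc; apply/cpaP => i u; rewrite coef_restr coef_arr cpa_coef0.
case: u => [|d [|? ?]]; rewrite ?andbF //= ?eqseq_cons ?andbF // andbT.
by case: (h d =P c) => [e|]; rewrite ?andbF //; move: gc; rewrite -e gK.
Qed.

(** A path through an arrow outside the subquiver lies in [I], and every other path is fixed by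
    restriction followed by extension; closedness passes from paths to series. *)
Lemma restr_mod (I : cpa K P' -> Prop) x : cideal I ->
  (forall c, g c = None -> I (arr_el c)) -> I (x - extend g (restr x)).
Proof.
move=> cI Iarr; have me := cpa_morph_comp extend_morph restr_morph.
apply: ci_closed => //; apply/madic_closureP => n; move: x.
apply: (@cpa_ind _ _ _ n).
- move=> x y [x' Ix dx] [y' Iy dy]; exists (x' + y'); first exact: ciD.
  rewrite (cmD restr_morph) (cmD extend_morph).
  by have := depthD dx dy; rewrite addrACA -opprD addrACA -opprD.
- move=> k x [x' Ix dx]; exists (k *: x'); first exact: ciZ.
  by rewrite (cmZ restr_morph) (cmZ extend_morph) -!scalerBr; apply: depthZ.
- move=> i w wk; exists (mono K i w - extend g (restr (mono K i w))).
    elim: w i wk => [|c w IHw] i /=.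
      by move=> _; rewrite (cm_idem restr_morph) (cm_idem extend_morph) subrr; apply: ci0.
    move=> /andP[/eqP hc wk]; rewrite mono_cons // (cmM restr_morph) (cmM extend_morph).
    case E: (g c) => [d|]; last first.
      rewrite restr_arr0 // (cm0 extend_morph) mul0r subr0; apply: ciMr => //; exact: Iarr.
    rewrite (iffLR (gh _ _) E) -{2}extend_arr extendK extend_arr -mulrBr.
    by apply: ciMl => //; apply: IHw; rewrite tlh; move: wk; rewrite (iffLR (gh _ _) E) tlh.
  by rewrite subrr; apply: depth0.
move=> x dx; exists 0; first exact: ci0.
rewrite subr0; apply: depthB => // i w lt; have [[u eu]|[c cw gc]] := mapP' w.
  by rewrite eu coef_extend coef_restr dx // -eu.
by rewrite (coef_extend0 _ _ cw gc).
Qed.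

End Subquiver.

(** The image lies in the corner of [c], which contains a trivial path only when [tl c = hd c]. *)
Lemma morph_depth1 (K : fieldType) (V : finType) (Q Q' : quiver V)
    (f : cpa K Q -> cpa K Q') (c : arrow Q) :
  cpa_morph f -> tl c != hd c -> depth 1 (f (arr_el c)).
Proof.
move=> mf lf i w; rewrite ltnS leqn0 size_eq0 => /eqP ->.
rewrite (coef_corner _ _ (cm_corner mf (corner_arr _ c))) /=.
case: (i =P hd c) => [->|_]; last by rewrite !mul0r.
by rewrite eq_sym (negbTE lf) mulr0.
Qed.

Lemma rmorph_cpa_morph (K : fieldType) (V : finType) (Q Q' : quiver V)
    (f : {rmorphism cpa K Q -> cpa K Q'}) :
  scalable f -> (forall i, f (idem Q i) = idem Q' i) -> cpa_morph f.
Proof. by move=> sf fi; split=> // *; rewrite ?rmorphD ?rmorphM. Qed.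

(** * Comparison of Jacobian algebras through a splitting *)

Section Splitting.
Variables (K : fieldType) (V : finType) (Qt Qr P : quiver V).
Variables (St : cpa K Qt) (Sr : cpa K Qr) (T : cpa K P).
Variable phi : {rmorphism cpa K (qsum Qt Qr) -> cpa K P}.
Hypotheses (spl : splitting St Sr T phi) (lfP : forall c : arrow P, tl c != hd c).
Local Notation A' := (cpa K (qsum Qt Qr)).

Let gl (c : arrow (qsum Qt Qr)) : option (arrow Qt) := if c is inl a then Some a else None.
Let gr (c : arrow (qsum Qt Qr)) : option (arrow Qr) := if c is inr a then Some a else None.
Let hl (a : arrow Qt) : arrow (qsum Qt Qr) := inl a.
Let hr (a : arrow Qr) : arrow (qsum Qt Qr) := inr a.

Let ghl c d : gl c = Some d <-> c = hl d.
Proof. by case: c => c; split=> // -[->]. Qed.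
Let ghr c d : gr c = Some d <-> c = hr d.
Proof. by case: c => c; split=> // -[->]. Qed.

Let ml : cpa_morph (@ext_l K V Qt Qr).
Proof. by apply: (extend_morph _ ghl). Qed.
Let mr : cpa_morph (@ext_r K V Qt Qr).
Proof. by apply: (extend_morph _ ghr). Qed.
Let rs : A' -> cpa K Qr := restr hr.
Let mrs : cpa_morph rs.
Proof. by apply: restr_morph. Qed.

Let W : A' := ext_l Qr St + ext_r Qt Sr.

Let lf : forall c : arrow (qsum Qt Qr), tl c != hd c.
Proof.
by case=> c; [exact: (qp_loopfree (sp_triv_qp spl) c) | exact: (qp_loopfree (sp_red_qp spl) c)].
Qed.

Let dWl a : dcyc (hl a) W = ext_l Qr (dcyc a St).
Proof.
rewrite dcycE dcycsD -!dcycE [X in _ + X]dcyc_extend0 // addr0.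
exact: (dcyc_extend ghl).
Qed.

Let dWr a : dcyc (hr a) W = ext_r Qt (dcyc a Sr).
Proof.
rewrite dcycE dcycsD -!dcycE [X in X + _]dcyc_extend0 // add0r.
exact: (dcyc_extend ghr).
Qed.

Let potW : is_potential W.
Proof.
move=> i w; rewrite cpa_coefD; have [e|ne _] := eqVneq (coef (ext_l Qr St) i w) 0.
  rewrite e add0r; apply: (extend_potential ghr) => //.
  exact: (qp_potential (sp_red_qp spl)).
move: ne; apply: (extend_potential ghl) => //; exact: (qp_potential (sp_triv_qp spl)).
Qed.

(** Triviality writes each arrow of [Qt] as a combination of derivatives of [St], cut by
    idempotents. *)
Let JWl a : jacobian W (arr_el (hl a)).
Proof.
rewrite -(extend_arr K ghl) // -[extend gl _]/(ext_l Qr _); have cW := jacobian_cideal W.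
have /(sp_triv spl) : arrow_space (arr_el a : cpa K Qt).
  by move=> i w; rewrite coef_arr; case: (w =P [:: a]) => [->|_] //; rewrite andbF eqxx.
elim=> {a} [x [i [j [y [[a ->] ->]]]]||x y _ Jx _ Jy|k x _ Jx].
- rewrite !(cmM ml); apply: (ciMr cW); apply: (ciMl cW).
  by rewrite -dWl; apply: dcyc_jacobian.
- by rewrite (cm0 ml); apply: (ci0 cW).
- by rewrite (cmD ml); apply: (ciD cW).
- by rewrite (cmZ ml); apply: (ciZ _ cW).
Qed.

Let JW_restr x : jacobian W x -> jacobian Sr (rs x).
Proof.
apply: (jacobian_sub (preim_cideal mrs _ (jacobian_cideal Sr))).
  by move=> c; apply: morph_depth1.
case=> a; last first.
  rewrite -/(hr a) dWr; have -> : rs (ext_r Qt (dcyc a Sr)) = dcyc a Sr by apply: extendK.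
  exact: dcyc_jacobian.
rewrite -/(hl a) dWl.
suff -> : rs (ext_l Qr (dcyc a St)) = 0 by exact: (ci0 (jacobian_cideal Sr)).
apply/cpaP => i u; rewrite coef_restr // cpa_coef0; case: u => [|d u] /=; last first.
  by apply: (coef_extend0 _ _ (mem_head (hr d) _)).
(* Only the empty word is left: the constant term of a derivative along [a] is the coefficient of a
   loop [a], and there are no loops. *)
rewrite (@coef_extend _ _ _ _ gl hl ghl _ _ _ _ [::]) // dcycE coef_dcycs // big_nat1 /=.
apply/eqP; apply: contraT => /(qp_potential (sp_triv_qp spl)) /and3P[_ /= /andP[/eqP e _] /eqP e'].
by have := qp_loopfree (sp_triv_qp spl) a; rewrite e e' eqxx.
Qed.

(** [chi] is the inverse of [phi] followed by the projection killing the trivial arrows. It is an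
    exact left inverse of the restriction of [phi] to the reduced part, and a right inverse modulo
    the Jacobian ideal, which contains the images of the trivial arrows. *)
Lemma splitting_reduction : exists chi : cpa K P -> cpa K Qr,
  [/\ cpa_morph (fun x => phi (ext_r Qt x)),
      forall a, jacobian T (phi (ext_r Qt (dcyc a Sr))),
      cpa_morph chi,
      (forall x, chi (phi (ext_r Qt x)) = x) /\ (forall x, jacobian T x -> jacobian Sr (chi x)) &
      forall x, jacobian T (phi (ext_r Qt (chi x)) - x)].
Proof.
have [sphi iphi [psi phiK psiK] ephi] := sp_equiv spl.
have mphi : cpa_morph phi by apply: rmorph_cpa_morph.
have mpsi : cpa_morph psi.
  split=> [x y|k x|x y|i]; apply: (can_inj phiK).
  - by rewrite (cmD mphi) !psiK.
  - by rewrite (cmZ mphi) !psiK.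
  - by rewrite (cmM mphi) !psiK.
  - by rewrite (cm_idem mphi) psiK.
have dphi c : depth 1 (phi (arr_el c)) by apply: morph_depth1.
have dpsi c : depth 1 (psi (arr_el c)) by apply: morph_depth1.
have eT a : dcyc a T = dcyc a (phi W) by rewrite -(cyc_equiv_dcyc a ephi).
(* The chain rule is applied to [psi], with [W] seen as the image of [phi W]; the derivatives of
   [phi W] are those of [T] by cyclic equivalence. *)
have J1 x : jacobian W x -> jacobian T (phi x).
  have cI := preim_cideal mphi dphi (jacobian_cideal T).
  apply: (jacobian_sub cI) => b; rewrite -[W]phiK.
  apply: (dcyc_morph mpsi dpsi _ cI); first exact: morph_potential.
  by move=> a; rewrite psiK -eT; apply: dcyc_jacobian.
have J2 x : jacobian T x -> jacobian W (psi x).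
  have cI := preim_cideal mpsi dpsi (jacobian_cideal W).
  apply: (jacobian_sub cI) => a; rewrite eT; apply: (dcyc_morph mphi dphi _ cI) => // b.
  by rewrite phiK; apply: dcyc_jacobian.
exists (rs \o psi); split.
- exact: (cpa_morph_comp mphi mr).
- by move=> a; rewrite -dWr; apply/J1/dcyc_jacobian.
- exact: (cpa_morph_comp mrs mpsi).
- by split=> x; [rewrite /= phiK; apply: extendK | move=> Jx; apply/JW_restr/J2].
move=> x; rewrite -[X in _ - X]psiK -(cmB mphi); apply: J1.
have := @restr_mod _ _ _ _ gr hr ghr _ _ _ (psi x) (jacobian_cideal W) _.
move=> H; rewrite -[X in jacobian W X]opprB; apply: (ciN (jacobian_cideal W)).
by apply: H => // -[a _|//]; apply: JWl.
Qed.

End Splitting.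

(** * Pre-mutation of potentials *)

Lemma big_sig (R : nmodType) (I : finType) (p : pred I) (F : I -> R) :
  \sum_(i | p i) F i = \sum_(x : {i | p i}) F (val x).
Proof.
rewrite (reindex_omap (val : {i | p i} -> I) insub) => [|i pi]; last by rewrite insubT.
by apply: eq_bigl => x; rewrite valK eqxx (valP x).
Qed.

Lemma dcyc_mono3 (K : fieldType) (V : finType) (Q : quiver V) (x y z c : arrow Q) :
    tl x = hd y -> tl y = hd z -> tl z = hd x ->
  dcyc c (mono K (hd x) [:: x; y; z]) =
  (if x == c then arr_el y * arr_el z else 0) + (if y == c then arr_el z * arr_el x else 0)
  + (if z == c then arr_el x * arr_el y else 0).
Proof.
move=> exy eyz ezx; rewrite dcyc_mono /= ?exy ?eyz ?ezx ?eqxx // addr0 !mulr1 !mul1r -!addrA.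
congr (_ + (_ + _)); case: eqP => _; rewrite ?scale0r // scale1r.
- by rewrite mono_cons // eyz -/(arr_el z) -mulrA -ezx arr_idem eqxx scale1r.
- by rewrite -/(arr_el z) -mulrA -exy arr_idem eqxx scale1r.
- by rewrite -/(idem Q _) mulrA idem_arr eqxx scale1r -mulrA -eyz arr_idem eqxx scale1r.
Qed.

Lemma mono3 (K : fieldType) (V : finType) (Q : quiver V) (x y z : arrow Q) :
  tl x = hd y -> tl y = hd z -> mono K (hd x) [:: x; y; z] = arr_el x * arr_el y * arr_el z.
Proof. by move=> exy eyz; rewrite mono_cons // exy mono_cons // eyz mulrA. Qed.

Lemma dcycs2_mono3 (K : fieldType) (V : finType) (Q : quiver V) (x y z c d : arrow Q) :
    tl x = hd y -> tl y = hd z -> tl z = hd x -> x != c -> d != x ->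
  dcycs [:: c; d] (mono K (hd x) [:: x; y; z]) =
  if (y == c) && (z == d) then arr_el x else 0.
Proof.
move=> exy eyz ezx xc dx; rewrite dcycs_mono /= ?exy ?eyz ?ezx ?eqxx //.
rewrite big_mkcond !big_nat_recl // big_geq //.
rewrite /= !addr0 ?exy ?eyz ?ezx.
rewrite !eqseq_cons !andbF (negbTE xc) /= !add0r addr0 !andbT.
case: ifP => // _; rewrite -/(idem Q _) -/(arr_el x).
by rewrite idem_arr eqxx scale1r.
Qed.

Section PremutArrows.
Variables (V : finType) (Q : quiver V) (k : V).
Hypothesis lf : forall a : arrow Q, tl a != hd a.

Lemma big_arrow (R : nmodType) (F : arrow Q -> R) : \sum_c F c =
  \sum_(c : off_arrow Q k) F (val c) + \sum_(a : in_arrow Q k) F (val a)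
  + \sum_(b : out_arrow Q k) F (val b).
Proof.
rewrite -(big_sig (fun a => hd a == k)) -(big_sig (fun b => tl b == k)).
rewrite -(big_sig (fun c => (hd c != k) && (tl c != k))).
rewrite (bigID (fun c => hd c == k)) /= [in RHS]addrAC addrC; congr (_ + _).
rewrite (bigID (fun c => tl c == k)) /= addrC; congr (_ + _).
apply: eq_bigl => c; case: eqP => [e|]; rewrite ?andbT ?andbF //.
by case: eqP => // e'; have := lf c; rewrite e e' eqxx.
Qed.

Lemma big_premut (R : nmodType) (F : arrow (premut Q k) -> R) : \sum_x F x =
  \sum_c F (Keep c) + \sum_b \sum_a F (Comp b a) + \sum_a F (StarIn a) + \sum_b F (StarOut b).
Proof.
rewrite (reindex (@premut_arrow_dec _ Q k)) /=; last first.
  by exists (@premut_arrow_enc _ Q k) => [[[[c|[b a]]|a]|b]|x _]; rewrite ?premut_arrow_encK.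
rewrite !big_sumType /= pair_bigA; congr (_ + _ + _ + _).
by apply: eq_bigr => -[b a] _.
Qed.

(** A loop [[ba]] would come from a 2-cycle at [k]. *)
Lemma premut_loopfree : no_2cycle_at Q k -> forall x : arrow (premut Q k), tl x != hd x.
Proof.
move=> no2 [c|b a|a|b] /=; first exact: lf.
- by rewrite eq_sym; apply: no2; rewrite (eqP (valP a), eqP (valP b)).
- by rewrite eq_sym -{2}(eqP (valP a)) lf.
- by rewrite -{2}(eqP (valP b)) eq_sym lf.
Qed.

Lemma premut_hd_k (x : arrow (premut Q k)) : hd x = k -> exists b, x = StarOut b.
Proof.
case: x => [c|b a|a|b] /= e; last by exists b.
- by have := valP c; rewrite e eqxx.
- by have := lf (val b); rewrite e (eqP (valP b)) eqxx.
- by have := lf (val a); rewrite e (eqP (valP a)) eqxx.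
Qed.

Lemma premut_tl_k (x : arrow (premut Q k)) : tl x = k -> exists a, x = StarIn a.
Proof.
case: x => [c|b a|a|b] /= e; [| |by exists a|].
- by have := valP c; rewrite e eqxx andbF.
- by have := lf (val a); rewrite e (eqP (valP a)) eqxx.
- by have := lf (val b); rewrite e (eqP (valP b)) eqxx.
Qed.

Lemma premut_no2 : no_2cycle_at Q k -> no_2cycle_at (premut Q k) k.
Proof.
move=> no2 x y /premut_hd_k[b ->] /premut_tl_k[a ->] /=.
by rewrite eq_sym; apply: no2; apply/eqP; [apply: (valP a) | apply: (valP b)].
Qed.

End PremutArrows.

(** * Brackets and cyclic derivatives at [k] *)

Section Bracket.
Variables (K : fieldType) (V : finType) (Q : quiver V) (k : V).
Hypothesis lf : forall a : arrow Q, tl a != hd a.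
Local Notation Qm := (premut Q k).
Implicit Types (T x : cpa K Q) (i j : V) (w : seq (arrow Qm)).

Definition nostar w := all (fun y => isSome (unbracket1 (y : premut_arrow Q k))) w.

Definition unbr w : seq (arrow Q) :=
  flatten [seq odflt [::] (unbracket1 (y : premut_arrow Q k)) | y <- w].

Lemma unbracketE w : unbracket w = if nostar w then Some (unbr w) else None.
Proof.
elim: w => //= x w ->; rewrite /unbr /= -/(unbr w); case: (unbracket1 x) => //= u.
by case: (nostar w).
Qed.

Lemma nostar_cat w1 w2 : nostar (w1 ++ w2) = nostar w1 && nostar w2.
Proof. exact: all_cat. Qed.

Lemma unbr_cat w1 w2 : unbr (w1 ++ w2) = unbr w1 ++ unbr w2.
Proof. by rewrite /unbr map_cat flatten_cat. Qed.

Lemma walk_unbr i w : nostar w -> walk i (unbr w) = walk i w.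
Proof.
elim: w i => //= -[c|b a|//|//] w IHw i /= nw; rewrite ?IHw //.
by rewrite (eqP (valP a)) (eqP (valP b)) eqxx.
Qed.

Lemma wend_unbr i w : nostar w -> wend i (unbr w) = wend i w.
Proof. by elim: w i => //= -[c|b a|//|//] w IHw i /= nw; rewrite ?IHw. Qed.

Lemma coef_bracket x i w :
  coef (bracket k x) i w = if nostar w then coef x i (unbr w) else 0.
Proof.
rewrite coef_mkser unbracketE; case: ifP => //; case: ifP => // nw nk.
by rewrite coef_out // walk_unbr // nk.
Qed.

(** The expanded word has additional cuts, between the two letters of a bracket; there the second
    piece begins with an arrow of head [k], where [G] vanishes. *)
Lemma sum_unbr (R : nmodType) (G : seq (arrow Q) -> seq (arrow Q) -> R) w : nostar w ->
    (forall p q a, hd a = k -> G p (a :: q) = 0) ->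
  \sum_(0 <= j < (size w).+1) G (unbr (take j w)) (unbr (drop j w))
  = \sum_(0 <= j < (size (unbr w)).+1) G (take j (unbr w)) (drop j (unbr w)).
Proof.
elim: w G => [|x w IHw] G /=; first by rewrite !big_nat1.
case/andP=> nx nw G0; rewrite big_nat_recl //=.
have {}IHw p : \sum_(0 <= j < (size w).+1) G (p ++ unbr (take j w)) (unbr (drop j w))
  = \sum_(0 <= j < (size (unbr w)).+1) G (p ++ take j (unbr w)) (drop j (unbr w)).
  by apply: (IHw (fun p' q => G (p ++ p') q)) => // p' q a; apply: G0.
case: x nx => [c|b a|//|//] _.
  by rewrite (IHw [:: val c]) -[unbr (_ :: w)]/(val c :: unbr w) [RHS]big_nat_recl.
rewrite (IHw [:: val b; val a]) -[unbr (_ :: w)]/[:: val b, val a & unbr w].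
rewrite [RHS]big_nat_recl // [in RHS]big_nat_recl //.
by rewrite /= ?take0 ?drop0 [X in _ + (X + _)]G0 ?add0r //; apply/eqP/(valP a).
Qed.

(** A cut inside a bracket [[ba]] would give a cycle of [T] beginning at [k]. *)
Lemma dcycs_bracket s' T : no_cycle_begins T k -> nostar s' ->
  dcycs s' (bracket k T) = bracket k (dcycs (unbr s') T).
Proof.
move=> nok ns; apply/cpaP => i w; rewrite coef_bracket.
have [wk|nw] := boolP (walk i w); last first.
  by rewrite coef_out //; case: ifP => // nst; rewrite coef_out // walk_unbr.
rewrite coef_dcycs //; case: ifP => nst; last first.
  rewrite big1 // => j _; rewrite coef_bracket !nostar_cat ns /= andbC.
  by rewrite -nostar_cat cat_take_drop nst.
rewrite coef_dcycs ?walk_unbr // -(@sum_unbr _ (fun p q =>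
  coef T (wend i p) (q ++ unbr s' ++ p)) w) //; last first.
  move=> p q a ha; have [e|ne] := eqVneq (wend i p) k.
    by apply/eqP; apply: contraT => /nok; rewrite e eqxx.
  by rewrite coef_out //= ha eq_sym (negbTE ne).
apply: eq_bigr => j _; have /andP[nt nd] : nostar (take j w) && nostar (drop j w).
  by rewrite -nostar_cat cat_take_drop.
by rewrite coef_bracket !nostar_cat nt nd ns /= !unbr_cat wend_unbr.
Qed.

Lemma dcycs_bracket0 s' T : ~~ nostar s' -> dcycs s' (bracket k T) = 0.
Proof.
move=> ns; apply/cpaP => i w; rewrite cpa_coef0; have [wk|nw] := boolP (walk i w); last by rewrite coef_out.
rewrite coef_dcycs // big1 // => j _; rewrite coef_bracket !nostar_cat.
by rewrite (negbTE ns) /= andbF.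
Qed.

Lemma bracket_potential T : is_potential T -> is_potential (bracket k T).
Proof.
move=> potT i w; rewrite coef_bracket; case: ifP => [nw|]; last by rewrite eqxx.
by case/potT/and3P => nn; rewrite walk_unbr // wend_unbr // /is_cycle => -> ->; case: w nw nn.
Qed.

Lemma bracket_nok T : no_cycle_begins T k -> no_cycle_begins (bracket k T) k.
Proof. by move=> nok i w; rewrite coef_bracket; case: ifP => [_ /nok|]; rewrite ?eqxx. Qed.

(** In a cycle of [T] the letter [b] is followed by an arrow of head [k]: as last letter it would
    make the cycle begin at [k]. *)
Lemma dcyc_out T (b : out_arrow Q k) : is_potential T -> no_cycle_begins T k ->
  dcyc (val b) T = \sum_(a : in_arrow Q k) arr_el (val a) * dcyc2 (val b) (val a) T.
Proof.
move=> potT nok; apply/cpaP => i w; rewrite cpa_coef_sum.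
under eq_bigr => a _ do rewrite coef_arr_mul.
have [wk|nw] := boolP (walk i w); last first.
  rewrite coef_out // big1 // => -[a ha] _; case: w nw => //= d v.
  case: (d =P a) => [->|_]; last by rewrite mul0r.
  rewrite [i == _]eq_sym; case: (hd a == i) => /= nw; last by rewrite mul0r.
  by rewrite coef_out ?mulr0.
have T0 l q : wend l (q ++ [:: val b]) = k -> coef T l (q ++ [:: val b]) = 0.
  move=> e; apply/eqP; apply: contraT => ne; have := nok _ _ ne.
  by case/potT/and3P: ne => _ _ /eqP <-; rewrite e eqxx.
rewrite dcycE coef_dcycs // big_nat_recl // take0 drop0 T0; last first.
  by rewrite wend_cat /= (eqP (valP b)).
rewrite add0r; case: w wk => [|d v] wk; first by rewrite big_geq // big1.
have [hdk|hdk] := eqVneq (hd d) k; last first.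
  rewrite big1 ?big1 // => [a _|j _].
    case: (d =P val a) => [e|_]; last by rewrite mul0r.
    by move: hdk; rewrite e (eqP (valP a)) eqxx.
  rewrite coef_out // !walk_cat /= (eqP (valP b)) (negbTE hdk).
  by rewrite !andbF.
(* Only the first letter of the path can be the factor [a]. *)
pose a0 : in_arrow Q k := exist _ d (introT eqP hdk).
rewrite (bigD1 a0) //= [X in _ + X]big1 ?addr0 => [|a aa]; last first.
  by case: (d =P val a) => [e|_]; [case/eqP: aa; apply/val_inj | rewrite mul0r].
case/andP: wk => /eqP hdi wk; rewrite hdi !eqxx mul1r dcyc2E coef_dcycs //.
Qed.

(** Mirror image of [dcyc_out]: [a] is never the first letter of a cycle of [T]. The factor [b] is
    now the last letter of the path, whence [belast] and [last]. *)
Lemma dcyc_in T (a : in_arrow Q k) : is_potential T -> no_cycle_begins T k ->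
  dcyc (val a) T = \sum_(b : out_arrow Q k) dcyc2 (val b) (val a) T * arr_el (val b).
Proof.
move=> potT nok; apply/cpaP => i w; rewrite cpa_coef_sum.
have [wk|nw] := boolP (walk i w); last first.
  by rewrite coef_out // big1 // => b _; rewrite coef_out.
have T0 l q : coef T l (val a :: q) = 0.
  apply/eqP; apply: contraT => ne; have := nok _ _ ne.
  by case/potT/and3P: ne => _ /= /andP[/eqP <- _] _; rewrite (eqP (valP a)) eqxx.
have E (b : out_arrow Q k) : coef (dcyc2 (val b) (val a) T * arr_el (val b)) i w =
    if w is d :: v then (last d v == val b)%:R * coef (dcyc2 (val b) (val a) T) i (belast d v) else 0.
  rewrite cpa_coefM; case: w wk => [|d v] wk; first by rewrite big_nat1 coef_arr andbF mulr0.
  rewrite big_nat_recr //= drop_oversize // coef_arr andbF mulr0 addr0.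
  rewrite big_nat_recr //=.
  have -> : take (size v) (d :: v) = belast d v by rewrite lastI -cats1 take_size_cat ?size_belast.
  have -> : drop (size v) (d :: v) = [:: last d v] by rewrite lastI -cats1 drop_size_cat ?size_belast.
  rewrite coef_arr eqseq_cons andbT.
  rewrite big_nat big1 ?add0r => [|j /andP[_ lt]]; last first.
    rewrite coef_arr; case: (_ =P [:: val b]) => [/(congr1 size)|_]; last by rewrite andbF mulr0.
    by rewrite size_drop /=; lia.
  move: wk; rewrite lastI -cats1 walk_cat /= => /and3P[_ /eqP <- _].
  by case: (_ =P val b) => [->|_]; rewrite ?eqxx ?andbF ?mulr0 ?mul0r ?mulr1 ?mul1r.
under eq_bigr => b _ do rewrite E.
rewrite dcycE coef_dcycs // big_nat_recr //= drop_oversize // T0 addr0.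
case: w wk {E} => [|d v] wk; first by rewrite big_geq // big1.
have [tlk|tlk] := eqVneq (tl (last d v)) k; last first.
  rewrite [RHS]big1 => [|b _]; last first.
    case: (_ =P val b) => [e|_]; last by rewrite mul0r.
    by move: tlk; rewrite e (eqP (valP b)) eqxx.
  rewrite big1 // => j _.
  rewrite coef_out // !walk_cat.
  have -> : wend (wend i (take j (d :: v))) (drop j (d :: v)) = tl (last d v).
    by rewrite -wend_cat cat_take_drop lastI -cats1 wend_cat.
  by rewrite /= (eqP (valP a)) eq_sym (negbTE tlk) andbF.
pose b0 : out_arrow Q k := exist _ (last d v) (introT eqP tlk).
rewrite (bigD1 b0) //= [X in _ + X]big1 ?addr0 => [|b bb]; last first.
  by case: (_ =P val b) => [e|_]; [case/eqP: bb; apply/val_inj | rewrite mul0r].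
rewrite eqxx mul1r dcyc2E coef_dcycs; last first.
  by move: wk; rewrite lastI -cats1 walk_cat => /andP[].
rewrite size_belast !big_nat; apply: eq_bigr => j /andP[_ lt].
rewrite lastI -cats1 takel_cat ?size_belast // drop_cat size_belast.
case: ltnP => [_|ge]; first by rewrite -catA.
have -> : j = size v by lia.
by rewrite subnn drop0 drop_oversize ?size_belast.
Qed.

Lemma dcycs_corner T d p : is_potential T ->
  corner (tl (last d p)) (hd d) (dcycs (d :: p) T).
Proof.
move=> potT; apply/cpaP => i w; rewrite coef_mul_idem coef_idem_mul.
have [wk|nw] := boolP (walk i w); last by rewrite coef_out // mulr0 mul0r.
have [/andP[/eqP-> /eqP->]|nc] := boolP ((i == tl (last d p)) && (wend i w == hd d)).
  by rewrite !eqxx mulr1 mul1r.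
suff -> : coef (dcycs (d :: p) T) i w = 0 by rewrite mulr0 mul0r.
rewrite coef_dcycs // big1 // => j _; apply/eqP; apply: contraNT nc => /potT/and3P[_].
rewrite !walk_cat !wend_cat -wend_cat cat_take_drop /=.
have -> : wend (tl d) p = tl (last d p) by elim: (p) (d) => //=.
case/and3P=> _ /andP[/eqP -> _]; rewrite eqxx andbT.
have : walk i (take j w) by move: wk; rewrite -{1}[w](cat_take_drop j) walk_cat => /andP[].
by case: (take j w) => [_ _ /=|c q /= /andP[/eqP -> _] /andP[/eqP -> _]]; rewrite ?eqxx // eq_sym.
Qed.

End Bracket.

(** * Cyclic derivatives of the pre-mutated potential *)

Section PremutDerivatives.
Variables (K : fieldType) (V : finType) (Q : quiver V) (k : V).
Local Notation Qm := (premut Q k).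
Implicit Types (T : cpa K Q) (a : in_arrow Q k) (b : out_arrow Q k) (s : K).

Let star b a : cpa K Qm := mono K (hd (val b))
  [:: Comp b a : arrow Qm; StarIn a : arrow Qm; StarOut b : arrow Qm].

Let dstar x b a : dcyc x (star b a) =
  (if Comp b a == x then arr_el (StarIn a : arrow Qm) * arr_el (StarOut b : arrow Qm) else 0)
  + (if StarIn a == x then arr_el (StarOut b : arrow Qm) * arr_el (Comp b a : arrow Qm) else 0)
  + (if StarOut b == x then arr_el (Comp b a : arrow Qm) * arr_el (StarIn a : arrow Qm) else 0).
Proof. by rewrite (@dcyc_mono3 _ _ Qm (Comp b a) (StarIn a) (StarOut b)). Qed.

Lemma premut_potE s T : premut_pot k s T = bracket k T + s *: \sum_b \sum_a star b a.
Proof.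
congr (_ + s *: _); apply: eq_bigr => b _; apply: eq_bigr => a _.
by apply/esym/(@mono3 _ _ Qm (Comp b a) (StarIn a) (StarOut b)).
Qed.

Lemma dcyc_Keep s T c : no_cycle_begins T k ->
  dcyc (Keep c : arrow Qm) (premut_pot k s T) = bracket k (dcyc (val c) T).
Proof.
move=> nok; rewrite premut_potE dcycE dcycsD dcycsZ !dcycs_sum dcycs_bracket //=.
rewrite [X in _ *: X]big1 ?scaler0 ?addr0 // => b _; rewrite dcycs_sum big1 // => a _.
by rewrite -dcycE dstar !addr0.
Qed.

Lemma dcyc_Comp s T a b : no_cycle_begins T k ->
  dcyc (Comp b a : arrow Qm) (premut_pot k s T) =
  bracket k (dcyc2 (val b) (val a) T)
  + s *: (arr_el (StarIn a : arrow Qm) * arr_el (StarOut b : arrow Qm)).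
Proof.
move=> nok; rewrite premut_potE dcycE dcycsD dcycsZ !dcycs_sum dcycs_bracket //=.
congr (_ + _ *: _); rewrite (bigD1 b) //= [X in _ + X]big1 ?addr0 => [|b' bb]; last first.
  rewrite dcycs_sum big1 // => a' _; rewrite -dcycE dstar !addr0.
  by case: eqP => // -[e _]; rewrite e eqxx in bb.
rewrite dcycs_sum (bigD1 a) //= big1 ?addr0 => [|a' aa].
  by rewrite -dcycE dstar eqxx !addr0.
by rewrite -dcycE dstar !addr0; case: eqP => // -[e]; rewrite e eqxx in aa.
Qed.

Lemma dcyc_StarIn s T a : dcyc (StarIn a : arrow Qm) (premut_pot k s T) =
  s *: \sum_b arr_el (StarOut b : arrow Qm) * arr_el (Comp b a : arrow Qm).
Proof.
rewrite premut_potE dcycE dcycsD dcycsZ !dcycs_sum dcycs_bracket0 // add0r; congr (_ *: _).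
apply: eq_bigr => b _; rewrite dcycs_sum (bigD1 a) //= big1 ?addr0 => [|a' aa].
  by rewrite -dcycE dstar eqxx addr0 add0r.
by rewrite -dcycE dstar addr0 add0r; case: eqP => // -[e]; rewrite e eqxx in aa.
Qed.

Lemma dcyc_StarOut s T b : dcyc (StarOut b : arrow Qm) (premut_pot k s T) =
  s *: \sum_a arr_el (Comp b a : arrow Qm) * arr_el (StarIn a : arrow Qm).
Proof.
rewrite premut_potE dcycE dcycsD dcycsZ !dcycs_sum dcycs_bracket0 // add0r; congr (_ *: _).
rewrite (bigD1 b) //= [X in _ + X]big1 ?addr0 => [|b' bb]; last first.
  rewrite dcycs_sum big1 // => a _; rewrite -dcycE dstar !add0r.
  by case: eqP => // -[e]; rewrite e eqxx in bb.
rewrite dcycs_sum; apply: eq_bigr => a _.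
by rewrite -dcycE dstar eqxx !add0r.
Qed.

(** Starred arrows occur in the cubic terms only, and [a^* b^*] in exactly one of these. *)
Lemma dcyc2_stars s T a b : dcyc2 (StarIn a : arrow Qm) (StarOut b : arrow Qm) (premut_pot k s T) =
  s *: arr_el (Comp b a : arrow Qm).
Proof.
have D a' b' : dcycs [:: StarIn a : arrow Qm; StarOut b : arrow Qm] (star b' a') =
    if (a' == a) && (b' == b) then arr_el (Comp b a : arrow Qm) else 0.
  apply: etrans (@dcycs2_mono3 K V Qm (Comp b' a') (StarIn a') (StarOut b') (StarIn a) (StarOut b)
    erefl erefl erefl isT isT) _.
  have -> : (StarIn a' == StarIn a :> arrow Qm) && (StarOut b' == StarOut b :> arrow Qm)
      = (a' == a) && (b' == b).
    by apply/andP/andP => [[/eqP[->] /eqP[->]] //|[/eqP -> /eqP ->]].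
  by have [/andP[/eqP ea /eqP eb]|_] := boolP ((a' == a) && (b' == b)); rewrite ?ea ?eb.
rewrite premut_potE dcyc2E dcycsD dcycsZ !dcycs_sum dcycs_bracket0 // add0r; congr (_ *: _).
rewrite (bigD1 b) //= [X in _ + X]big1 ?addr0 => [|b' bb]; last first.
  by rewrite dcycs_sum big1 // => a' _; rewrite D (negbTE bb) andbF.
rewrite dcycs_sum (bigD1 a) //= big1 ?addr0 => [|a' aa]; first by rewrite D !eqxx.
by rewrite D (negbTE aa).
Qed.

Lemma premut_potential s T : is_potential T -> is_potential (premut_pot k s T).
Proof.
move=> potT i w; rewrite premut_potE cpa_coefD.
have [e|/(bracket_potential potT) //] := eqVneq (coef (bracket k T) i w) 0.
rewrite e add0r cpa_coefZ cpa_coef_sum => ne.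
have [//|nc] := boolP (is_cycle i w); case/eqP: ne; rewrite big1 ?mulr0 // => b _.
rewrite cpa_coef_sum big1 // => a _; rewrite coef_mono.
by case: eqP => [[ei ew]|_]; rewrite ?andbF //; move: nc; rewrite ei ew /is_cycle /= !eqxx.
Qed.

Lemma premut_nok s T : (forall a : arrow Q, tl a != hd a) ->
  no_cycle_begins T k -> no_cycle_begins (premut_pot k s T) k.
Proof.
move=> lf nok i w; rewrite premut_potE cpa_coefD.
have [e|/(bracket_nok nok) //] := eqVneq (coef (bracket k T) i w) 0.
rewrite e add0r cpa_coefZ cpa_coef_sum; apply: contraNN => /eqP ->.
rewrite big1 ?mulr0 // => b _; rewrite cpa_coef_sum big1 // => a _; rewrite coef_mono.
case: eqP => [[e' _]|_]; rewrite ?andbF //.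
by have := lf (val b); rewrite (eqP (valP b)) -e' eqxx.
Qed.

End PremutDerivatives.

(** * Evaluation of bracketed series *)

Section Transport.
Variables (K : fieldType) (V : finType) (Q : quiver V) (k : V).
Hypothesis lf : forall a : arrow Q, tl a != hd a.
Local Notation Qm := (premut Q k).
Variables (X : rep K Qm) (Y : rep K Q) (v : forall i, 'Hom(X i, Y i)).
Hypotheses (nilX : nilpotent X) (nilY : nilpotent Y).
Hypothesis vKeep : forall (c : off_arrow Q k) y,
  v (hd (val c)) (rmap X (Keep c : arrow Qm) y) = rmap Y (val c) (v (tl (val c)) y).
Hypothesis vComp : forall (b : out_arrow Q k) (a : in_arrow Q k) y,
  v (hd (val b)) (rmap X (Comp b a : arrow Qm) y) =
  act1 Y (hd (val b)) (val b) k (act1 Y k (val a) (tl (val a)) (v (tl (val a)) y)).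

Lemma lres_bracket_Keep (z : cpa K Q) (c : off_arrow Q k) :
  lres (Keep c : arrow Qm) (bracket k z) = bracket k (lres (val c) z).
Proof.
apply/cpaP => i w; rewrite coef_lres !coef_bracket /= coef_lres.
by case: ifP => // _; case: ifP => //; rewrite -/(nostar w) => ->.
Qed.

Lemma lres_bracket_Comp (z : cpa K Q) (b : out_arrow Q k) (a : in_arrow Q k) :
  lres (Comp b a : arrow Qm) (bracket k z) = bracket k (lres (val a) (lres (val b) z)).
Proof.
apply/cpaP => i w; rewrite coef_lres !coef_bracket /= !coef_lres.
rewrite (eqP (valP a)) (eqP (valP b)) eqxx.
by case: ifP => // _; case: ifP => //; rewrite -/(nostar w) => ->.
Qed.

Lemma lres_bracket0 (z : cpa K Q) (x : arrow Qm) : ~~ nostar [:: x] -> lres x (bracket k z) = 0.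
Proof.
move=> /negbTE ns; apply/cpaP => i w; rewrite coef_lres coef_bracket cpa_coef0.
by rewrite (nostar_cat [:: x]) ns if_same.
Qed.

(** One step of [X] along [[ba]] is two steps of [Y], through the space at [k], where [X] and [Y]
    are not compared. *)
Lemma bracket_eval (z : cpa K Q) i j (y : X j) : i != k -> j != k ->
  v i (eval X (bracket k z) i j y) = eval Y z i j (v j y).
Proof.
move=> ik jk; apply/eqP; rewrite -subr_eq0; apply/eqP.
pose D z i := v i (eval X (bracket k z) i j y) - eval Y z i j (v j y).
(* At [k] the defect [D] is not controlled; there [P] consists of the sums of arrows into [k]
   applied to defects off [k]. *)
pose P i (d : Y i) := if i == k
  then exists z, d = \sum_(a : in_arrow Q k) act1 Y i (val a) (tl (val a)) (D (lres (val a) z) (tl (val a)))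
  else exists z, d = D z i.
suff H i' d : P i' d -> d = 0 by apply: (H i); rewrite /P (negbTE ik); exists z.
move: i' d {z i ik}; apply: nilp_coind => // i d.
have inlf (a : in_arrow Q k) : tl (val a) != k by have := lf (val a); rewrite (eqP (valP a)).
have outlf (b : out_arrow Q k) : hd (val b) != k by have := lf (val b); rewrite (eqP (valP b)) eq_sym.
rewrite /P; case: ifP => [/eqP ik|/negbT ik] [z ->].
  exists (fun c => D (lres c z) (tl c)); last first.
    move=> c hc; have -> : tl c == k = false by apply/negbTE; rewrite -ik -hc lf.
    by exists (lres c z).
  rewrite (big_arrow k lf) [X in X + _ + _]big1 => [|c _]; last first.
    by rewrite act1_hd ?zero_lfunE // ik; case/andP: (valP c).
  rewrite [X in _ + X]big1 ?addr0 ?add0r // => b _.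
  by rewrite act1_hd ?zero_lfunE // ik.
exists (fun c => if tl c == k then
    \sum_(a : in_arrow Q k) act1 Y (tl c) (val a) (tl (val a)) (D (lres (val a) (lres c z)) (tl (val a)))
  else D (lres c z) (tl c)); last first.
  by move=> c _; case: (tl c == k); exists (lres c z).
rewrite (big_arrow k lf) [X in _ + X + _]big1 ?addr0 => [|a _]; last first.
  by rewrite act1_hd ?zero_lfunE // (eqP (valP a)) eq_sym.
have -> : D z i = \sum_(c : off_arrow Q k) act1 Y i (val c) (tl (val c)) (D (lres (val c) z) (tl (val c)))
   + \sum_(b : out_arrow Q k) act1 Y i (val b) k (\sum_(a : in_arrow Q k) act1 Y k (val a) (tl (val a))
      (D (lres (val a) (lres (val b) z)) (tl (val a)))); last first.
  congr (_ + _); apply: eq_bigr => c _; last by rewrite (eqP (valP c)) eqxx.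
  by case/andP: (valP c) => _ /negbTE ->.
rewrite {1}/D !eval_unroll // !(add_lfunE, scale_lfunE, sum_lfunE) linearD linearZ linear_sum /=.
have -> : v i (id_at X i j y) = id_at Y i j (v j y).
  case: (j =P i) y @D @P => [->|/eqP ne] y D P; first by rewrite !id_atxx !id_lfunE.
  by rewrite !id_at_neq // !zero_lfunE linear0.
rewrite coef_bracket opprD addrACA subrr add0r (big_arrow k lf) big_premut.
rewrite [X in _ + _ + X + _]big1 ?addr0 => [|a _]; last first.
  by rewrite lres_bracket0 // eval0 comp_lfun0r zero_lfunE linear0.
rewrite [X in _ + _ + X - _]big1 ?addr0 => [|b _]; last first.
  by rewrite lres_bracket0 // eval0 comp_lfun0r zero_lfunE linear0.
rewrite [X in _ - (_ + X + _)]big1 ?addr0 => [|a _]; last first.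
  by rewrite act1_hd ?comp_lfun0l ?zero_lfunE // (eqP (valP a)) eq_sym.
rewrite opprD addrACA -sumrB -sumrB; congr (_ + _).
  apply: eq_bigr => c _; rewrite lres_bracket_Keep.
  have [e|ne] := eqVneq (hd (val c)) i.
    rewrite -e (comp_lfunE (act1 X _ _ _)) (comp_lfunE (act1 Y _ _ _)) linearB /=; congr (_ - _).
    rewrite act1E -vKeep; congr (v _ _); congr (fun_of_lfun _ _); exact: (act1E X (Keep c : arrow Qm)).
  by rewrite !act1_hd // !comp_lfun0l !zero_lfunE linear0 subrr.
apply: eq_bigr => b _; have [e|ne] := eqVneq (hd (val b)) i; last first.
  rewrite !(act1_hd Y _ ne) comp_lfun0l !zero_lfunE subr0 big1 // => a _.
  by rewrite act1_hd // comp_lfun0l !zero_lfunE linear0.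
rewrite (eqP (valP b)) -e (comp_lfunE (act1 Y _ _ _)).
(* The second step of [Y], unrolled at [k]; its constant term drops because [j != k]. *)
rewrite (eval_unroll (lres (val b) z)) // !(add_lfunE, scale_lfunE, sum_lfunE).
rewrite id_at_neq // zero_lfunE scaler0 add0r (big_arrow k lf).
rewrite [X in X + _ + _]big1 ?add0r => [|c _]; last first.
  by rewrite act1_hd ?comp_lfun0l ?zero_lfunE //; case/andP: (valP c).
rewrite [X in _ - act1 _ _ _ _ (_ + X)]big1 ?addr0 => [|c _]; last first.
  by rewrite act1_hd ?comp_lfun0l ?zero_lfunE.
rewrite [RHS]linear_sum [X in _ - X]linear_sum /= -sumrB; apply: eq_bigr => a _.
rewrite (comp_lfunE (act1 X _ _ _)) (comp_lfunE (act1 Y _ _ _)) /D !linearB /= lres_bracket_Comp.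
congr (_ - _); rewrite -vComp; congr (v _ _); congr (fun_of_lfun _ _).
exact: (act1E X (Comp b a : arrow Qm)).
Qed.

End Transport.

(** * Pre-mutation of representations *)

Section LinearAlgebra.
Variables (K : fieldType).

Lemma vinclE (W : vectType K) (U : {vspace W}) u : vincl U u = vsval u.
Proof. by rewrite lfunE. Qed.

Lemma vcoresE (W : vectType K) (U : {vspace W}) w : w \in U -> vsval (vcores U w) = w.
Proof. by move=> wU; rewrite lfunE /= vsprojK. Qed.

Lemma qpi_eq0 (W : vectType K) (U : {vspace W}) w : (qpi U w == 0) = (w \in U).
Proof. by rewrite -memv_ker lker_qpi. Qed.

Lemma qlift_qpi (W W' : vectType K) (U : {vspace W}) (f : 'Hom(W, W')) w :
  (forall u, u \in U -> f u = 0) -> qlift U f (qpi U w) = f w.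
Proof.
move=> fU; rewrite -[LHS]comp_lfunE qliftE //; apply/subvP => u uU.
by rewrite memv_ker fU.
Qed.

Lemma dsum_eqP (I : finType) (U : I -> vectType K) (f g : dsum U) :
  (forall i, f i = g i) -> f = g.
Proof. by move/dsumP. Qed.

Lemma dsum_sumE (I J : finType) (U : I -> vectType K) (F : J -> dsum U) i :
  (\sum_j F j) i = \sum_j F j i.
Proof.
elim/big_rec2: _ => [|j y x _ <-]; first exact: dsum_mkE.
exact: dsum_addE.
Qed.

Lemma dsum_decomp (I : finType) (U : I -> vectType K) (f : dsum U) :
  f = \sum_i dsum_inj U i (f i).
Proof.
apply: dsum_eqP => j; rewrite dsum_sumE (bigD1 j) //= dsum_injE dsum_single_id.
by rewrite big1 ?addr0 // => i ij; rewrite dsum_injE dsum_single_neq.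
Qed.

End LinearAlgebra.

Section PremutLinear.
Variables (K : fieldType) (V : finType) (Q : quiver V) (k : V).
Variables (T : cpa K Q) (M : rep K Q).
Local Notation Min := (Min k M).
Local Notation Mout := (Mout k M).
Local Notation alpha := (alpha k M).
Local Notation beta := (beta k M).
Local Notation gamma := (gamma k T M).

Lemma alphaE x : alpha x = \sum_a act1 M k (val a) (tl (val a)) (x a).
Proof.
rewrite sum_lfunE; apply: eq_bigr => a _.
by rewrite (comp_lfunE (act1 _ _ _ _)) dsum_projE.
Qed.

Lemma betaE v b : beta v b = act1 M (hd (val b)) (val b) k v.
Proof.
rewrite sum_lfunE dsum_sumE (bigD1 b) //= comp_lfunE dsum_injE dsum_single_id.
by rewrite big1 ?addr0 // => b' bb; rewrite comp_lfunE dsum_injE dsum_single_neq.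
Qed.

Lemma gammaE u a :
  gamma u a = \sum_b eval M (dcyc2 (val b) (val a) T) (tl (val a)) (hd (val b)) (u b).
Proof.
rewrite sum_lfunE dsum_sumE (bigD1 a) //= [X in _ + X]big1 ?addr0 => [|a' aa].
  rewrite sum_lfunE dsum_sumE; apply: eq_bigr => b _.
  by rewrite comp_lfunE dsum_injE dsum_single_id comp_lfunE dsum_projE.
rewrite sum_lfunE dsum_sumE big1 // => b _.
by rewrite comp_lfunE dsum_injE dsum_single_neq.
Qed.

Lemma alpha_inj a y : alpha (dsum_inj _ a y) = act1 M k (val a) (tl (val a)) y.
Proof.
rewrite dsum_injE alphaE (bigD1 a) // dsum_single_id /= big1 ?addr0 // => a' aa.
by rewrite dsum_single_neq 1?eq_sym // linear0.
Qed.

Lemma gamma_inj b a u : gamma (dsum_inj _ b u) a =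
  eval M (dcyc2 (val b) (val a) T) (tl (val a)) (hd (val b)) u.
Proof.
rewrite dsum_injE gammaE (bigD1 b) // dsum_single_id /= big1 ?addr0 // => b' bb.
by rewrite dsum_single_neq 1?eq_sym // linear0.
Qed.

Section Module.
Hypotheses (potT : is_potential T) (nok : no_cycle_begins T k) (modM : is_module T M).

(** By [dcyc_out] the component of the composite at [b] is the action of the derivative along [b], a
    relation of [M]. Dually, [dcyc_in] gives [gamma_beta]. *)
Lemma alpha_gamma u : alpha (gamma u) = 0.
Proof.
have [nilM relM] := modM; rewrite alphaE.
under eq_bigr => a _ do rewrite gammaE linear_sum /=.
rewrite exchange_big big1 //= => b _.
rewrite -[RHS](zero_lfunE _ (u b)) -(relM (val b)) (dcyc_out b potT nok) eval_sum sum_lfunE.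
apply: eq_bigr => a _; rewrite eval_mul // (bigD1 (tl (val a))) //= big1 ?addr0.
  by rewrite eval_arr.
by move=> l la; rewrite eval_arr // act1_tl 1?eq_sym // zero_lfunE.
Qed.

Lemma gamma_beta v : gamma (beta v) = 0.
Proof.
have [nilM relM] := modM; apply: dsum_eqP => a; rewrite gammaE.
under eq_bigr => b _ do rewrite betaE.
transitivity (eval M (dcyc (val a) T) (tl (val a)) k v); last first.
  by rewrite relM zero_lfunE [RHS]dsum_mkE.
rewrite (dcyc_in a potT nok) eval_sum sum_lfunE; apply: eq_bigr => b _.
rewrite eval_mul // (bigD1 (hd (val b))) //= [X in _ + X]big1 ?addr0; first by rewrite eval_arr.
by move=> l lb; rewrite eval_arr // act1_hd 1?eq_sym // zero_lfunE linear0.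
Qed.

End Module.

Section Stars.
Variables (s : K) (rho : 'Hom(Mout, ker_gamma k T M))
  (sigma : 'Hom(ker_alpha_mod k T M, ker_alpha k M)).

Lemma star_outE u : star_out s rho u =
  (- s *: qpi (im_beta_in_ker k T M) (rho u), - s *: vcores (limg gamma) (gamma u), 0).
Proof.
rewrite add_lfunE !comp_lfunE !scale_lfunE !comp_lfunE.
set x := _ *: _; set y := _ *: _.
have [_ [-> _ _]] := Mbar_components x 0 0 (0 : Mbar k T M).
have [_ [_ -> _]] := Mbar_components 0 y 0 (0 : Mbar k T M).
by congr (_, _, _); rewrite ?addr0 ?add0r.
Qed.

Lemma star_inE y : star_in sigma y = vsval y.1.2 + vsval (sigma y.2).
Proof.
rewrite add_lfunE !comp_lfunE !vinclE.
by have [[_ -> ->] _] := Mbar_components 0 0 0 y.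
Qed.

Hypotheses (potT : is_potential T) (nok : no_cycle_begins T k) (modM : is_module T M).
Hypothesis rhoK : (rho \o vincl (lker gamma))%VF = \1%VF.
Hypothesis sigmaK : (pi_map k T M \o sigma)%VF = \1%VF.

Lemma rhoE u : gamma u = 0 -> vsval (rho u) = u.
Proof.
move=> g0; have uk : u \in lker gamma by rewrite memv_ker g0.
have /lfunP/(_ (vcores _ u)) := rhoK.
by rewrite comp_lfunE vinclE vcoresE // id_lfunE => ->; apply: vcoresE.
Qed.

Lemma qpi_sigma y : qpi (im_gamma_in_ker k T M) (sigma y) = y.
Proof. by have /lfunP/(_ y) := sigmaK; rewrite comp_lfunE id_lfunE. Qed.

Lemma star_in_out u : star_in sigma (star_out s rho u) = - s *: gamma u.
Proof.
rewrite star_outE star_inE -!vinclE /= !linear0 addr0 linearZ /= vinclE vcoresE //.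
exact: memv_img (memvf _).
Qed.

(** The second block contributes the image of [gamma], the third a section of the quotient by it;
    together they exhaust the kernel of [alpha]. *)
Lemma star_in_im x : (exists y, star_in sigma y = x) <-> alpha x = 0.
Proof.
split=> [[y <-]|x0].
  rewrite star_inE linearD /=.
  have /memv_imgP[u _ ->] := subvsP y.1.2.
  rewrite alpha_gamma // add0r; apply/eqP; rewrite -memv_ker; exact: subvsP.
have xk : x \in lker alpha by rewrite memv_ker x0.
pose x' : ker_alpha k M := vcores _ x; pose t := qpi (im_gamma_in_ker k T M) x'.
have : x' - sigma t \in im_gamma_in_ker k T M.
  by rewrite -qpi_eq0 linearB /= qpi_sigma subrr.
rewrite -memv_preim linearB /= !vinclE vcoresE // => im.
exists (0, vcores (limg gamma) (x - vsval (sigma t)), t).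
by rewrite star_inE /= vcoresE // subrK.
Qed.

(** The second block forces [u] into the kernel of [gamma], where [rho] is the identity; the first
    block then tests membership in the image of [beta]. *)
Lemma star_out_ker u : s != 0 -> star_out s rho u = 0 <-> exists v, beta v = u.
Proof.
move=> s0; rewrite star_outE; split=> [e|[v <-]].
  have /eqP := congr1 (fun y : Mbar k T M => y.1.1) e.
  have /eqP := congr1 (fun y : Mbar k T M => y.1.2) e.
  rewrite /= !scaler_eq0 !oppr_eq0 (negbTE s0) /= => /eqP g0 r0.
  have {}g0 : gamma u = 0.
    by rewrite -(vcoresE (memv_img gamma (memvf u))) g0 linear0.
  move: r0; rewrite qpi_eq0 -memv_preim vinclE rhoE // => /memv_imgP[v _ ->].
  by exists v.
have g0 : gamma (beta v) = 0 by apply: gamma_beta.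
have -> : qpi (im_beta_in_ker k T M) (rho (beta v)) = 0.
  apply/eqP; rewrite qpi_eq0 -memv_preim vinclE rhoE //; exact: memv_img (memvf v).
by rewrite g0 !linear0.
Qed.

End Stars.
End PremutLinear.

Section Casts.
Variables (K : fieldType) (V : finType) (Q : quiver V) (k : V).
Variables (M : rep K Q) (A : vectType K).

Lemma to_offK i y : i != k -> from_off k M A i (to_off k M A i y) = y.
Proof.
rewrite /from_off /to_off /mut_space; case: (i == k) => // _.
by rewrite !id_lfunE.
Qed.

Lemma from_offK i y : i != k -> to_off k M A i (from_off k M A i y) = y.
Proof.
move: y; rewrite /from_off /to_off /mut_space; case: (i == k) => // y _.
by rewrite !id_lfunE.
Qed.

Lemma from_off_inj i y z : i != k -> from_off k M A i y = from_off k M A i z -> y = z.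
Proof. by move=> ik /(congr1 (to_off k M A i)); rewrite !from_offK. Qed.

Lemma from_off_eq0 i y : i != k -> from_off k M A i y = 0 -> y = 0.
Proof. by move=> ik y0; rewrite -(from_offK y ik) y0 linear0. Qed.

Lemma to_kK y : from_k k M A k (to_k k M A k y) = y.
Proof.
rewrite /from_k /to_k /mut_space; case: (k =P k) => // _.
by rewrite !id_lfunE.
Qed.

Lemma from_kK y : to_k k M A k (from_k k M A k y) = y.
Proof.
move: y; rewrite /from_k /to_k /mut_space; case: (k =P k) => // _ y.
by rewrite !id_lfunE.
Qed.

End Casts.

(** * Nilpotency and relations of the pre-mutated representation *)

Section PremutModule.
Variables (K : fieldType) (V : finType) (Q : quiver V) (k : V).
Hypotheses (lf : forall a : arrow Q, tl a != hd a) (no2 : no_2cycle_at Q k).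
Variables (T : cpa K Q) (M : rep K Q) (s : K).
Variables (rho : 'Hom(Mout k M, ker_gamma k T M))
  (sigma : 'Hom(ker_alpha_mod k T M, ker_alpha k M)).
Local Notation Qm := (premut Q k).
Local Notation X := (premut_rep s rho sigma).
Local Notation fo := (from_off k M (Mbar k T M)).
Local Notation fk := (from_k k M (Mbar k T M) k).

Lemma in_off (a : in_arrow Q k) : tl (val a) != k.
Proof. by have := lf (val a); rewrite (eqP (valP a)). Qed.

Lemma out_off (b : out_arrow Q k) : hd (val b) != k.
Proof. by have := lf (val b); rewrite (eqP (valP b)) eq_sym. Qed.

Lemma premut_Keep (c : off_arrow Q k) y :
  fo (hd (val c)) (rmap X (Keep c : arrow Qm) y) = rmap M (val c) (fo (tl (val c)) y).
Proof.
rewrite [rmap _ _]/(premut_rmap _ _ _ _) /= !comp_lfunE to_offK //.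
by case/andP: (valP c).
Qed.

Lemma premut_Comp (b : out_arrow Q k) (a : in_arrow Q k) y :
  fo (hd (val b)) (rmap X (Comp b a : arrow Qm) y) =
  act1 M (hd (val b)) (val b) k (act1 M k (val a) (tl (val a)) (fo (tl (val a)) y)).
Proof.
by rewrite [rmap _ _]/(premut_rmap _ _ _ _) /= 3!comp_lfunE to_offK; last exact: out_off.
Qed.

Lemma premut_StarIn (a : in_arrow Q k) y :
  fo (tl (val a)) (rmap X (StarIn a : arrow Qm) y) = star_in sigma (fk y) a.
Proof.
rewrite [rmap _ _]/(premut_rmap _ _ _ _) /= 2!comp_lfunE to_offK; last exact: in_off.
by rewrite comp_lfunE dsum_projE.
Qed.

Lemma premut_StarOut (b : out_arrow Q k) y :
  fk (rmap X (StarOut b : arrow Qm) y) = star_out s rho (dsum_inj _ b (fo (hd (val b)) y)).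
Proof.
by rewrite [rmap _ _]/(premut_rmap _ _ _ _) /= 2!comp_lfunE to_kK comp_lfunE.
Qed.

Lemma fk_inj y : fk y = 0 -> y = 0.
Proof. by move=> y0; rewrite -[y]from_kK y0 linear0. Qed.

Hypotheses (potT : is_potential T) (nok : no_cycle_begins T k) (modM : is_module T M).
Hypothesis rhoK : (rho \o vincl (lker (gamma k T M)))%VF = \1%VF.
Hypothesis sigmaK : (pi_map k T M \o sigma)%VF = \1%VF.

(** A constant term would be the coefficient of the 2-cycle [ba]. *)
Lemma depth_dcyc2 a b : hd a = k -> tl b = k -> depth 1 (dcyc2 b a T).
Proof.
move=> ha tb i w; rewrite ltnS leqn0 size_eq0 => /eqP ->.
rewrite dcyc2E coef_dcycs // big_nat1 /=; apply/eqP; apply: contraT.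
move/potT/and3P => [_ /= /andP[/eqP hb _] /eqP tae].
by have := no2 ha tb; rewrite hb tae eqxx.
Qed.

Lemma corner_dcyc2 a b : corner (tl a) (hd b) (dcyc2 b a T).
Proof. exact: (@dcycs_corner _ _ _ _ b [:: a]). Qed.

Lemma premut_nilpotent : nilpotent X.
Proof.
have [nilM relM] := modM; pose d := total_dim M.
(* Layers as in [nilpotent_pullback]. *)
pose R n i (w : M i) := forall l x, depth (d - n) x -> eval M x l i w = 0.
have R0 n i : R n i 0 by move=> l x _; rewrite linear0.
have RW n n' i w : (n <= n')%N -> R n' i w -> R n i w.
  by move=> nn Rw l x dx; apply: Rw; apply: depthW dx; rewrite leq_sub2l.
have RS n i j w z : depth 1 z -> corner i j z -> R n j w -> R n.+1 i (eval M z i j w).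
  move=> dz cz Rw l x dx; have := Rw l (x * z); rewrite eval_mul // (bigD1 i) //= big1 ?addr0 => [|p pc].
    apply; apply: depthW (depthM dx dz); rewrite subnS.
    by case: (_ - _)%N => // p; rewrite addn1.
  by rewrite (corner_eval_hd _ _ cz pc) zero_lfunE linear0.
have Ract n c w : R n (tl c) w -> R n.+1 (hd c) (act1 M (hd c) c (tl c) w).
  by move=> Rw; rewrite -eval_arr //; apply: RS Rw; [apply: depth_mono | apply: corner_arr].
(* Indices are halved because the passage [b^*], [a^*] through [k] uses two arrows but acts, up to
   sign, as one derivative along [ba], of depth at least 1, and so gains one layer of [M]. At [k]
   the layer is read on a preimage under [star_out], which need not exist at index 0; the arrow
   [b^*] alone gains no layer. *)
pose P m i (y : X i) := if i == k
  then if m is m'.+1 then exists2 u, from_k k M _ i y = star_out s rho u & forall b, R m'./2 (hd (val b)) (u b) else True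
  else R m./2 i (fo i y).
apply: (@nilpotentP _ _ _ X P (d.*2.+2)).
- move=> i y; rewrite /P; case: ifP => // _ l x dx.
  by rewrite eval_depth ?zero_lfunE //; move: dx; rewrite subn0.
- move=> m i; rewrite /P; case: ifP => [_|_]; last by rewrite linear0; apply: R0.
  case: m => // m; exists 0; first by rewrite !linear0.
  move=> b; rewrite [X in R _ _ X]dsum_mkE; exact: R0.
- move=> m [c|b a|a|b] y.
  + rewrite /P /=; case/andP: (valP c) => /negbTE hk /negbTE tk; rewrite hk tk => Ry.
    rewrite premut_Keep -act1E; apply: RW (Ract _ _ _ Ry).
    by rewrite uphalf_half; case: odd.
  + rewrite /P /= (negbTE (out_off b)) (negbTE (in_off a)) => Ry.
    rewrite premut_Comp; apply: (@RW _ (m./2.+2)); first by rewrite uphalf_half; case: odd; lia.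
    have := Ract _ (val b); rewrite (eqP (valP b)); apply.
    by have := Ract _ (val a); rewrite (eqP (valP a)); apply.
  + rewrite /P /= eqxx (negbTE (in_off a)) premut_StarIn.
    case: m => [_ l x|m [u eu Ru]].
      by rewrite subn0 => dx; rewrite eval_depth ?zero_lfunE.
    rewrite [fk _]eu star_in_out; move=> l x dx; rewrite dsum_scaleE linearZ /= gammaE linear_sum /=.
    rewrite big1 ?scaler0 // => b _.
    apply: (RS m./2 _ _ _ _ _ _ (Ru b)) => //; first by apply: depth_dcyc2; apply/eqP; [apply: (valP a) | apply: (valP b)].
    exact: corner_dcyc2.
  rewrite /P /= eqxx (negbTE (out_off b)) => Ry.
  exists (@dsum_single _ _ (fun b : out_arrow Q k => M (hd (val b))) b (fo (hd (val b)) y)).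
    by rewrite -dsum_injE; apply: premut_StarOut.
  move=> b'; have [<-|ne] := eqVneq b b'; first by rewrite dsum_single_id.
  by rewrite dsum_single_neq //; apply: R0.
move=> m i y le; rewrite /P; case: ifP => [/eqP ik|/negbT ik Ry].
  case: m le => // m le [u eu Ru]; subst i; apply: fk_inj; rewrite [fk y]eu.
  suff -> : u = 0 by rewrite linear0.
  apply: dsum_eqP => b; rewrite [RHS]dsum_mkE -[u b]id_lfunE -(eval_idxx _ nilM).
  by apply: Ru => j w; rewrite (_ : d - _ = 0)%N //; apply/eqP; rewrite subn_eq0; lia.
apply: (from_off_eq0 ik); rewrite -[fo i y]id_lfunE -(eval_idxx _ nilM).
by apply: Ry => j w; rewrite (_ : d - _ = 0)%N //; apply/eqP; rewrite subn_eq0; lia.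
Qed.

Lemma premut_bracket_eval z i j y : i != k -> j != k ->
  fo i (eval X (bracket k z) i j y) = eval M z i j (fo j y).
Proof.
exact: (@bracket_eval K V Q k lf X M fo premut_nilpotent (proj1 modM) premut_Keep premut_Comp).
Qed.

(** Each kind of arrow has its own reason: kept arrows by transport of brackets; [[ba]] because
    [a^* b^*] acts as [- s] times [gamma] and [s * s = 1]; [a^*] because [star_out] kills the image
    of [beta]; [b^*] because [alpha] kills the image of [star_in]. *)
Lemma premut_rep_module : s * s = 1 -> is_module (premut_pot k s T) X.
Proof.
move=> ss; have nilX := premut_nilpotent; split=> // x i j.
have [nilM relM] := modM.
have s0 : s != 0 by apply/eqP => s0; move/eqP: ss; rewrite s0 mul0r eq_sym oner_eq0.
have cx : corner (tl x) (hd x) (dcyc x (premut_pot k s T)).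
  by apply: (@dcycs_corner _ _ _ _ x [::]); apply: premut_potential.
have [->|ne] := eqVneq i (tl x); last by rewrite (corner_eval_hd _ _ cx ne).
have [->|ne] := eqVneq j (hd x); last by rewrite (corner_eval_tl _ _ cx ne).
have arr_arr (f g : arrow Qm) l p y : tl f = hd g ->
    eval X (arr_el f * arr_el g) l p y = act1 X l f (hd g) (act1 X (hd g) g p y).
  move=> fg; rewrite eval_mul // (bigD1 (hd g)) //= big1 ?addr0 => [|q qg].
    by rewrite !eval_arr.
  by rewrite eval_arr // act1_tl ?zero_lfunE // fg eq_sym.
apply/lfunP => y; rewrite zero_lfunE {i j cx}; case: x y => [c|b a|a|b] y.
- have /andP[hk tk] := valP c; rewrite dcyc_Keep //; apply: (from_off_eq0 tk).
  by rewrite premut_bracket_eval // relM zero_lfunE.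
- rewrite dcyc_Comp // evalD evalZ add_lfunE scale_lfunE; apply: (from_off_eq0 (in_off a)).
  rewrite linearD linearZ /= premut_bracket_eval; [|exact: in_off|exact: out_off].
  rewrite arr_arr //.
  rewrite [act1 X _ (StarIn a) _](act1E X (StarIn a : arrow Qm)) premut_StarIn.
  rewrite [act1 X _ (StarOut b) _](act1E X (StarOut b : arrow Qm)) premut_StarOut.
  by rewrite star_in_out dsum_scaleE scalerA mulrN ss scaleN1r gamma_inj subrr.
- rewrite dcyc_StarIn evalZ scale_lfunE eval_sum sum_lfunE.
  apply: fk_inj; rewrite linearZ linear_sum /=.
  have -> : \sum_b fk (eval X (arr_el (StarOut b : arrow Qm) * arr_el (Comp b a : arrow Qm)) k (tl (val a)) y)
      = star_out s rho (beta k M (act1 M k (val a) (tl (val a)) (fo (tl (val a)) y))).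
    rewrite [beta _ _ _]dsum_decomp linear_sum; apply: eq_bigr => b _.
    rewrite arr_arr // [act1 X _ (StarOut b) _](act1E X (StarOut b : arrow Qm)) premut_StarOut.
    rewrite [act1 X _ (Comp b a) _](act1E X (Comp b a : arrow Qm)) premut_Comp /=.
    by rewrite betaE.
  have H := star_out_ker potT nok modM rhoK (beta k M (act1 M k (val a) (tl (val a)) (fo (tl (val a)) y))) s0.
  by rewrite (iffRL H) ?scaler0 //; eexists.
rewrite dcyc_StarOut evalZ scale_lfunE eval_sum sum_lfunE.
apply: (from_off_eq0 (out_off b)); rewrite linearZ linear_sum /=.
have -> : \sum_a fo (hd (val b)) (eval X (arr_el (Comp b a : arrow Qm) * arr_el (StarIn a : arrow Qm)) (hd (val b)) k y)
    = act1 M (hd (val b)) (val b) k (alpha k M (star_in sigma (fk y))).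
  rewrite alphaE linear_sum; apply: eq_bigr => a _.
  rewrite arr_arr // [act1 X _ (StarIn a) _](act1E X (StarIn a : arrow Qm)).
  rewrite [act1 X _ (Comp b a) _](act1E X (Comp b a : arrow Qm)) premut_Comp.
  by rewrite premut_StarIn.
have H := star_in_im potT nok modM sigmaK (star_in sigma (fk y)).
by rewrite (iffLR H) ?linear0 ?scaler0 //; eexists.
Qed.

End PremutModule.

(** * Pre-mutation of morphisms *)

Section TildeMaps.
Variables (K : fieldType) (V : finType) (Q : quiver V) (k : V).
Variables (T : cpa K Q) (M : rep K Q).
Variables (rho : 'Hom(Mout k M, ker_gamma k T M))
  (sigma : 'Hom(ker_alpha_mod k T M, ker_alpha k M)).
Hypotheses (potT : is_potential T) (nok : no_cycle_begins T k) (modM : is_module T M).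
Hypothesis rhoK : (rho \o vincl (lker (gamma k T M)))%VF = \1%VF.
Hypothesis sigmaK : (pi_map k T M \o sigma)%VF = \1%VF.
Local Notation gam := (gamma k T M).

Lemma gamma_im_beta u : u \in limg (beta k M) -> gam u = 0.
Proof. by move=> /memv_imgP[v _ ->]; apply: gamma_beta. Qed.

Lemma gamma_tildeE u : gamma_tilde k T M (qpi _ u) = vcores (limg gam) (gam u).
Proof.
rewrite /gamma_tilde qlift_qpi; first by rewrite comp_lfunE.
by move=> v /gamma_im_beta v0; rewrite comp_lfunE v0 linear0.
Qed.

Lemma rho_tildeE u : rho_tilde rho (qpi _ u) = qpi (im_beta_in_ker k T M) (rho u).
Proof.
rewrite /rho_tilde qlift_qpi; first by rewrite comp_lfunE.
move=> v vb; rewrite comp_lfunE; apply/eqP; rewrite qpi_eq0 -memv_preim vinclE.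
by rewrite (rhoE rhoK) //; apply: gamma_im_beta.
Qed.

Lemma i_tildeE w : i_tilde k T M (qpi _ w) = qpi (limg (beta k M)) (vsval w).
Proof.
rewrite /i_tilde qlift_qpi; first by rewrite comp_lfunE vinclE.
move=> v; rewrite -memv_preim vinclE => vb.
by apply/eqP; rewrite comp_lfunE vinclE qpi_eq0.
Qed.

Lemma tilde_decomp z :
  z = i_tilde k T M (rho_tilde rho z) + j_map rho (gamma_tilde k T M z).
Proof.
rewrite /j_map comp_lfunE add_lfunE opp_lfunE id_lfunE (comp_lfunE (i_tilde k T M)).
(* [z'] is the preimage chosen by [j_map]; the difference [z - z'] lies in the kernel of
   [gamma_tilde], where [rho_tilde] followed by [i_tilde] is the identity. *)
set z' := ((gamma_tilde k T M)^-1)%VF (gamma_tilde k T M z).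
have g0 : gamma_tilde k T M (z - z') = 0.
  by rewrite linearB /= limg_lfunVK ?subrr // memv_img // memvf.
suff E : i_tilde k T M (rho_tilde rho (z - z')) = z - z'.
  by move: E; rewrite !linearB /= addrCA => ->; rewrite addrC subrK.
rewrite -[z - z']qsecK in g0 *; move: (qsec _ _) g0 => u.
rewrite gamma_tildeE => /(congr1 vsval); rewrite vcoresE ?memv_img ?memvf // linear0 => g0.
by rewrite rho_tildeE i_tildeE (rhoE rhoK).
Qed.

Lemma vs_iota y : vsval (iota_map k T M y) = vsval y.
Proof.
rewrite /iota_map comp_lfunE vinclE vcoresE //.
by have /memv_imgP[u _ ->] := subvsP y; rewrite memv_ker alpha_gamma.
Qed.

Lemma vs_epsilon x : vsval (epsilon_map sigma x) = vsval x - vsval (sigma (qpi _ x)).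
Proof.
rewrite /epsilon_map 2!comp_lfunE vinclE add_lfunE opp_lfunE id_lfunE (comp_lfunE sigma).
rewrite vcoresE linearB //.
have : x - sigma (qpi (im_gamma_in_ker k T M) x) \in im_gamma_in_ker k T M.
  by rewrite -qpi_eq0 linearB /= (qpi_sigma sigmaK) subrr.
by rewrite -memv_preim vinclE linearB.
Qed.

End TildeMaps.

Section PremutHom.
Variables (K : fieldType) (V : finType) (Q : quiver V) (k : V).
Hypotheses (lf : forall a : arrow Q, tl a != hd a).
Variables (T : cpa K Q) (ch : premut_choice k T) (M N : rep K Q) (f : maps M N).

Lemma f_inE x a : f_in k f x a = f (tl (val a)) (x a).
Proof.
rewrite sum_lfunE dsum_sumE (bigD1 a) //= comp_lfunE dsum_injE dsum_single_id.
rewrite comp_lfunE dsum_projE big1 ?addr0 // => a' aa.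
by rewrite comp_lfunE dsum_injE dsum_single_neq.
Qed.

Lemma f_outE x b : f_out k f x b = f (hd (val b)) (x b).
Proof.
rewrite sum_lfunE dsum_sumE (bigD1 b) //= comp_lfunE dsum_injE dsum_single_id.
rewrite comp_lfunE dsum_projE big1 ?addr0 // => b' bb.
by rewrite comp_lfunE dsum_injE dsum_single_neq.
Qed.

Lemma f_out_inj b y : f_out k f (dsum_inj _ b y) = dsum_inj _ b (f (hd (val b)) y).
Proof.
rewrite dsum_injE (@dsum_injE _ _ (fun b : out_arrow Q k => N (hd (val b))) b).
apply: dsum_eqP => b'; rewrite f_outE; case: (b =P b') => [<-|/eqP ne].
  by rewrite !dsum_single_id.
by rewrite !dsum_single_neq // linear0.
Qed.

Lemma f_in_inj a y : f_in k f (dsum_inj _ a y) = dsum_inj _ a (f (tl (val a)) y).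
Proof.
rewrite dsum_injE (@dsum_injE _ _ (fun b : in_arrow Q k => N (tl (val b))) a).
apply: dsum_eqP => a'; rewrite f_inE; case: (a =P a') => [<-|/eqP ne].
  by rewrite !dsum_single_id.
by rewrite !dsum_single_neq // linear0.
Qed.

Lemma premut_hom_kE y : premut_hom_k ch f y =
  let iM := i_tilde k T M y.1.1 in let jM := j_map (ch_rho ch M) y.1.2 in
  let x := f_in_ker k f (iota_map k T M y.1.2) + f_in_ker k f (ch_sigma ch M y.2) in
  (rho_tilde (ch_rho ch N) (f_out_coker k f (iM + jM)),
   gamma_tilde k T N (f_out_coker k f iM) + epsilon_map (ch_sigma ch N) x,
   qpi (im_gamma_in_ker k T N) x).
Proof.
have [[e1 e2 e3] _] := Mbar_components 0 0 0 y.
rewrite /premut_hom_k !add_lfunE !comp_lfunE e1 e2 e3.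
have C1 u : Mbar_in1 k T N u = (u, 0, 0) by have [_ []] := Mbar_components u 0 0 (0 : Mbar k T N).
have C2 u : Mbar_in2 k T N u = (0, u, 0) by have [_ []] := Mbar_components 0 u 0 (0 : Mbar k T N).
have C3 u : Mbar_in3 k T N u = (0, 0, u) by have [_ []] := Mbar_components 0 0 u (0 : Mbar k T N).
rewrite !C1 !C2 !C3 /= !linearD /=.
by congr (_, _, _); rewrite /= ?addr0 ?add0r // -addrA.
Qed.

Hypotheses (potT : is_potential T) (nok : no_cycle_begins T k).
Hypotheses (modM : is_module T M) (modN : is_module T N) (hf : is_hom f).

Lemma f_in_gamma u : f_in k f (gamma k T M u) = gamma k T N (f_out k f u).
Proof.
apply: dsum_eqP => a; rewrite f_inE !gammaE linear_sum /=; apply: eq_bigr => b _.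
by rewrite f_outE; apply: hom_eval => //; [case: modM | case: modN].
Qed.

Lemma alpha_f_in x : alpha k N (f_in k f x) = f k (alpha k M x).
Proof.
rewrite !alphaE linear_sum; apply: eq_bigr => a _ /=.
by rewrite f_inE hom_act1.
Qed.

Lemma f_out_beta v : f_out k f (beta k M v) = beta k N (f k v).
Proof. by apply: dsum_eqP => b; rewrite f_outE !betaE hom_act1. Qed.

Lemma f_out_cokerE u : f_out_coker k f (qpi _ u) = qpi (limg (beta k N)) (f_out k f u).
Proof.
rewrite /f_out_coker qlift_qpi; first by rewrite comp_lfunE.
move=> v /memv_imgP[w _ ->]; apply/eqP.
by rewrite comp_lfunE qpi_eq0 f_out_beta memv_img // memvf.
Qed.

Lemma vs_f_in_ker x : vsval (f_in_ker k f x) = f_in k f (vsval x).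
Proof.
rewrite /f_in_ker comp_lfunE vcoresE; first by rewrite comp_lfunE vinclE.
rewrite comp_lfunE vinclE memv_ker alpha_f_in.
by have := subvsP x; rewrite memv_ker => /eqP ->; rewrite linear0.
Qed.

(** [f_out] maps the kernel of [gamma] into the kernel of [gamma], so the lower left entry of the
    upper 2 by 2 block of the matrix at [k] is 0. *)
Lemma gamma_f_out_i y : gamma_tilde k T N (f_out_coker k f (i_tilde k T M y)) = 0.
Proof.
rewrite -[y]qsecK i_tildeE f_out_cokerE gamma_tildeE // -f_in_gamma.
have := subvsP (qsec _ y); rewrite memv_ker => /eqP ->; by rewrite !linear0.
Qed.

Lemma star_in_hom_k y :
  star_in (ch_sigma ch N) (premut_hom_k ch f y) = f_in k f (star_in (ch_sigma ch M) y).
Proof.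
rewrite !star_inE premut_hom_kE /= gamma_f_out_i add0r.
rewrite vs_epsilon //; last exact: (ch_sigmaK ch N).
rewrite subrK linearD /= !vs_f_in_ker linearD /= vs_iota //.
Qed.

(** Up to the factor [- s], [star_out] splits the class of [u] modulo the image of [beta] into two
    blocks; [tilde_decomp] reassembles them, so the first row applies [f_out_coker] to that
    class. *)
Lemma hom_k_star_out s u : premut_hom_k ch f (star_out s (ch_rho ch M) u) =
  star_out s (ch_rho ch N) (f_out k f u).
Proof.
rewrite !star_outE premut_hom_kE /= gamma_f_out_i add0r.
have rM := ch_rhoK ch M; have rN := ch_rhoK ch N; have sN := ch_sigmaK ch N.
rewrite -(gamma_tildeE potT nok modM) -(gamma_tildeE potT nok modN).
rewrite -(rho_tildeE potT nok modM rM) -(rho_tildeE potT nok modN rN).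
rewrite !linearZ -scalerDr /= -(tilde_decomp potT nok modM rM) linear0 linear0 addr0.
rewrite !linearZ /= f_out_cokerE.
(* [x] lies in the image of [gamma]: it dies in the third block, and [epsilon_map] returns it
   unchanged in the second. *)
set x := f_in_ker k f _.
have ex : vsval x = gamma k T N (f_out k f u).
  by rewrite vs_f_in_ker vs_iota // gamma_tildeE // vcoresE ?memv_img ?memvf // f_in_gamma.
have q0 : qpi (im_gamma_in_ker k T N) x = 0.
  by apply/eqP; rewrite qpi_eq0 -memv_preim vinclE ex memv_img // memvf.
congr (_, _ *: _, _); last by rewrite q0 linear0.
apply/val_inj; rewrite /= vs_epsilon // q0 linear0 subr0 ex.
by rewrite gamma_tildeE // vcoresE ?memv_img ?memvf.
Qed.

Local Notation X := (premut_rep _ (ch_rho ch M) (ch_sigma ch M)).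
Local Notation Y := (premut_rep _ (ch_rho ch N) (ch_sigma ch N)).

Lemma pm_from_off s i y : from_off k N (Mbar k T N) i (premut_maps ch f s i y) =
  f i (from_off k M (Mbar k T M) i y).
Proof.
move: y; rewrite /premut_maps /from_off /=/mut_space; case: (i == k) => y.
  by rewrite !zero_lfunE linear0.
by rewrite !id_lfunE.
Qed.

Lemma pm_from_k s y : from_k k N (Mbar k T N) k (premut_maps ch f s k y) =
  premut_hom_k ch f (from_k k M (Mbar k T M) k y).
Proof.
move: y; rewrite /premut_maps /from_k /=/mut_space; case: (k =P k) => // _ y.
by rewrite !id_lfunE.
Qed.

Lemma premut_maps_hom s : is_hom (premut_maps ch f s).
Proof.
have fk_inj (y y' : mut_space k N (Mbar k T N) k) :
    from_k k N (Mbar k T N) k y = from_k k N (Mbar k T N) k y' -> y = y'.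
  by move=> e; rewrite -[y]from_kK e from_kK.
case=> [c|b a|a|b]; apply/lfunP => y; rewrite [LHS]comp_lfunE [RHS]comp_lfunE.
- have /andP[hk tk] := valP c; apply: (from_off_inj hk).
  rewrite pm_from_off (premut_Keep (Q := Q)) [RHS](premut_Keep (Q := Q)) pm_from_off.
  by have /lfunP := hf (val c) => /(_ (from_off k M (Mbar k T M) (tl (val c)) y)); rewrite !comp_lfunE.
- apply: (from_off_inj (out_off lf b)).
  by rewrite pm_from_off (premut_Comp lf) [RHS](premut_Comp lf) !hom_act1 // pm_from_off.
- apply: (from_off_inj (in_off lf a)).
  by rewrite pm_from_off (premut_StarIn lf) [RHS](premut_StarIn lf) pm_from_k star_in_hom_k f_inE.
apply: fk_inj.
by rewrite pm_from_k premut_StarOut [RHS]premut_StarOut hom_k_star_out f_out_inj pm_from_off.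
Qed.

End PremutHom.

(** * Morphisms confined to [k] and extension of morphisms across [k] *)

Section AddSimple.
Variables (K : fieldType) (V : finType) (Q : quiver V) (k : V).
Implicit Types (M N : rep K Q).

Lemma in_add_simple_off M N (d : maps M N) i : in_add_simple k d -> i != k -> d i = 0.
Proof.
case=> I [g] [h] [_ _ e] ik; rewrite e; apply/lfunP => v.
rewrite comp_lfunE zero_lfunE; have -> : g i v = 0; last exact: linear0.
apply/ffunP => l; rewrite ffunE; apply/rowP => -[j lt]; exfalso.
by move: lt; rewrite (negbTE ik).
Qed.

Hypothesis lf : forall a : arrow Q, tl a != hd a.

(** A morphism confined to [k] factors through its image at [k], on which every
    arrow acts by 0 since there is no loop at [k]. *)
Lemma off_in_add_simple M N (d : maps M N) :
  is_hom d -> (forall i, i != k -> d i = 0) -> in_add_simple k d.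
Proof.
move=> hd_ d0; pose U := limg (d k); pose B := vbasis U; pose I := 'I_(\dim U).
(* [g] takes coordinates in a basis of the image and [h] recombines them. The simple module has row
   vectors of length 1 at [k] and 0 elsewhere, so a constant row encodes a scalar at [k] and the sum
   over its entries decodes it. *)
pose g i : 'Hom(M i, copies I (simple K Q k) i) :=
  linfun (fun v => [ffun l : I => const_mx (coord B l (d k (id_at M k i v)))] : {ffun I -> 'rV[K]_(i == k)}).
pose h i : 'Hom(copies I (simple K Q k) i, N i) :=
  linfun (fun x : {ffun I -> 'rV[K]_(i == k)} => id_at N i k (\sum_l (\sum_j x l 0 j) *: B`_l)).
have linE (A C : vectType K) (F : A -> C) : linear F -> linfun F =1 F.
  move=> FL; pose L := GRing.isLinear.Build K _ _ _ F FL.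
  by pose F' : {linear A -> C} := HB.pack F L; exact: (lfunE F').
have gE i v : g i v = [ffun l : I => const_mx (coord B l (d k (id_at M k i v)))].
  apply: linE => c x y; apply/ffunP => l; apply/rowP => j.
  by rewrite !ffunE !mxE !linearP.
have hE i x : h i x = id_at N i k (\sum_l (\sum_j (x : {ffun I -> 'rV[K]_(i == k)}) l 0 j) *: B`_l).
  apply: linE => c {}x y; rewrite -linearP; congr (id_at N i k _).
  rewrite scaler_sumr -big_split; apply: eq_bigr => l _ /=.
  rewrite scalerA -scalerDl mulr_sumr -big_split; congr (_ *: _).
  by apply: eq_bigr => j _; rewrite !ffunE !mxE.
exists I, g, h; split.
- move=> a; apply/lfunP => v; rewrite [LHS]comp_lfunE [RHS]comp_lfunE gE copiesE.
  apply/ffunP => l; rewrite !ffunE; have -> : rmap (simple K Q k) a = 0 by [].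
  rewrite zero_lfunE; have -> : d k (id_at M k (hd a) (rmap M a v)) = 0.
    rewrite -act1E -[id_at _ _ _ _]comp_lfunE id_act1 hom_act1 //.
    have [e|ne] := eqVneq (tl a) k; last by rewrite d0 // zero_lfunE linear0.
    by rewrite act1_hd ?zero_lfunE // -e eq_sym lf.
  by apply/rowP => j; rewrite linear0 !mxE.
- move=> a; apply/lfunP => x; rewrite [LHS]comp_lfunE [RHS]comp_lfunE copiesE !hE.
  have -> : rmap (simple K Q k) a = 0 by [].
  rewrite big1 ?linear0 => [|l _]; last first.
    by rewrite big1 ?scale0r // => j _; rewrite ffunE zero_lfunE mxE.
  rewrite -act1E -[RHS]comp_lfunE act1_id linear_sum big1 // => l _ /=.
  rewrite linearZ /=; have /memv_imgP[u _ ->] : B`_l \in U.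
    by apply: vbasis_mem; apply: mem_nth; rewrite size_tuple.
  suff -> : act1 N (hd a) a k (d k u) = 0 by rewrite scaler0.
  have [e|ne] := eqVneq (tl a) k; last by rewrite act1_tl // zero_lfunE.
  by rewrite -hom_act1 // d0 ?zero_lfunE // -e eq_sym lf.
move=> i; rewrite /comp_maps; apply/lfunP => v; rewrite comp_lfunE hE gE.
case: (i =P k) v => [->|/eqP ne] v; last by rewrite id_at_neq 1?eq_sym // d0 // !zero_lfunE.
rewrite id_atxx id_lfunE [LHS](coord_vbasis (memv_img (d k) (memvf v))).
apply: eq_bigr => l _; congr (_ *: _); rewrite !ffunE id_atxx id_lfunE.
under eq_bigr => j _ do rewrite mxE.
by rewrite sumr_const card_ord.
Qed.

Lemma eq_mod_simple_offk M N (f g : maps M N) :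
  is_hom f -> is_hom g -> (forall i, i != k -> f i = g i) -> eq_mod_simple k f g.
Proof.
move=> hf hg fg; apply: off_in_add_simple => [a|i ik]; last by rewrite fg // subrr.
by rewrite comp_lfunDl comp_lfunNl hf hg comp_lfunDr comp_lfunNr.
Qed.

End AddSimple.

(** On the image of [aX] the map is forced; on a complement any lift of [bX] through [bY] will do.
    The last hypothesis makes the forced part compatible with [bX]. *)
Lemma lift_factor (K : fieldType) (U X Y W : vectType K)
    (aX : 'Hom(U, X)) (aY : 'Hom(U, Y)) (bX : 'Hom(X, W)) (bY : 'Hom(Y, W)) :
    (forall x, aX x = 0 -> aY x = 0) -> (forall v, exists w, bY w = bX v) ->
    (forall x, bY (aY x) = bX (aX x)) ->
  exists eta : 'Hom(X, Y), (forall x, eta (aX x) = aY x) /\ forall v, bY (eta v) = bX v.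
Proof.
move=> ka ib ba; pose P := projv (limg aX).
have Pim v : P v \in limg aX by apply: memv_proj.
have aV v : v \in limg aX -> aX (aX^-1%VF v) = v by apply: limg_lfunVK.
have bV v : bY (bY^-1%VF (bX v)) = bX v.
  by have [w <-] := ib v; rewrite limg_lfunVK // memv_img // memvf.
exists ((aY \o aX^-1 \o P)%VF + (bY^-1 \o bX \o (\1 - P))%VF); split=> [x|v].
  rewrite add_lfunE !comp_lfunE add_lfunE opp_lfunE id_lfunE.
  rewrite projv_id ?memv_img ?memvf // subrr !linear0 addr0.
  apply/eqP; rewrite -subr_eq0 -linearB; apply/eqP/ka.
  by rewrite linearB /= aV ?subrr // memv_img // memvf.
rewrite add_lfunE !comp_lfunE add_lfunE opp_lfunE id_lfunE linearD /= ba aV // bV.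
by rewrite -linearD addrC subrK.
Qed.

Section ExtendHom.
Variables (K : fieldType) (V : finType) (Q : quiver V) (k : V).
Hypothesis lf : forall a : arrow Q, tl a != hd a.
Variables (X Y : rep K Q) (u : maps X Y).
Hypothesis uoff : forall c : arrow Q, hd c != k -> tl c != k ->
  forall y, u (hd c) (rmap X c y) = rmap Y c (u (tl c) y).
Hypothesis u_ker : forall x : (forall a : in_arrow Q k, X (tl (val a))),
  \sum_a act1 X k (val a) (tl (val a)) (x a) = 0 ->
  \sum_a act1 Y k (val a) (tl (val a)) (u (tl (val a)) (x a)) = 0.
Hypothesis u_im : forall v, exists w, forall b : out_arrow Q k,
  act1 Y (hd (val b)) (val b) k w = u (hd (val b)) (act1 X (hd (val b)) (val b) k v).
Hypothesis u_comp : forall (b : out_arrow Q k) (a : in_arrow Q k) y,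
  act1 Y (hd (val b)) (val b) k (act1 Y k (val a) (tl (val a)) (u (tl (val a)) y)) =
  u (hd (val b)) (act1 X (hd (val b)) (val b) k (act1 X k (val a) (tl (val a)) y)).

(** Without loops the neighbours of [k] are off [k], so the conditions at [k] are the two equations
    of [lift_factor], for [alpha] and for [beta]. *)
Lemma extend_hom : exists2 eta : maps X Y, is_hom eta & forall i, i != k -> eta i = u i.
Proof.
have [e [ea eb]] : exists e : 'Hom(X k, Y k),
    (forall x, e (alpha k X x) = alpha k Y (f_in k u x)) /\
    (forall v, beta k Y (e v) = f_out k u (beta k X v)).
  have := @lift_factor K _ _ _ _ (alpha k X) (alpha k Y \o f_in k u)%VF (f_out k u \o beta k X)%VF (beta k Y).
  case=> [x|v|x|e [e1 e2]].
  - rewrite alphaE comp_lfunE alphaE => /u_ker; congr (_ = _).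
    by apply: eq_bigr => a _; rewrite f_inE.
  - have [w wE] := u_im v; exists w; apply: dsum_eqP => b.
    by rewrite comp_lfunE f_outE !betaE wE.
  - rewrite !comp_lfunE; apply: dsum_eqP => b; rewrite f_outE !betaE !alphaE !linear_sum /=.
    by apply: eq_bigr => a _ /=; rewrite f_inE u_comp.
  by exists e; split=> [x|v]; rewrite ?e1 ?e2 comp_lfunE.
exists (fun i => if i == k then (id_at Y i k \o (e \o id_at X k i))%VF else u i); last first.
  by move=> i /negbTE ->.
move=> a; apply/lfunP => y; rewrite [LHS]comp_lfunE [RHS]comp_lfunE.
have [hk|hk] := eqVneq (hd a) k.
  have tk : tl a != k by rewrite -hk lf.
  have E : id_at X k (hd a) (rmap X a y) = act1 X k a (tl a) y.
    by rewrite -act1E -[LHS]comp_lfunE id_act1.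
  rewrite (negbTE tk) 2!comp_lfunE E.
  pose a0 : in_arrow Q k := exist _ a (introT eqP hk).
  rewrite -(@alpha_inj _ _ _ _ X a0) ea.
  rewrite f_in_inj.
  by rewrite alpha_inj -[LHS]comp_lfunE cast_act1 // act1E.
have [tk|tk] := eqVneq (tl a) k; last exact: uoff.
pose b0 : out_arrow Q k := exist _ a (introT eqP tk).
have E z : rmap Y a (id_at Y (tl a) k z) = act1 Y (hd a) a k z.
  by rewrite /act1 id_atxx comp_lfun1l comp_lfunE.
rewrite 2!comp_lfunE E.
have := eb (id_at X k (tl a) y) => /(congr1 (fun z : Mout k Y => z b0)).
rewrite betaE f_outE betaE => ->; congr (u _ _).
by rewrite -[RHS]comp_lfunE act1_cast // act1E.
Qed.

End ExtendHom.

(** * Double mutation *)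

Section PremutFamilies.
Variables (K : fieldType) (V : finType) (Q : quiver V) (k : V).
Hypotheses (lf : forall a : arrow Q, tl a != hd a).
Variables (T : cpa K Q) (M : rep K Q) (s : K).
Variables (rho : 'Hom(Mout k M, ker_gamma k T M))
  (sigma : 'Hom(ker_alpha_mod k T M, ker_alpha k M)).
Local Notation Qm := (premut Q k).
Local Notation X := (premut_rep s rho sigma).
Local Notation fo := (from_off k M (Mbar k T M)).
Local Notation fk := (from_k k M (Mbar k T M) k).
Hypotheses (potT : is_potential T) (nok : no_cycle_begins T k) (modM : is_module T M).
Hypothesis rhoK : (rho \o vincl (lker (gamma k T M)))%VF = \1%VF.
Hypothesis sigmaK : (pi_map k T M \o sigma)%VF = \1%VF.

(** This lemma and the next two restate kernel, image and composite of the starred arrows for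
    families indexed by arrows, a form that can be used for both mutations. *)
Lemma sum_StarOut_eq0 (z : forall b : out_arrow Q k, X (hd (val b))) : s != 0 ->
  \sum_b (rmap X (StarOut b : arrow Qm) (z b) : X k) = 0 <->
  exists m, forall b : out_arrow Q k, act1 M (hd (val b)) (val b) k m = fo (hd (val b)) (z b).
Proof.
move=> s0; pose U : Mout k M := dsum_mk (fun b : out_arrow Q k => fo (hd (val b)) (z b)).
have E : fk (\sum_b (rmap X (StarOut b : arrow Qm) (z b) : X k)) = star_out s rho U.
  rewrite linear_sum [U]dsum_decomp linear_sum; apply: eq_bigr => b _ /=.
  by rewrite [LHS]premut_StarOut [in RHS]dsum_mkE.
have H := star_out_ker potT nok modM rhoK U s0; split=> [e|[m mE]].
  move: E; rewrite e linear0 => /esym/H[m mU]; exists m => b.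
  by rewrite -betaE mU dsum_mkE.
apply: fk_inj; rewrite E; apply/H; exists m; apply: dsum_eqP => b.
by rewrite betaE mE dsum_mkE.
Qed.

Lemma StarIn_im (x : forall a : in_arrow Q k, M (tl (val a))) :
  (exists y : X k, forall a, fo (tl (val a)) (rmap X (StarIn a : arrow Qm) y) = x a) <->
  \sum_a act1 M k (val a) (tl (val a)) (x a) = 0.
Proof.
pose x' : Min k M := dsum_mk x.
have E : alpha k M x' = \sum_a act1 M k (val a) (tl (val a)) (x a).
  by rewrite alphaE; apply: eq_bigr => a _; rewrite dsum_mkE.
have H := star_in_im potT nok modM sigmaK x'; rewrite -E -H; split=> [[y yE]|[y yE]].
  exists (fk y); apply: dsum_eqP => a.
  by have := yE a; rewrite (premut_StarIn lf) => ->; rewrite dsum_mkE.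
exists (to_k k M _ k y) => a; rewrite (premut_StarIn lf) to_kK yE.
by rewrite dsum_mkE.
Qed.

Lemma StarIn_StarOut (b : out_arrow Q k) (a : in_arrow Q k) y :
  fo (tl (val a)) (rmap X (StarIn a : arrow Qm) (rmap X (StarOut b : arrow Qm) y)) =
  - s *: eval M (dcyc2 (val b) (val a) T) (tl (val a)) (hd (val b)) (fo (hd (val b)) y).
Proof.
rewrite (premut_StarIn lf) premut_StarOut star_in_out.
by rewrite dsum_scaleE gamma_inj.
Qed.

End PremutFamilies.

Section DoubleArrows.
Variables (V : finType) (Q : quiver V) (k : V).
Hypothesis lf : forall a : arrow Q, tl a != hd a.
Local Notation Qm := (premut Q k).

Lemma out_premutP (o : out_arrow Qm k) : exists a, o = star_in_arrow a.
Proof.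
have [a e] := premut_tl_k lf (eqP (valP o)); exists a; exact/val_inj.
Qed.

Lemma in_premutP (i : in_arrow Qm k) : exists b, i = star_out_arrow b.
Proof.
have [b e] := premut_hd_k lf (eqP (valP i)); exists b; exact/val_inj.
Qed.

Lemma big_out_premut (R : nmodType) (F : out_arrow Qm k -> R) :
  \sum_o F o = \sum_a F (star_in_arrow a).
Proof.
rewrite (reindex_omap (@star_in_arrow _ Q k) (fun o => if (val o : premut_arrow Q k) is StarIn a then Some a else None)).
  by apply: eq_bigl => a; rewrite /= eqxx.
by move=> o _; have [a ->] := out_premutP o.
Qed.

Lemma big_in_premut (R : nmodType) (F : in_arrow Qm k -> R) :
  \sum_i F i = \sum_b F (star_out_arrow b).
Proof.
rewrite (reindex_omap (@star_out_arrow _ Q k) (fun i => if (val i : premut_arrow Q k) is StarOut b then Some b else None)).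
  by apply: eq_bigl => b; rewrite /= eqxx.
by move=> i _; have [b ->] := in_premutP i.
Qed.

Lemma arrowP (c : arrow Q) : [\/ exists a : in_arrow Q k, c = val a,
  exists b : out_arrow Q k, c = val b | exists c' : off_arrow Q k, c = val c'].
Proof.
have [hk|hk] := boolP (hd c == k); first by apply: Or31; exists (exist _ c hk).
have [tk|tk] := boolP (tl c == k); first by apply: Or32; exists (exist _ c tk).
have ck : (hd c != k) && (tl c != k) by rewrite hk.
by apply: Or33; exists (exist _ c ck).
Qed.

Variable K : fieldType.
Local Notation Qmm := (premut Qm k).

Lemma double_star_in (a : in_arrow Q k) :
  double_star K k (val a) = arr_el (StarOut (star_in_arrow a) : arrow Qmm).
Proof. by rewrite /double_star valK. Qed.

Lemma double_star_out (b : out_arrow Q k) :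
  double_star K k (val b) = arr_el (StarIn (star_out_arrow b) : arrow Qmm).
Proof.
rewrite /double_star insubN ?valK //.
by have := lf (val b); rewrite (eqP (valP b)) eq_sym.
Qed.

Lemma double_star_off (c : off_arrow Q k) :
  double_star K k (val c) = arr_el (Keep (keep_arrow c) : arrow Qmm).
Proof.
by have /andP[hk tk] := valP c; rewrite /double_star insubN // insubN // valK.
Qed.

Lemma double_star_corner (c : arrow Q) : corner (hd c) (tl c) (double_star K k c).
Proof.
case: (arrowP c) => [[a ->]|[b ->]|[d ->]].
- rewrite double_star_in (eqP (valP a)); exact: (corner_arr K (StarOut (star_in_arrow a) : arrow Qmm)).
- rewrite double_star_out (eqP (valP b)); exact: (corner_arr K (StarIn (star_out_arrow b) : arrow Qmm)).
- rewrite double_star_off; exact: (corner_arr K (Keep (keep_arrow d) : arrow Qmm)).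
Qed.

Lemma double_star_depth (c : arrow Q) : depth 1 (double_star K k c).
Proof.
by case: (arrowP c) => [[a ->]|[b ->]|[d ->]];
  rewrite ?double_star_in ?double_star_out ?double_star_off; apply: depth_mono.
Qed.

End DoubleArrows.

(** * Mutating back a module over the mutated potential *)

Section BackMutation.
Variables (K : fieldType) (V : finType) (Q : quiver V) (k : V).
Hypotheses (lf : forall a : arrow Q, tl a != hd a) (no2 : no_2cycle_at Q k).
Variable S : cpa K Q.
Hypotheses (potS : is_potential S) (nok : no_cycle_begins S k).
Local Notation Qm := (premut Q k).
Local Notation Sm := (premut_pot k 1 S).
Variable Y : rep K Qm.
Hypothesis modY : is_module Sm Y.
Variables (rho : 'Hom(Mout k Y, ker_gamma k Sm Y))
  (sigma : 'Hom(ker_alpha_mod k Sm Y, ker_alpha k Y)).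
Hypothesis rhoK : (rho \o vincl (lker (gamma k Sm Y)))%VF = \1%VF.
Hypothesis sigmaK : (pi_map k Sm Y \o sigma)%VF = \1%VF.
Local Notation Z := (premut_rep (-1) rho sigma).

Definition back_rep : rep K Q := pullback (double_star K k) Z.
Local Notation G := back_rep.

Definition back_off i : 'Hom(G i, Y i) := from_off k Y (Mbar k Sm Y) i.
Local Notation w := back_off.

Let lfm : forall c : arrow Qm, tl c != hd c := premut_loopfree lf no2.
Let potm : is_potential Sm := premut_potential (s := 1) potS.
Let nokm : no_cycle_begins Sm k := premut_nok (s := 1) lf nok.

Let nilZ : nilpotent Z.
Proof. exact: (premut_nilpotent lfm (premut_no2 lf no2) _ _ _ potm modY). Qed.

Lemma back_act_in (a : in_arrow Q k) y : act1 G k (val a) (tl (val a)) y =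
  rmap Z (StarOut (star_in_arrow a) : arrow (premut Qm k)) y.
Proof.
rewrite [act1 G _ _ _](pullback_act1 Z _ _ (double_star_corner k lf K _)).
rewrite double_star_in eval_arr //.
by rewrite -[in RHS]act1E.
Qed.

Lemma back_act_out (b : out_arrow Q k) y : act1 G (hd (val b)) (val b) k y =
  rmap Z (StarIn (star_out_arrow b) : arrow (premut Qm k)) y.
Proof.
rewrite [act1 G _ _ _](pullback_act1 Z _ _ (double_star_corner k lf K _)).
rewrite (double_star_out lf) eval_arr //.
by rewrite -[in RHS]act1E.
Qed.

Lemma back_rmap_off (c : off_arrow Q k) y : rmap G (val c) y =
  rmap Z (Keep (keep_arrow c) : arrow (premut Qm k)) y.
Proof.
rewrite -[rmap G _]act1E [act1 G _ _ _](pullback_act1 Z _ _ (double_star_corner k lf K _)).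
rewrite (double_star_off _ c) eval_arr //.
by rewrite -[in RHS]act1E.
Qed.

Lemma back_off_arrow (c : off_arrow Q k) y :
  w (hd (val c)) (rmap G (val c) y) = rmap Y (Keep c : arrow Qm) (w (tl (val c)) y).
Proof. by rewrite back_rmap_off [LHS](premut_Keep (c := keep_arrow c)). Qed.

(** Incoming and outgoing arrows have exchanged roles: [a] acts as [a^**], and the [a^*] are the
    arrows of the mutated quiver leaving [k]. In [back_out_im] the [b^*] enter [k]. *)
Lemma back_in_eq0 (x : forall a : in_arrow Q k, G (tl (val a))) :
  \sum_a act1 G k (val a) (tl (val a)) (x a) = 0 <->
  exists y : Y k, forall a : in_arrow Q k, rmap Y (StarIn a : arrow Qm) y = w (tl (val a)) (x a).
Proof.
(* Every arrow leaving [k] is some [a^*], so the default 0 is never reached; the match gives the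
   family its dependent type. *)
pose z (o : out_arrow Qm k) : Z (hd (val o)) :=
  match val o as c return Z (premut_hd c) with StarIn a => x a | _ => 0 end.
have N1 : - 1 != 0 :> K by rewrite oppr_eq0 oner_eq0.
have := sum_StarOut_eq0 (sigma := sigma) potm nokm modY rhoK z N1.
rewrite (big_out_premut lf) => H.
rewrite (eq_bigr _ (fun a _ => back_act_in (x a))) [X in X <-> _]H; split=> [[m mE]|[y yE]].
  exists m => a; have := mE (star_in_arrow a); rewrite -act1E; exact.
exists y => o; have [a ->] := out_premutP lf o; rewrite -yE -act1E; reflexivity.
Qed.

Lemma back_out_im (z : forall b : out_arrow Q k, Y (hd (val b))) :
  (exists g : G k, forall b, w (hd (val b)) (act1 G (hd (val b)) (val b) k g) = z b) <->
  \sum_b (rmap Y (StarOut b : arrow Qm) (z b) : Y k) = 0.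
Proof.
pose x (i : in_arrow Qm k) : Y (tl (val i)) :=
  match val i as c return Y (premut_tl c) with StarOut b => z b | _ => 0 end.
have := StarIn_im lfm (-1) rho potm nokm modY sigmaK x.
rewrite (big_in_premut lf) => H.
split=> [[g gE]|/esym e].
  transitivity (\sum_b act1 Y k (val (star_out_arrow b)) (tl (val (star_out_arrow b))) (x (star_out_arrow b))).
    by apply: eq_bigr => b _; rewrite -act1E.
  apply/H; exists g => i; have [b ->] := in_premutP lf i.
  by rewrite -[RHS]gE back_act_out.
have /H[g gE] : \sum_b act1 Y k (val (star_out_arrow b)) (tl (val (star_out_arrow b))) (x (star_out_arrow b)) = 0.
  by rewrite [RHS]e; apply: eq_bigr => b _; rewrite -[in RHS]act1E.
exists g => b; rewrite back_act_out; exact: (gE (star_out_arrow b)).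
Qed.

Lemma back_comp (b : out_arrow Q k) (a : in_arrow Q k) y :
  w (hd (val b)) (act1 G (hd (val b)) (val b) k (act1 G k (val a) (tl (val a)) y)) =
  rmap Y (Comp b a : arrow Qm) (w (tl (val a)) y).
Proof.
rewrite back_act_in back_act_out.
rewrite [LHS](@StarIn_StarOut _ _ _ _ lfm _ _ _ _ _ (star_in_arrow a) (star_out_arrow b)).
rewrite [dcyc2 _ _ _](dcyc2_stars 1 S a b) opprK !scale1r eval_arr; last by case: modY.
by rewrite -[in RHS]act1E.
Qed.

Lemma back_nilpotent : nilpotent G.
Proof.
by apply: (@nilpotent_pullback K V Q _ (double_star K k) Z nilZ) => c; [apply: double_star_corner | apply: double_star_depth].
Qed.

Definition from_back i : 'Hom(Y i, G i) := to_off k Y (Mbar k Sm Y) i.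

Lemma from_backK i y : i != k -> w i (from_back i y) = y.
Proof. exact: to_offK. Qed.

Lemma back_offK i y : i != k -> from_back i (w i y) = y.
Proof. exact: from_offK. Qed.

(** The maps [w] point the wrong way for [bracket_eval], which is applied to their inverses off
    [k]. *)
Lemma back_bracket_eval z i j y : i != k -> j != k ->
  w i (eval G z i j y) = eval Y (bracket k z) i j (w j y).
Proof.
move=> ik jk; rewrite -{1}[y]back_offK //.
rewrite -(@bracket_eval K V Q k lf Y G from_back (proj1 modY) back_nilpotent) ?from_backK //.
- move=> c u; have /andP[hk tk] := valP c.
  rewrite -[RHS]back_offK // back_off_arrow from_backK //.
- move=> b a u; rewrite -[RHS]back_offK ?(out_off lf) // back_comp.
  by rewrite from_backK ?(in_off lf).
Qed.

(** This is the relation of [Y] given by the derivative along [[ba]]. *)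
Lemma premut_Comp_rel (b : out_arrow Q k) (a : in_arrow Q k) y :
  eval Y (bracket k (dcyc2 (val b) (val a) S)) (tl (val a)) (hd (val b)) y =
  - rmap Y (StarIn a : arrow Qm) (rmap Y (StarOut b : arrow Qm) y).
Proof.
have [nilY relY] := modY.
have := relY (Comp b a : arrow Qm) (tl (val a)) (hd (val b)).
rewrite dcyc_Comp // scale1r evalD => /lfunP/(_ y).
rewrite add_lfunE zero_lfunE eval_arr_mul // => /eqP; rewrite addr_eq0 => /eqP ->.
by rewrite eval_arr // [act1 Y _ (StarIn a) _](act1E Y (StarIn a : arrow Qm))
     [act1 Y _ (StarOut b) _](act1E Y (StarOut b : arrow Qm)).
Qed.

(** Off [k] the derivative of [S] along [ba] acts as minus [a^* b^*]. For [a], the sum of the [b^*]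
    over a family coming from [k] is 0; for [b], the resulting family has the form [a^* y], which
    the arrows [a] kill. A kept arrow has the bracketed relation. *)
Lemma back_module : is_module S G.
Proof.
have nilG := back_nilpotent; have [nilY relY] := modY; split=> // x i j.
have cx : corner (tl x) (hd x) (dcyc x S) by apply: (@dcycs_corner _ _ _ _ x [::]).
have [->|ne] := eqVneq i (tl x); last by rewrite (corner_eval_hd _ _ cx ne).
have [->|ne] := eqVneq j (hd x); last by rewrite (corner_eval_tl _ _ cx ne).
apply/lfunP => y; rewrite zero_lfunE {i j cx}.
case: (arrowP k x) y => [[a ->]|[b ->]|[c ->]] y.
- apply: (from_off_eq0 (in_off lf a)); rewrite -/(w _).
  move: y; rewrite (eqP (valP a)) dcyc_in // => y.
  have H := back_out_im (fun b : out_arrow Q k => w (hd (val b)) (act1 G (hd (val b)) (val b) k y)).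
  rewrite eval_sum sum_lfunE linear_sum.
  transitivity (- rmap Y (StarIn a : arrow Qm) (\sum_b (rmap Y (StarOut b : arrow Qm)
      (w (hd (val b)) (act1 G (hd (val b)) (val b) k y)) : Y k))); last first.
    by rewrite (iffLR H) ?linear0 ?oppr0 //; exists y.
  rewrite linear_sum -sumrN; apply: eq_bigr => b _.
  by rewrite [eval G _ _ _ _](eval_mul_arr nilG) [LHS]back_bracket_eval ?premut_Comp_rel //; [apply: in_off | apply: out_off].
- move: y; rewrite (eqP (valP b)) dcyc_out // => y; rewrite eval_sum sum_lfunE.
  have H := back_in_eq0 (fun a : in_arrow Q k =>
    eval G (dcyc2 (val b) (val a) S) (tl (val a)) (hd (val b)) y).
  rewrite (eq_bigr _ (fun a _ => eval_arr_mul nilG _ _ _ y)); apply/H.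
  exists (- rmap Y (StarOut b : arrow Qm) (w (hd (val b)) y)) => a.
  by rewrite back_bracket_eval ?premut_Comp_rel ?linearN //; [apply: in_off | apply: out_off].
have /andP[hk tk] := valP c; apply: (from_off_eq0 tk); rewrite -/(w _).
by rewrite [LHS]back_bracket_eval // -(dcyc_Keep 1) // relY zero_lfunE.
Qed.

End BackMutation.

Section ExtendIso.
Variables (K : fieldType) (V : finType) (Q : quiver V) (k : V).
Hypothesis lf : forall a : arrow Q, tl a != hd a.
Variables (X Y : rep K Q) (u : maps X Y) (v : maps Y X).
Hypotheses (uv : forall i y, i != k -> u i (v i y) = y).
Hypotheses (vu : forall i y, i != k -> v i (u i y) = y).
Hypothesis uoff : forall (c : off_arrow Q k) y,
  u (hd (val c)) (rmap X (val c) y) = rmap Y (val c) (u (tl (val c)) y).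
Hypothesis u_ker : forall x : (forall a : in_arrow Q k, X (tl (val a))),
  \sum_a act1 X k (val a) (tl (val a)) (x a) = 0 <->
  \sum_a act1 Y k (val a) (tl (val a)) (u (tl (val a)) (x a)) = 0.
Hypothesis u_im : forall z : (forall b : out_arrow Q k, X (hd (val b))),
  (exists m, forall b, act1 X (hd (val b)) (val b) k m = z b) <->
  (exists m, forall b, act1 Y (hd (val b)) (val b) k m = u (hd (val b)) (z b)).
Hypothesis u_comp : forall (b : out_arrow Q k) (a : in_arrow Q k) y,
  act1 Y (hd (val b)) (val b) k (act1 Y k (val a) (tl (val a)) (u (tl (val a)) y)) =
  u (hd (val b)) (act1 X (hd (val b)) (val b) k (act1 X k (val a) (tl (val a)) y)).

(** The hypotheses are equivalences, so [extend_hom] applies in both directions. The two extensions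
    need not be inverse at [k], which is invisible modulo [add S_k]. *)
Lemma extend_iso : exists (eta : maps X Y) (eta' : maps Y X),
  [/\ is_hom eta, is_hom eta', forall i, i != k -> eta i = u i &
      forall i, i != k -> eta' i = v i].
Proof.
have uoff' (c : arrow Q) : hd c != k -> tl c != k ->
    forall y, u (hd c) (rmap X c y) = rmap Y c (u (tl c) y).
  move=> hc tc; have ck : (hd c != k) && (tl c != k) by rewrite hc.
  exact: (@uoff (exist _ c ck)).
have [eta heta etaE] : exists2 eta : maps X Y, is_hom eta & forall i, i != k -> eta i = u i.
  apply: (extend_hom lf uoff' _ _ u_comp) => [x /u_ker //|m].
  by apply/(u_im (fun b : out_arrow Q k => act1 X (hd (val b)) (val b) k m)); exists m.
have [eta' heta' etaE'] : exists2 eta' : maps Y X, is_hom eta' & forall i, i != k -> eta' i = v i.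
  apply: (extend_hom lf) => [c hc tc y|x x0|m|b a y].
  - by rewrite -{1}[y]uv // -uoff' // vu.
  - apply/u_ker; rewrite -[RHS]x0; apply: eq_bigr => a _; rewrite uv //.
    exact: in_off.
  - apply/(u_im (fun b : out_arrow Q k => v (hd (val b)) (act1 Y (hd (val b)) (val b) k m))).
    by exists m => b; rewrite uv //; apply: out_off.
  - have ob := out_off lf b; have oa := in_off lf a.
    by rewrite -[LHS]vu // -u_comp uv.
by exists eta, eta'.
Qed.

End ExtendIso.

(** * The two composites of pre-mutations *)

Section BackForth.
Variables (K : fieldType) (V : finType) (Q : quiver V) (k : V).
Hypotheses (lf : forall a : arrow Q, tl a != hd a) (no2 : no_2cycle_at Q k).
Variable S : cpa K Q.
Hypotheses (potS : is_potential S) (nok : no_cycle_begins S k).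
Local Notation Qm := (premut Q k).
Local Notation Sm := (premut_pot k 1 S).
Local Notation foff N := (from_off k N (Mbar k _ N)).
Local Notation toff N := (to_off k N (Mbar k _ N)).

Section Back.
Variables (M : rep K Q) (rho : 'Hom(Mout k M, ker_gamma k S M))
  (sigma : 'Hom(ker_alpha_mod k S M, ker_alpha k M)).
Hypothesis modM : is_module S M.
Hypothesis rhoK : (rho \o vincl (lker (gamma k S M)))%VF = \1%VF.
Hypothesis sigmaK : (pi_map k S M \o sigma)%VF = \1%VF.
(** In the composite of the functors, the intermediate module has the spaces of the pre-mutation,
    but its arrows act through [phi_r] and [phi_r_inv]: the maps agree by a proof, not by
    computation. Hence a variable [r] with an equation. *)
Variable r : forall c : arrow Qm,
  'Hom(mut_space k M (Mbar k S M) (tl c), mut_space k M (Mbar k S M) (hd c)).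
Hypothesis rE : r = premut_rmap 1 rho sigma.
Local Notation Y := (@Rep K V Qm (mut_space k M (Mbar k S M)) r).
Variables (rho' : 'Hom(Mout k Y, ker_gamma k Sm Y))
  (sigma' : 'Hom(ker_alpha_mod k Sm Y, ker_alpha k Y)).
Hypothesis rhoK' : (rho' \o vincl (lker (gamma k Sm Y)))%VF = \1%VF.
Hypothesis sigmaK' : (pi_map k Sm Y \o sigma')%VF = \1%VF.

Lemma back_forth_iso : exists (eta : maps (back_rep rho' sigma') M)
    (eta' : maps M (back_rep rho' sigma')),
  [/\ is_hom eta, is_hom eta',
      forall i, i != k -> eta i = (from_off k M (Mbar k S M) i \o back_off rho' sigma' i)%VF &
      forall i, i != k -> eta' i = (from_back rho' sigma' i \o to_off k M (Mbar k S M) i)%VF].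
Proof.
subst r; have ss : 1 * 1 = 1 :> K by rewrite mulr1.
have modY := premut_rep_module lf no2 potS nok modM rhoK sigmaK ss.
have n0 : 1 != 0 :> K by apply: oner_neq0.
apply: (extend_iso lf) => [i y ik|i y ik|c y|x|z|b a y].
- by rewrite !comp_lfunE from_backK // to_offK.
- by rewrite !comp_lfunE from_offK // back_offK.
- by rewrite !comp_lfunE (back_off_arrow lf no2 potS modY) [LHS]premut_Keep.
- rewrite (back_in_eq0 lf no2 potS nok modY rhoK') -(StarIn_im lf 1 rho potS nok modM sigmaK).
  split=> [[y yE]|[y yE]]; exists y => a; first by rewrite comp_lfunE -yE.
  by apply: (from_off_inj (in_off lf a) (etrans (yE a) _)); rewrite comp_lfunE.
- pose z' (b : out_arrow Q k) := back_off rho' sigma' (hd (val b)) (z b).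
  have H1 := back_out_im lf no2 potS nok modY rho' sigmaK' z'.
  have H2 := sum_StarOut_eq0 (sigma := sigma) potS nok modM rhoK z' n0.
  split=> [[m mE]|[m mE]].
    have /H1/H2[m' m'E] : exists g, forall b : out_arrow Q k, back_off rho' sigma' (hd (val b))
        (act1 (back_rep rho' sigma') (hd (val b)) (val b) k g) = z' b.
      by exists m => b; rewrite mE.
    by exists m' => b; rewrite comp_lfunE m'E.
  have /H2/H1[m' m'E] : exists g, forall b : out_arrow Q k,
      act1 M (hd (val b)) (val b) k g = from_off k M (Mbar k S M) (hd (val b)) (z' b).
    by exists m => b; rewrite mE comp_lfunE.
  by exists m' => b; apply: (from_off_inj (out_off lf b) (m'E b)).
- rewrite [RHS]comp_lfunE (back_comp lf no2 potS modY) [RHS](premut_Comp lf).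
  by congr (act1 _ _ _ _ (act1 _ _ _ _ _)); rewrite comp_lfunE.
Qed.
End Back.

Section Forth.
Variable Y : rep K Qm.
Hypothesis modY : is_module Sm Y.
Variables (rho' : 'Hom(Mout k Y, ker_gamma k Sm Y))
  (sigma' : 'Hom(ker_alpha_mod k Sm Y, ker_alpha k Y)).
Hypothesis rhoK' : (rho' \o vincl (lker (gamma k Sm Y)))%VF = \1%VF.
Hypothesis sigmaK' : (pi_map k Sm Y \o sigma')%VF = \1%VF.
Local Notation G := (back_rep rho' sigma').
Local Notation w := (back_off rho' sigma').
Variables (rho : 'Hom(Mout k G, ker_gamma k S G))
  (sigma : 'Hom(ker_alpha_mod k S G, ker_alpha k G)).
Hypothesis rhoK : (rho \o vincl (lker (gamma k S G)))%VF = \1%VF.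
Hypothesis sigmaK : (pi_map k S G \o sigma)%VF = \1%VF.
Local Notation X := (premut_rep 1 rho sigma).
Local Notation fo := (from_off k G (Mbar k S G)).

Lemma forth_back_iso : exists (eta : maps X Y) (eta' : maps Y X),
  [/\ is_hom eta, is_hom eta',
      forall i, i != k -> eta i = (w i \o fo i)%VF &
      forall i, i != k -> eta' i = (to_off k G (Mbar k S G) i \o from_back rho' sigma' i)%VF].
Proof.
have modG := back_module lf no2 potS nok modY rhoK' sigmaK'.
have n0 : 1 != 0 :> K by apply: oner_neq0.
have lfm := premut_loopfree lf no2.
have nG := proj1 modG.
apply: (extend_iso lfm) => [i y ik|i y ik|c y|x|z|a b].
- by rewrite !comp_lfunE to_offK // from_backK.
- by rewrite !comp_lfunE back_offK // from_offK.
- case: c y => -[c|b a|a|b] ck y.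
  + rewrite comp_lfunE [X in w _ X](premut_Keep (c := c)) (back_off_arrow lf no2 potS modY).
    by congr (rmap Y _ _); rewrite comp_lfunE.
  + rewrite comp_lfunE [X in w _ X](premut_Comp lf) (back_comp lf no2 potS modY).
    by congr (rmap Y _ _); rewrite comp_lfunE.
  + by exfalso; have := ck; rewrite /= eqxx andbF.
  + by exfalso; have := ck; rewrite /= eqxx.
- pose x' (b : out_arrow Q k) : X (hd (val b)) := x (star_out_arrow b).
  have H1 := sum_StarOut_eq0 (sigma := sigma) potS nok modG rhoK x' n0.
  have H2 := back_out_im lf no2 potS nok modY rho' sigmaK'
    (fun b : out_arrow Q k => w (hd (val b)) (fo (hd (val b)) (x' b))).
  have -> : \sum_i act1 X k (val i) (tl (val i)) (x i) =
      \sum_b (rmap X (StarOut b : arrow Qm) (x' b) : X k).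
    by rewrite (big_in_premut lf); apply: eq_bigr => b _; rewrite -[in RHS]act1E.
  have -> : \sum_i act1 Y k (val i) (tl (val i)) ((w (tl (val i)) \o fo (tl (val i)))%VF (x i)) =
      \sum_b (rmap Y (StarOut b : arrow Qm) (w (hd (val b)) (fo (hd (val b)) (x' b))) : Y k).
    by rewrite (big_in_premut lf); apply: eq_bigr => b _; rewrite -[in RHS]act1E comp_lfunE.
  split=> [/H1[m mE]|/H2[m mE]]; first by apply/H2; exists m => b; rewrite mE.
  by apply/H1; exists m => b; apply: (from_off_inj (out_off lf b) (mE b)).
- pose z' (a : in_arrow Q k) : X (tl (val a)) := z (star_in_arrow a).
  have H1 := StarIn_im lf 1 rho potS nok modG sigmaK (fun a => fo (tl (val a)) (z' a)).
  have H2 := back_in_eq0 lf no2 potS nok modY rhoK' (fun a => fo (tl (val a)) (z' a)).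
  split=> [[m mE]|[m mE]].
    have /H1/H2[m' m'E] : exists y : X k, forall a : in_arrow Q k,
        fo (tl (val a)) (rmap X (StarIn a : arrow Qm) y) = fo (tl (val a)) (z' a).
      by exists m => a; have := mE (star_in_arrow a); rewrite -act1E => ->.
    exists m' => o; have [a ->] := out_premutP lf o.
    by rewrite [RHS]comp_lfunE [act1 Y _ _ _](act1E Y (StarIn a : arrow Qm)) m'E.
  have /H2/H1[m' m'E] : exists y : Y k, forall a : in_arrow Q k,
      rmap Y (StarIn a : arrow Qm) y = w (tl (val a)) (fo (tl (val a)) (z' a)).
    by exists m => a; have := mE (star_in_arrow a); rewrite [RHS]comp_lfunE -[rmap Y _]act1E.
  exists m' => o; have [a ->] := out_premutP lf o.
  rewrite [act1 X _ _ _](act1E X (StarIn a : arrow Qm)).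
  exact: (from_off_inj (in_off lf a) (m'E a)).
- have [a' ->] := out_premutP lf a; have [b' ->] := in_premutP lf b; move=> y {a b}.
  have tb : (w (hd (val b')) \o fo (hd (val b')))%VF y = w (hd (val b')) (fo (hd (val b')) y).
    by rewrite comp_lfunE.
  rewrite [act1 X _ (val (star_out_arrow b')) _](act1E X (StarOut b' : arrow Qm)).
  rewrite [act1 X _ (val (star_in_arrow a')) _](act1E X (StarIn a' : arrow Qm)).
  rewrite [act1 Y _ (val (star_out_arrow b')) _](act1E Y (StarOut b' : arrow Qm)).
  rewrite [act1 Y _ (val (star_in_arrow a')) _](act1E Y (StarIn a' : arrow Qm)).
  (* On [X], [a^* b^*] acts as minus the derivative of [S] along [ba], hence as minus its bracket on
     [Y], which the relation of [[ba]] turns into [a^* b^*] on [Y]. *)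
  rewrite [RHS]comp_lfunE [X in w _ X](StarIn_StarOut lf) scaleN1r linearN.
  rewrite [X in - X](back_bracket_eval lf no2 potS modY) ?(in_off lf) ?(out_off lf) //.
  by rewrite [X in - X](premut_Comp_rel nok modY) opprK -tb.
Qed.

End Forth.
End BackForth.

(** * The mutation functors *)

Section PullbackModule.
Variables (K : fieldType) (V : finType) (Q Q' : quiver V).
Variables (S : cpa K Q) (S' : cpa K Q') (f : cpa K Q -> cpa K Q').
Hypotheses (lf : forall a : arrow Q, tl a != hd a) (mf : cpa_morph f).
Hypothesis fS : forall a, jacobian S' (f (dcyc a S)).
Local Notation pb := (pullback (fun c => f (arr_el c))).

Lemma morph_pullback_nilpotent N : nilpotent N -> nilpotent (pb N).
Proof.
move=> nN; apply: (nilpotent_pullback nN) => c; last exact: (morph_depth1 mf).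
exact: (cm_corner mf (corner_arr _ _)).
Qed.

Lemma morph_eval_pullback N x i j : nilpotent N -> eval (pb N) x i j = eval N (f x) i j.
Proof.
by move=> nN; apply: eval_pullback => //; apply: morph_pullback_nilpotent.
Qed.

Lemma morph_pullback_module N : is_module S' N -> is_module S (pb N).
Proof.
move=> modN; have nN := proj1 modN; split=> [|a i j]; first exact: morph_pullback_nilpotent.
rewrite morph_eval_pullback //; exact: is_module_jacobian (fS a).
Qed.

End PullbackModule.

Lemma eq_mod_simple_off (K : fieldType) (V : finType) (Q : quiver V) (k : V)
    (M N : rep K Q) (f g : maps M N) i : eq_mod_simple k f g -> i != k -> f i = g i.
Proof. by move=> fg ik; apply/eqP; rewrite -subr_eq0 (in_add_simple_off fg ik). Qed.

Section PremutMaps.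
Variables (K : fieldType) (V : finType) (Q : quiver V) (k : V).
Variables (T : cpa K Q) (ch : premut_choice k T) (s : K).

Lemma premut_maps_off (M N : rep K Q) (f : maps M N) i : i != k ->
  premut_maps ch f s i =
  (to_off k N (Mbar k T N) i \o (f i \o from_off k M (Mbar k T M) i))%VF.
Proof.
move=> ik; apply/lfunP => y; apply: (from_off_inj ik).
by rewrite pm_from_off !comp_lfunE to_offK.
Qed.

Lemma premut_maps_id (M : rep K Q) i : i != k ->
  premut_maps ch (fun i => \1%VF : 'End(M i)) s i = \1%VF.
Proof.
move=> ik; apply/lfunP => y; apply: (from_off_inj ik).
by rewrite pm_from_off !id_lfunE.
Qed.

Lemma premut_maps_comp (L M N : rep K Q) (g : maps M N) (f : maps L M) i : i != k ->
  premut_maps ch (comp_maps g f) s i = (premut_maps ch g s i \o premut_maps ch f s i)%VF.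
Proof.
move=> ik; apply/lfunP => y; apply: (from_off_inj ik).
by rewrite comp_lfunE !pm_from_off comp_lfunE.
Qed.

End PremutMaps.

(** The components are prescribed off [k] only. Extensions at [k] are chosen separately for each
    object, which is harmless as naturality is tested off [k]. *)
Lemma nat_iso_off (K : fieldType) (V : finType) (Q : quiver V) (S : cpa K Q) (k : V)
    (D : category) (F G : functor D (stable_cat S k))
    (p : forall X, maps (F X : fdmod S) (G X : fdmod S))
    (q : forall X, maps (G X : fdmod S) (F X : fdmod S)) :
    (forall a : arrow Q, tl a != hd a) ->
    (forall X, exists (eta : maps (F X : fdmod S) (G X : fdmod S))
                      (eta' : maps (G X : fdmod S) (F X : fdmod S)),
      [/\ is_hom eta, is_hom eta', forall i, i != k -> eta i = p X i &
          forall i, i != k -> eta' i = q X i]) ->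
    (forall X i y, i != k -> q X i (p X i y) = y) ->
    (forall X i y, i != k -> p X i (q X i y) = y) ->
    (forall (X Y : obj D) (f : Defs.hom X Y) i y, i != k ->
      p Y i (fd_maps (fmap F f : fdhom _ _) i y) =
      fd_maps (fmap G f : fdhom _ _) i (p X i y)) ->
  nat_iso F G.
Proof.
move=> lf ex qp pq nat.
have ex' X : {eta : fdhom (F X : fdmod S) (G X : fdmod S) &
    {eta' : fdhom (G X : fdmod S) (F X : fdmod S) |
     (forall i, i != k -> fd_maps eta i = p X i) /\
     (forall i, i != k -> fd_maps eta' i = q X i)}}.
  have [eta /cid[eta' [h h' E E']]] := cid (ex X).
  by exists (FdHom h), (FdHom h').
exists (fun X => projT1 (ex' X)) => [X|X Y f].
  case: (ex' X) => eta [eta' [E E']] /=; exists eta'.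
    apply: (eq_mod_simple_offk lf) => [||i ik]; [exact: is_hom_comp (fd_hom _) (fd_hom _)|exact: is_hom_id|].
    by apply/lfunP => y; rewrite comp_lfunE E // E' // qp // id_lfunE.
  apply: (eq_mod_simple_offk lf) => [||i ik]; [exact: is_hom_comp (fd_hom _) (fd_hom _)|exact: is_hom_id|].
  by apply/lfunP => y; rewrite comp_lfunE E // E' // pq // id_lfunE.
have [_ [EX _]] := projT2 (ex' X); have [_ [EY _]] := projT2 (ex' Y).
apply: (eq_mod_simple_offk lf) => [||i ik]; try exact: is_hom_comp (fd_hom _) (fd_hom _).
by apply/lfunP => y; rewrite [LHS]comp_lfunE [RHS]comp_lfunE EX // EY // nat.
Qed.

Section Mutation.
Variables (K : fieldType) (V : finType) (Q : quiver V) (S : cpa K Q) (k : V).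
Hypotheses (lf : forall a : arrow Q, tl a != hd a) (no2 : no_2cycle_at Q k).
Hypotheses (potS : is_potential S) (nok : no_cycle_begins S k).
Variables (Qt Qr : quiver V) (Sr : cpa K Qr).
Hypothesis lfr : forall a : arrow Qr, tl a != hd a.
Variable phi : {rmorphism cpa K (qsum Qt Qr) -> cpa K (premut Q k)}.
Local Notation Qm := (premut Q k).
Local Notation Sm := (premut_pot k 1 S).
Local Notation phr := (phi_r phi).
Variable chi : cpa K Qm -> cpa K Qr.
Hypotheses (mphi : cpa_morph phr) (Jphi : forall a, jacobian Sm (phr (dcyc a Sr))).
Hypotheses (mchi : cpa_morph chi) (chiK : forall x, chi (phr x) = x).
Hypotheses (Jchi : forall x, jacobian Sm x -> jacobian Sr (chi x)).
Hypotheses (phichi : forall x, jacobian Sm (phr (chi x) - x)).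
Variables (ch : premut_choice k S) (ch' : premut_choice k Sm).

Let lfm : forall a : arrow Qm, tl a != hd a := premut_loopfree lf no2.
Let ss : 1 * 1 = 1 :> K. Proof. exact: mulr1. Qed.
Let mut (M : rep K Q) := premut_rep 1 (ch_rho ch M) (ch_sigma ch M).
Let inv_pb (N : rep K Qr) := pullback (phi_r_inv S phi) N.

Lemma mut_module (M : rep K Q) : is_module S M -> is_module Sm (mut M).
Proof. by move=> modM; apply: premut_rep_module => //; [exact: ch_rhoK | exact: ch_sigmaK]. Qed.

(** Applying [chi] to the congruence defining [phi_r_inv c] identifies it with [chi (arr_el c)]
    modulo the Jacobian ideal; by [phichi] such a preimage exists. *)
Lemma phi_r_inv_chi N c i j : is_module Sr N ->
  eval N (phi_r_inv S phi c) i j = eval N (chi (arr_el c)) i j.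
Proof.
move=> modN; apply/eqP; rewrite -subr_eq0 -evalB; apply/eqP.
apply: (is_module_jacobian _ _ modN).
rewrite /phi_r_inv; case: pselect => [e|[]]; last by exists (chi (arr_el c)).
by have := Jchi (projT2 (cid e)); rewrite (cmB mchi) chiK.
Qed.

Lemma inv_pbE N : is_module Sr N ->
  rmap (inv_pb N) = rmap (pullback (fun c => chi (arr_el c)) N).
Proof.
by move=> modN; apply: functional_extensionality_dep => c; apply: phi_r_inv_chi.
Qed.

Lemma inv_pb_module N : is_module Sr N -> is_module Sm (inv_pb N).
Proof.
(* Both representations have the same spaces, so it is enough to rewrite the family of arrow
   maps. *)
move=> modN; rewrite -[inv_pb N]/(Rep (rmap (inv_pb N))) inv_pbE //.
apply: (morph_pullback_module lfm mchi _ modN) => a; exact: Jchi (dcyc_jacobian _ _).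
Qed.

Lemma eval_inv_pb N x i j : is_module Sr N -> eval (inv_pb N) x i j = eval N (chi x) i j.
Proof.
move=> modN; rewrite -[inv_pb N]/(Rep (rmap (inv_pb N))) inv_pbE //.
by apply: (morph_eval_pullback lfm mchi); case: modN.
Qed.

Lemma mu_plus_module M : is_module S M -> is_module Sr (mu_plus_obj phi ch M).
Proof. by move=> modM; apply: (morph_pullback_module lfr mphi Jphi); apply: mut_module. Qed.

Lemma mu_minus_module N : is_module Sr N -> is_module S (mu_minus_obj phi ch' N).
Proof.
move=> modN; apply: (back_module lf no2 potS nok (inv_pb_module modN)).
  exact: ch_rhoK.
exact: ch_sigmaK.
Qed.

Lemma mu_plus_hom M N (f : maps M N) : is_module S M -> is_module S N -> is_hom f ->
  is_hom (mu_plus_maps phi ch f).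
Proof.
move=> modM modN hf; apply: hom_pullback; [by case: (mut_module modM)|by case: (mut_module modN)|].
exact: premut_maps_hom.
Qed.

Lemma mu_plus_induces : induces S Sr k (mu_plus_maps phi ch).
Proof.
split=> [M|M N f|M N f g modM modN hf hg fg|M modM|L M N g f modL modM modN hg hf].
- exact: mu_plus_module.
- exact: mu_plus_hom.
- apply: (eq_mod_simple_offk lfr); [exact: mu_plus_hom|exact: mu_plus_hom|] => i ik.
  by rewrite /mu_plus_maps !premut_maps_off // (eq_mod_simple_off fg ik).
- apply: (eq_mod_simple_offk lfr) => [||i ik]; [|exact: is_hom_id|exact: premut_maps_id].
  by apply: mu_plus_hom => //; apply: is_hom_id.
apply: (eq_mod_simple_offk lfr) => [||i ik]; last exact: premut_maps_comp.
  by apply: mu_plus_hom => //; apply: is_hom_comp.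
by apply: is_hom_comp; apply: mu_plus_hom.
Qed.

Lemma mu_minus_hom M N (f : maps M N) : is_module Sr M -> is_module Sr N -> is_hom f ->
  is_hom (mu_minus_maps phi ch' f).
Proof.
move=> modM modN hf; have modM' := inv_pb_module modM; have modN' := inv_pb_module modN.
have potm : is_potential Sm := premut_potential potS.
have nokm : no_cycle_begins Sm k := premut_nok lf nok.
have no2m := premut_no2 lf no2.
have hf' : @is_hom _ _ _ (inv_pb M) (inv_pb N) f.
  by apply: hom_pullback hf; [case: modM|case: modN].
apply: hom_pullback; last exact: (premut_maps_hom lfm ch' potm nokm modM' modN' hf').
  exact: (premut_nilpotent lfm no2m).
exact: (premut_nilpotent lfm no2m).
Qed.

Lemma mu_minus_induces : induces Sr S k (mu_minus_maps phi ch').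
Proof.
split=> [M|M N f|M N f g modM modN hf hg fg|M modM|L M N g f modL modM modN hg hf].
- exact: mu_minus_module.
- exact: mu_minus_hom.
- apply: (eq_mod_simple_offk lf); [exact: mu_minus_hom|exact: mu_minus_hom|] => i ik.
  by rewrite /mu_minus_maps !premut_maps_off // (eq_mod_simple_off fg ik).
- apply: (eq_mod_simple_offk lf) => [||i ik]; [|exact: is_hom_id|exact: premut_maps_id].
  by apply: mu_minus_hom => //; apply: is_hom_id.
apply: (eq_mod_simple_offk lf) => [||i ik]; last first.
  exact: (@premut_maps_comp _ _ _ _ _ ch' (-1) (inv_pb L) (inv_pb M) (inv_pb N) g f i ik).
  by apply: is_hom_comp; apply: mu_minus_hom.
by apply: mu_minus_hom => //; apply: is_hom_comp.
Qed.

(** At [k] this is 0; only its values off [k], identities up to the two case distinctions, are ever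
    used. *)
Definition minus_plus (M : rep K Q) i : 'Hom(mu_minus_obj phi ch' (mu_plus_obj phi ch M) i, M i) :=
  (from_off k M (Mbar k S M) i \o
   @from_off K V Qm k (inv_pb (mu_plus_obj phi ch M)) (Mbar k Sm _) i)%VF.

Definition minus_plus_inv (M : rep K Q) i : 'Hom(M i, mu_minus_obj phi ch' (mu_plus_obj phi ch M) i) :=
  (@to_off K V Qm k (inv_pb (mu_plus_obj phi ch M)) (Mbar k Sm _) i \o
   to_off k M (Mbar k S M) i)%VF.

Definition plus_minus (N : rep K Qr) i : 'Hom(mu_plus_obj phi ch (mu_minus_obj phi ch' N) i, N i) :=
  (@from_off K V Qm k (inv_pb N) (Mbar k Sm _) i \o
   from_off k (mu_minus_obj phi ch' N) (Mbar k S _) i)%VF.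

Definition plus_minus_inv (N : rep K Qr) i : 'Hom(N i, mu_plus_obj phi ch (mu_minus_obj phi ch' N) i) :=
  (to_off k (mu_minus_obj phi ch' N) (Mbar k S _) i \o
   @to_off K V Qm k (inv_pb N) (Mbar k Sm _) i)%VF.

Lemma minus_plusK M i y : i != k -> minus_plus_inv M i (minus_plus M i y) = y.
Proof. by move=> ik; rewrite !comp_lfunE from_offK ?[LHS]from_offK. Qed.

Lemma minus_plus_invK M i y : i != k -> minus_plus M i (minus_plus_inv M i y) = y.
Proof. by move=> ik; rewrite !comp_lfunE [X in from_off _ _ _ _ X]to_offK ?[LHS]to_offK. Qed.

Lemma plus_minusK N i y : i != k -> plus_minus_inv N i (plus_minus N i y) = y.
Proof. by move=> ik; rewrite !comp_lfunE [X in to_off _ _ _ _ X]from_offK ?[LHS]from_offK. Qed.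

Lemma plus_minus_invK N i y : i != k -> plus_minus N i (plus_minus_inv N i y) = y.
Proof. by move=> ik; rewrite !comp_lfunE to_offK ?[LHS]to_offK. Qed.

Lemma minus_plus_nat M N (f : maps M N) i y :
  minus_plus N i (mu_minus_maps phi ch' (mu_plus_maps phi ch f) i y) =
  f i (minus_plus M i y).
Proof.
rewrite [LHS]comp_lfunE [X in from_off _ _ _ _ X]pm_from_off [LHS]pm_from_off.
by rewrite comp_lfunE.
Qed.

Lemma plus_minus_nat M N (f : maps M N) i y :
  plus_minus N i (mu_plus_maps phi ch (mu_minus_maps phi ch' f) i y) =
  f i (plus_minus M i y).
Proof.
rewrite [LHS]comp_lfunE [X in from_off _ _ _ _ X]pm_from_off [LHS]pm_from_off.
by rewrite comp_lfunE.
Qed.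

Lemma mu_minus_plus M : is_module S M ->
  exists (eta : maps (mu_minus_obj phi ch' (mu_plus_obj phi ch M)) M)
         (eta' : maps M (mu_minus_obj phi ch' (mu_plus_obj phi ch M))),
  [/\ is_hom eta, is_hom eta', forall i, i != k -> eta i = minus_plus M i &
      forall i, i != k -> eta' i = minus_plus_inv M i].
Proof.
move=> modM; have modX := mut_module modM; have modN := mu_plus_module modM.
apply: (back_forth_iso lf no2 potS nok modM (ch_rhoK ch M) (ch_sigmaK ch M)); last 2 first.
- exact: ch_rhoK.
- exact: ch_sigmaK.
(* The arrow [c] acts on the intermediate module as [phi_r (chi c)], congruent to [c] modulo the
   Jacobian ideal. *)
apply: functional_extensionality_dep => c; rewrite [LHS](phi_r_inv_chi _ _ _ modN).
rewrite [LHS](morph_eval_pullback lfr mphi _ _ _ (proj1 modX)).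
have := is_module_jacobian (hd c) (tl c) modX (phichi (arr_el c)).
by rewrite evalB eval_arr ?act1E; [move/eqP; rewrite subr_eq0 => /eqP | case: modX].
Qed.

Lemma mu_plus_minus N : is_module Sr N ->
  exists (eta : maps (mu_plus_obj phi ch (mu_minus_obj phi ch' N)) N)
         (eta' : maps N (mu_plus_obj phi ch (mu_minus_obj phi ch' N))),
  [/\ is_hom eta, is_hom eta', forall i, i != k -> eta i = plus_minus N i &
      forall i, i != k -> eta' i = plus_minus_inv N i].
Proof.
move=> modN; have modN' := inv_pb_module modN; have modG := mu_minus_module modN.
have [eta [eta' [h h' E E']]] := forth_back_iso lf no2 potS nok modN'
  (ch_rhoK ch' _) (ch_sigmaK ch' _) (ch_rhoK ch (mu_minus_obj phi ch' N)) (ch_sigmaK ch _).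
have modX := mut_module modG; have [nX nN'] := (proj1 modX, proj1 modN').
(* Pulling back along [phi_r] undoes [phi_r_inv], as [chi] is a left inverse of [phi_r]; so the
   morphisms found over the pre-mutated quiver are morphisms over the reduced one. *)
have rE c : eval (inv_pb N) (phr (arr_el c)) (hd c) (tl c) = rmap N c.
  by rewrite eval_inv_pb // chiK eval_arr ?act1E //; case: modN.
exists eta, eta'; split=> // c.
  by rewrite -rE; apply: (hom_pullback (fun c => phr (arr_el c)) nX nN' h).
by rewrite -rE; apply: (hom_pullback (fun c => phr (arr_el c)) nN' nX h').
Qed.

End Mutation.

Theorem theorem5p1 (K : closedFieldType) (V : finType) (Q : quiver V)
    (S : cpa K Q) (k : V)
    (QP : is_qp S) (QPred : reduced S)
    (no2 : no_2cycle_at Q k) (nok : no_cycle_begins S k)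
    (Qt Qr : quiver V) (St : cpa K Qt) (Sr : cpa K Qr)
    (phi : {rmorphism cpa K (qsum Qt Qr) -> cpa K (premut Q k)})
    (split : splitting St Sr (premut_pot k 1 S) phi)
    (ch : premut_choice k S) (ch' : premut_choice k (premut_pot k 1 S)) :
  exists (wp : induces S Sr k (mu_plus_maps phi ch))
         (wm : induces Sr S k (mu_minus_maps phi ch')),
    quasi_inverse (induced_functor wp) (induced_functor wm).
Proof.
have lf := qp_loopfree QP; have potS := qp_potential QP.
have lfr := qp_loopfree (sp_red_qp split).
have [chi [mphi Jphi mchi [chiK Jchi] phichi]] := splitting_reduction split (premut_loopfree lf no2).
have wp := mu_plus_induces lf no2 potS nok lfr mphi Jphi ch.
have wm := mu_minus_induces lf no2 potS nok mchi chiK Jchi phichi ch'.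
exists wp, wm; split.
  apply: (@nat_iso_off K V Q S k _ (comp_functor (induced_functor wm) (induced_functor wp)) (id_functor _)
    (fun M : fdmod S => minus_plus phi ch ch' M) (fun M : fdmod S => minus_plus_inv phi ch ch' M) lf).
  - by move=> M; apply: (mu_minus_plus lf no2 potS nok lfr mphi Jphi mchi chiK Jchi phichi ch ch' (fd_ok M)).
  - by move=> M i y; apply: minus_plusK.
  - by move=> M i y; apply: minus_plus_invK.
  - by move=> M N f i y _; apply: minus_plus_nat.
apply: (@nat_iso_off K V Qr Sr k _ (comp_functor (induced_functor wp) (induced_functor wm)) (id_functor _)
  (fun N : fdmod Sr => plus_minus phi ch ch' N) (fun N : fdmod Sr => plus_minus_inv phi ch ch' N) lfr).
- by move=> N; apply: (mu_plus_minus lf no2 potS nok mchi chiK Jchi phichi ch ch' (fd_ok N)).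
- by move=> N i y; apply: plus_minusK.
- by move=> N i y; apply: plus_minus_invK.
- by move=> M N f i y _; apply: plus_minus_nat.
Qed.
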